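(* Assume that the scheme is Cauchy-stable, i.e. $\left|\sum_{k=-r}^{p} a_k e^{ik\xi}\right|\leq 1$ for all $\xi\in\mathbb{R}$. Let $\Delta$ be the intrinsic Kreiss-Lopatinskii determinant and let $\Delta(\mathbb{S})$ be the closed parametrized curve $\theta\in[0,2\pi]\mapsto\Delta(e^{i\theta})$. (1) If $0\in\Delta(\mathbb{S})$, then there exists $z_0\in\mathbb{S}$ such that $\Delta(z_0)=0$. (2) If $0\notin\Delta(\mathbb{S})$, then $\Delta$ does not vanish on $\mathbb{S}$ and it has $r-\mathrm{Ind}_{\Delta(\mathbb{S})}(0)$ zeros (counted with multiplicity) in $\mathcal{U}$, where $\mathrm{Ind}_{\Delta(\mathbb{S})}(0)$ is the winding number of the origin with respect to $\Delta(\mathbb{S})$. In this case, if $\mathrm{Ind}_{\Delta(\mathbb{S})}(0)=r$ then the scheme is strongly stable; otherwise the scheme is not strongly stable.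
   Context: Notation: $\mathbb{S}=\{|z|=1\}$, $\mathbb{D}=\{|z|<1\}$, $\mathcal{U}=\{|z|>1\}$, $\overline{\mathcal{U}}=\{|z|\geq 1\}$ in $\mathbb{C}$. Scheme: let $r,p\geq 1$ be integers, $a_{-r},\dots,a_p$ complex coefficients with $a_{-r}\neq 0$ and $a_p\neq 0$, $m\geq p+r$ an integer, and $(b_{j,k})_{-r\leq j\leq -1,\ 0\leq k\leq m-1}$ complex coefficients. The scheme is $$U_j^{n+1}=\sum_{k=-r}^{p}a_kU_{j+k}^n\ (j\geq 0,\,n\geq0),\qquad U_j^n=\sum_{k=0}^{m-1}b_{j,k}U_k^n+g_j^n\ (-r\leq j\leq -1,\,n\geq 0),\qquad U_j^0=f_j\ (j\geq 0).$$ It discretizes $\partial_tu+a\partial_xu=0$ on $x\geq 0$ with velocity $a>0$, with space step $\Delta x>0$ and time step $\Delta t>0$ related by a fixed ratio $\lambda=a\Delta t/\Delta x$ (the coefficients $a_k,b_{j,k}$ do not depend on $\Delta x$). The boundary matrix $\mathcal{B}\in\mathcal{M}_{r,m}(\mathbb{C})$ (rows indexed by $i=0,\dots,r-1$, columns by $k=0,\dots,m-1$) obtained by eliminating the ghost values $U_j^n$, $-r\leq j\leq -1$, from the first $r$ interior equations is $$\mathcal{B}_{i,k}=a_{k-i}+\sum_{l=-r}^{-1}a_{l-i}\,b_{l,k},\qquad\text{with the convention } a_q=0 \text{ if } q\notin\{-r,\dots,p\}.$$ Strong stability: the scheme is strongly stable if, for $(f_j)=0$, there exist $C>0$ and $\alpha_0$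 such that for all $\alpha>\alpha_0$, all boundary data $(g_j^n)$ and all $\Delta x>0$, the solution satisfies $$\sum_{j=-r}^{-1}\sum_{n=0}^{\infty}\Delta t\,e^{-2\alpha n\Delta t}|U_j^n|^2+\left(\frac{\alpha-\alpha_0}{\alpha\Delta t+1}\right)\sum_{n=0}^{\infty}\sum_{j=0}^{\infty}\Delta t\,\Delta x\,e^{-2\alpha n\Delta t}|U_j^n|^2\leq C\sum_{j=-r}^{-1}\sum_{n=0}^{\infty}\Delta t\,e^{-2\alpha n\Delta t}|g_j^n|^2 .$$ Roots: the characteristic equation, with unknown $\kappa$ and parameter $z$, is $z\kappa^r=\sum_{k=-r}^{p}a_k\kappa^{r+k}$. Under Cauchy-stability, for $z\in\mathcal{U}$ it has exactly $r$ roots in $\mathbb{D}$ and $p$ roots in $\mathcal{U}$, counted with multiplicity, and none on $\mathbb{S}$. For $z\in\mathcal{U}$, let $\kappa_1(z),\dots,\kappa_M(z)$ be the distinct roots in $\mathbb{D}$, with multiplicities $\beta_1,\dots,\beta_M$, $\beta_1+\dots+\beta_M=r$. For $z\in\mathbb{S}$, the same notation denotes the $r$ roots (in $\overline{\mathbb{D}}$) ''coming from the inside'', i.e. the limit, as $z'\to z$ with $z'\in\mathcal{U}$, of the multiset of the $r$ roots in $\mathbb{D}$ for $z'$; $\kappa_1(z),\dots,\kappa_M(z)$ are its distinct elements and $\beta_1,\dots,\beta_M$ their multiplicities in this limit multiset. Matrices: for $0\leq i<j$ (and $i=j$ when $r=1$), $K_{i,j}(z)\in\mathcal{M}_{j-i+1,r}(\mathbb{C})$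 is the matrix whose $r$ columns are the rows of index $i$ to $j$ (included, indices starting at $0$) of the $r$ sequences $(q^{s}\kappa_\ell(z)^q)_{q\geq 0}$, $\ell=1,\dots,M$, $s=0,\dots,\beta_\ell-1$ (convention $0^0=1$), the columns being ordered in the same way for all $K_{i,j}(z)$ at a given $z$. The intrinsic Kreiss-Lopatinskii determinant is, for $z\in\overline{\mathcal{U}}$, $$\Delta(z)=\frac{\det\left(zK_{0,r-1}(z)-\mathcal{B}K_{0,m-1}(z)\right)}{\det K_{0,r-1}(z)}.$$ It does not depend on the ordering of the columns. It is holomorphic on $\mathcal{U}$ and continuous on $\overline{\mathcal{U}}$, so the curve $\Delta(\mathbb{S})$ is continuous. *)

(* Defs.v *)
From mathcomp Require Import all_boot all_order all_algebra.
From mathcomp Require Import complex.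
From mathcomp Require Import all_classical all_reals all_analysis.

Set Implicit Arguments.
Unset Strict Implicit.
Unset Printing Implicit Defensive.

Import Order.TTheory GRing.Theory Num.Theory.
Import numFieldNormedType.Exports.

Local Open Scope classical_set_scope.
Local Open Scope ring_scope.

Definition unit_circle (R : realType) : set R[i] := [set z | `|z| = 1].

Definition exterior (R : realType) : set R[i] := [set z | 1 < `|z|].

Definition expi (R : realType) (theta : R) : R[i] :=
  Complex (cos theta) (sin theta).

(* The modulus with values in R; `|z| lives in R[i]. *)
Definition modulus (R : realType) (z : R[i]) : R := Normc.normc z.

(* offset r 0, offset r 1, ... is -r, -r+1, ...: the stencil -r..p is
   enumerated by s < r+p+1 and the ghost indices -r..-1 by l < r. *)
Definition offset (r s : nat) : int := s%:Z - r%:Z.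

(* Coefficients are functions a : int -> R[i] and b : int -> nat -> R[i]. The
   convention a_q = 0 for q outside -r..p is a hypothesis of the theorem; b is
   only read at ghost rows -r..-1 and columns 0..m-1, and U only at j >= -r. *)
Definition is_solution (R : realType) (r p m : nat) (a : int -> R[i])
    (b : int -> nat -> R[i]) (f : nat -> R[i]) (g U : int -> nat -> R[i]) :=
  [/\ forall j n : nat, U j%:Z n.+1 =
        \sum_(s < (r + p).+1) a (offset r s) * U (j%:Z + offset r s) n,
      forall l n : nat, (l < r)%N -> U (offset r l) n =
        \sum_(k < m) b (offset r l) k * U k%:Z n + g (offset r l) n
    & forall j : nat, U j%:Z 0%N = f j].

Definition cauchy_stable (R : realType) (r p : nat) (a : int -> R[i]) :=
  forall xi : R, `|\sum_(s < (r + p).+1)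
    a (offset r s) * expi ((offset r s)%:~R * xi)| <= 1.

(* The sums are taken in \bar R, so boundary data of infinite norm are allowed
   and make the right-hand side infinite. *)
Definition strongly_stable (R : realType) (r p m : nat) (a : int -> R[i])
    (b : int -> nat -> R[i]) (velocity lambda : R) :=
  exists C alpha0 : R, 0 < C /\
  forall alpha : R, alpha0 < alpha ->
  forall (g : int -> nat -> R[i]) (dx : R), 0 < dx ->
  forall U : int -> nat -> R[i], is_solution r p m a b (fun _ => 0) g U ->
  let dt := lambda * dx / velocity in
  let weight (n : nat) := expR (- (2 * alpha * n%:R * dt)) in
  (\sum_(l < r) \sum_(0 <= n <oo)
      (dt * weight n * modulus (U (offset r l) n) ^+ 2)%:E
   + ((alpha - alpha0) / (alpha * dt + 1))%:E *
     \sum_(0 <= n <oo) \sum_(0 <= j <oo)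
      (dt * dx * weight n * modulus (U j%:Z n) ^+ 2)%:E
   <= C%:E * \sum_(l < r) \sum_(0 <= n <oo)
      (dt * weight n * modulus (g (offset r l) n) ^+ 2)%:E)%E.

Definition boundary_mx (R : realType) (r m : nat) (a : int -> R[i])
    (b : int -> nat -> R[i]) : 'M[R[i]]_(r, m) :=
  \matrix_(i < r, k < m) (a (k%:Z - i%:Z) +
    \sum_(l < r) a (offset r l - i%:Z) * b (offset r l) k).

(* Its roots are the solutions kappa of
   z kappa^r = \sum_(k = -r..p) a_k kappa^(r + k). *)
Definition char_poly_at (R : realType) (r p : nat) (a : int -> R[i]) (z : R[i])
    : {poly R[i]} :=
  \poly_(s < (r + p).+1) a (offset r s) - z *: 'X^r.

(* The roots of P, repeated according to multiplicity. *)
Definition poly_roots (R : realType) (P : {poly R[i]}) : seq R[i] :=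
  sval (closed_field_poly_normal P).

Definition interior_roots (R : realType) (r p : nat) (a : int -> R[i])
    (z : R[i]) : seq R[i] :=
  [seq kappa <- poly_roots (char_poly_at r p a z) | `|kappa| < 1].

(* s represents the limit, as w -> z with |w| > 1, of the multisets
   interior_roots w: for w close to z, the roots can be matched with s. *)
Definition is_limit_multiset (R : realType) (r p : nat) (a : int -> R[i])
    (z : R[i]) (s : seq R[i]) :=
  forall eps : R[i], 0 < eps ->
  \forall w \near within (exterior (R := R)) (nbhs (z : R[i]^o)),
    exists t : seq R[i],
      [/\ perm_eq t (interior_roots r p a w), size t = size s
        & forall i : nat, (i < size s)%N -> `|t`_i - s`_i| < eps].

(* The r roots coming from the inside, with multiplicity: the roots in the open
   unit disc if |z| > 1, their limit multiset if |z| = 1. *)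
Definition stable_roots (R : realType) (r p : nat) (a : int -> R[i])
    (z : R[i]) : seq R[i] :=
  if 1 < `|z| then interior_roots r p a z
  else xget [::] [set s | is_limit_multiset r p a z s].

(* The pairs (kappa_l, s) with s < beta_l, which index the columns. *)
Definition mode_indices (R : realType) (kappas : seq R[i]) : seq (R[i] * nat) :=
  [seq (kappa, s) | kappa <- undup kappas,
                    s <- iota 0 (count_mem kappa kappas)].

(* Kmx n is K_{0,n-1}(z). *)
Definition Kmx (R : realType) (r p n : nat) (a : int -> R[i]) (z : R[i])
    : 'M[R[i]]_(n, r) :=
  \matrix_(q < n, c < r)
    let mode := nth (0, 0%N) (mode_indices (stable_roots r p a z)) c in
    q%:R ^+ mode.2 * mode.1 ^+ q.

Definition KL_det (R : realType) (r p m : nat) (a : int -> R[i])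
    (b : int -> nat -> R[i]) (z : R[i]) : R[i] :=
  \det (z *: Kmx r p r a z - boundary_mx r m a b *m Kmx r p m a z)
  / \det (Kmx r p r a z).

(* f vanishes at z to order exactly n. *)
Definition zero_order (R : realType) (f : R[i] -> R[i]) (z : R[i]) (n : nat) :=
  exists g : R[i]^o -> R[i]^o,
    [/\ \forall w \near (z : R[i]^o), derivable g w 1,
        g z != 0
      & \forall w \near (z : R[i]^o), f w = (w - z) ^+ n * g w].

(* f has exactly N zeros in A, counted with multiplicity. *)
Definition has_zero_count (R : realType) (f : R[i] -> R[i]) (A : set R[i])
    (N : int) :=
  exists s : seq R[i],
    [/\ forall z, z \in s <-> A z /\ f z = 0,
        forall z, z \in s -> zero_order f z (count_mem z s)
      & (size s)%:Z = N].

(* A continuous determination phi of the argument of gamma - w along [0, 2pi]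
   increases by 2 k pi. *)
Definition is_winding_number (R : realType) (gamma : R -> R[i]) (w : R[i])
    (k : int) :=
  exists phi : R -> R,
    [/\ {within `[0, 2 * pi], continuous phi},
        forall theta : R, 0 <= theta <= 2 * pi ->
          gamma theta - w = `|gamma theta - w| * expi (phi theta)
      & phi (2 * pi) - phi 0 = 2 * pi * k%:~R].

Definition winding_number (R : realType) (gamma : R -> R[i]) (w : R[i]) : int :=
  xget 0 [set k | is_winding_number gamma w k].

(* Main.v *)
Require Import Defs.
From mathcomp Require Import all_boot all_order all_algebra.
From mathcomp Require Import complex ring lra zify.
From mathcomp Require Import all_classical all_reals all_analysis.

Import Order.TTheory GRing.Theory Num.Theory.
Import numFieldNormedType.Exports.

Set Implicit Arguments.
Unset Strict Implicit.
Unset Printing Implicit Defensive.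

Local Open Scope classical_set_scope.
Local Open Scope ring_scope.

Local Notation Re := complex.Re.
Local Notation Im := complex.Im.


(** The determinant is studied in the variable w = 1 / z on the closed unit disc.
    Let A be the symbol, sum of the a_k X^(r + k). For modulus w < 1 the polynomial
    X^r - w * A, a multiple of the characteristic polynomial at z, splits into a
    monic factor Q w with the r roots inside the disc (sfactor; there are r of
    them by a comparison of winding numbers, size_inner) and a cofactor with no
    root in the closed disc. The factor Q w extends continuously to the closed
    disc (sfactor_cont), and on the circle its roots are the stable roots, since
    the limit of Q w exists there (limit_of_candidates).

    The columns of the matrices K satisfy the recurrence of characteristic
    polynomial Q w. They are therefore generated by the powers of its companion
    matrix, and the determinant of K_{0,r-1} cancels: Delta z = z^r * lop_det w,
    where lop_det w is a determinant whose entries are polynomials in w and in the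
    coefficients of Q w, with lop_det 0 = 1 (KL_detE).

    The coefficients of Q w are holomorphic on the disc. What this fact must
    provide is their divided differences, which are found algebraically from the
    factorization (sfactor_dd); all functions in the proof belong to the algebra
    that w and these coefficients generate, which is closed under divided
    differences (sgen_dda). In such an algebra the mean value property holds
    (mean_value), hence Jensen's bound on the number of zeros (jensen_bound) and
    the factorization of lop_det as a product of n linear factors and a function
    without zeros (dda_factor). A curve described by a function without zeros on
    the closed disc does not wind, so the winding number of Delta on the circle is
    r - n (argument_principle, lop_det_factor), n is the number of zeros of Delta
    outside the closed disc with multiplicities (KL_det_zero_count), and the
    winding number is r exactly when Delta has no zero there.

    If Delta has no zero for modulus z >= 1, the generating functions of the
    solutions with one unit datum are bounded on the disc. By Duhamel's formula the
    trace of a solution is a sum of convolutions of the data with their Taylor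
    coefficients, which are bounded in weighted square norms (taylor_multiplier,
    trace_bound). Away from the boundary the scheme does not increase the energy,
    by Cauchy stability, so the trace controls the whole solution (stable). If
    Delta vanishes at some z outside the closed disc, strong stability would bound
    the solution with a well-chosen datum so well that its Laplace transform at z
    would solve a singular linear system whose right-hand side is not in the range
    (not_stable). *)

(** * Moduli of complex numbers and points of the unit circle *)

Section Modulus.
Variable R : realType.
Implicit Types (x y z : R[i]) (t : R).

Lemma normE z : `|z| = (modulus z)%:C%C.
Proof. by rewrite normc_def; case: z. Qed.

Lemma modulus_ge0 z : 0 <= modulus z.
Proof. by case: z => a b; rewrite /modulus /Normc.normc sqrtr_ge0. Qed.

Lemma modulus0 : modulus (0 : R[i]) = 0. Proof. exact: Normc.normc0. Qed.
Lemma modulus1 : modulus (1 : R[i]) = 1. Proof. exact: Normc.normc1. Qed.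

Lemma modulus_eq0 z : (modulus z == 0) = (z == 0).
Proof.
apply/eqP/eqP => [|->]; [exact: Normc.eq0_normc|exact: modulus0].
Qed.

Lemma modulus_gt0 z : (0 < modulus z) = (z != 0).
Proof. by rewrite lt_def modulus_ge0 andbT modulus_eq0. Qed.

Lemma modulusM : {morph @modulus R : x y / x * y}.
Proof. exact: Normc.normcM. Qed.

Lemma modulusV : {morph @modulus R : z / z^-1}.
Proof. exact: Normc.normcV. Qed.

Lemma modulusN z : modulus (- z) = modulus z.
Proof. exact: complex.normcN. Qed.

Lemma modulusX z n : modulus (z ^+ n) = modulus z ^+ n.
Proof. by elim: n => [|n IH]; rewrite ?expr0 ?modulus1 // !exprS modulusM IH. Qed.

Lemma modulusD x y : modulus (x + y) <= modulus x + modulus y.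
Proof. exact: complex.le_normcD. Qed.

Lemma modulusB x y : modulus (x - y) <= modulus x + modulus y.
Proof. by rewrite -(modulusN y) modulusD. Qed.

Lemma modulus_distC x y : modulus (x - y) = modulus (y - x).
Proof. by rewrite -modulusN opprB. Qed.

Lemma modulus_dist3 x y z : modulus (x - z) <= modulus (x - y) + modulus (y - z).
Proof. by rewrite (le_trans _ (modulusD _ _)) // addrA subrK. Qed.

Lemma modulus_ge_dist x y : modulus x - modulus y <= modulus (x - y).
Proof. by rewrite lerBlDr (le_trans _ (modulusD _ _)) // subrK. Qed.

Lemma modulus_sum I (s : seq I) (P : pred I) (F : I -> R[i]) :
  modulus (\sum_(i <- s | P i) F i) <= \sum_(i <- s | P i) modulus (F i).
Proof.
elim/big_rec2: _ => [|i u v _ le_vu]; first by rewrite modulus0.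
by rewrite (le_trans (modulusD _ _)) // lerD2l.
Qed.

Lemma modulus_prod I (s : seq I) (P : pred I) (F : I -> R[i]) :
  modulus (\prod_(i <- s | P i) F i) = \prod_(i <- s | P i) modulus (F i).
Proof. exact: (big_morph _ modulusM modulus1). Qed.

Lemma modulus_real t : modulus t%:C%C = `|t|.
Proof. by rewrite /modulus /= expr0n addr0 sqrtr_sqr. Qed.

Lemma modulus_nat n : modulus (n%:R : R[i]) = n%:R.
Proof. by rewrite -[n%:R](rmorph_nat (real_complex R)) modulus_real normr_nat. Qed.

Lemma modulus_conj z : modulus z^*%C = modulus z.
Proof. by case: z => a b; rewrite /modulus /= sqrrN. Qed.

Lemma mul_conj z : z * z^*%C = (modulus z ^+ 2)%:C%C.
Proof. by rewrite -sqr_normc normE rmorphXn. Qed.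

Lemma modulus_Re z : `|Re z| <= modulus z.
Proof.
case: z => a b /=; rewrite /modulus /= -sqrtr_sqr ler_sqrt ?lerDl ?sqr_ge0 //.
by rewrite addr_ge0 ?sqr_ge0.
Qed.

Lemma modulus_Im z : `|Im z| <= modulus z.
Proof.
case: z => a b /=; rewrite /modulus /= -sqrtr_sqr ler_sqrt ?lerDr ?sqr_ge0 //.
by rewrite addr_ge0 ?sqr_ge0.
Qed.

Lemma norm_lt1 z : (`|z| < 1) = (modulus z < 1).
Proof. by rewrite normE ltcR. Qed.

Lemma norm_gt1 z : (1 < `|z|) = (1 < modulus z).
Proof. by rewrite normE ltcR. Qed.

Lemma norm_eq1 z : `|z| = 1 <-> modulus z = 1.
Proof. by rewrite normE; split => [[]|->]. Qed.

Lemma inv_outside z : 1 < modulus z -> z != 0 /\ modulus z^-1 < 1.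
Proof.
move=> z1; have z0 : 0 < modulus z by apply: lt_trans z1.
by rewrite -modulus_gt0 z0 modulusV invf_lt1.
Qed.

Lemma expi0 : expi (0 : R) = 1.
Proof. by rewrite /expi cos0 sin0. Qed.

Lemma expiD (s t : R) : expi (s + t) = expi s * expi t.
Proof.
rewrite /expi sinD cosD; apply/eqP; rewrite eq_complex /= eqxx /=.
by rewrite addrC.
Qed.

Lemma expiN t : expi (- t) = (expi t)^*%C.
Proof. by rewrite /expi cosN sinN. Qed.

Lemma modulus_expi t : modulus (expi t) = 1.
Proof. by rewrite /modulus /expi /= cos2Dsin2 sqrtr1. Qed.

Lemma expi_neq0 t : expi t != 0.
Proof. by rewrite -modulus_eq0 modulus_expi oner_eq0. Qed.

Lemma expiV t : expi (- t) = (expi t)^-1.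
Proof.
by apply: (mulfI (expi_neq0 t)); rewrite -expiD subrr expi0 divff ?expi_neq0.
Qed.

Lemma expiMn t n : expi (t *+ n) = expi t ^+ n.
Proof. by elim: n => [|n IH]; rewrite ?expi0 ?expr0 // mulrS exprS expiD IH. Qed.

Lemma expi2pi : expi (2 * pi : R) = 1.
Proof. by rewrite mulr_natl /expi cos2pi sin2pi. Qed.

Lemma expi_onto z : modulus z = 1 -> exists2 t, 0 <= t <= 2 * pi & z = expi t.
Proof.
case: z => a b; rewrite /modulus /= => /(congr1 (fun u : R => u ^+ 2)).
rewrite sqr_sqrtr ?addr_ge0 ?sqr_ge0 // expr1n => ab1.
have a_in : -1 <= a <= 1 by apply/andP; split; nra.
have pi0 := @acos_ge0 R a a_in; have pi1 := @acos_lepi R a a_in.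
have sq : 1 - a ^+ 2 = b ^+ 2 by rewrite -ab1; ring.
have [b_ge0|b_lt0] := leP 0 b.
  exists (acos a); first by lra.
  by rewrite /expi sin_acos // acosK ?in_itv //= sq sqrtr_sqr ger0_norm.
exists (2 * pi - acos a); first by lra.
rewrite addrC expiD expi2pi mulr1 expiN /expi sin_acos // acosK ?in_itv //=.
by rewrite sq sqrtr_sqr ltr0_norm // opprK.
Qed.

End Modulus.

(** * Continuity on a set, and compactness of closed discs *)

Section ContinuousOn.
Variables (R : realType) (T : topologicalType).
Implicit Types (f g : T -> R[i]) (D : set T).

(** Relative continuity with a real modulus, which avoids the complex-valued
    epsilons of the norm on R[i]. *)
Definition cont_on D f := forall t, D t -> forall e : R, 0 < e ->
  \forall u \near t, D u -> modulus (f u - f t) < e.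

Lemma cont_on_ext D f g : (forall t, D t -> f t = g t) ->
  cont_on D f -> cont_on D g.
Proof.
move=> fg cf t Dt e e0; have := cf t Dt e e0; apply: filterS => u h Du.
by rewrite -!fg //; apply: h.
Qed.

Lemma cont_on_sub D D' f : D' `<=` D -> cont_on D f -> cont_on D' f.
Proof.
move=> sDD' cf t Dt e e0; have := cf t (sDD' _ Dt) e e0.
by apply: filterS => u h Du; apply: h; apply: sDD'.
Qed.

Lemma cont_on_cst D c : cont_on D (fun=> c).
Proof. by move=> t Dt e e0; apply: nearW => u; rewrite subrr modulus0. Qed.

Lemma cont_onD D f g : cont_on D f -> cont_on D g ->
  cont_on D (fun t => f t + g t).
Proof.
move=> cf cg t Dt e e0; have e20 : 0 < e / 2 by lra.
have := cf t Dt _ e20; have := cg t Dt _ e20; apply: filterS2 => u hg hf Du.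
have := modulusD (f u - f t) (g u - g t); rewrite addrACA -opprD.
by have := hf Du; have := hg Du; lra.
Qed.

Lemma cont_onM D f g : cont_on D f -> cont_on D g ->
  cont_on D (fun t => f t * g t).
Proof.
move=> cf cg t Dt e e0.
pose K := 1 + modulus (f t) + modulus (g t).
have K1 : 1 <= K by have := modulus_ge0 (f t); have := modulus_ge0 (g t); rewrite /K; lra.
have d0 : 0 < Num.min 1 (e / (2 * K)) by rewrite lt_min ltr01 divr_gt0 //; lra.
have := cf t Dt _ d0; have := cg t Dt _ d0; apply: filterS2 => u hg hf Du.
have -> : f u * g u - f t * g t =
  (f u - f t) * (g u - g t) + (f u - f t) * g t + f t * (g u - g t) by ring.
have {hf} := hf Du; have {hg} := hg Du; rewrite !lt_min.
move=> /andP[g1 g2] /andP[f1 f2].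
have eE : e = 2 * K * (e / (2 * K)) by rewrite mulrCA divff ?mulr1 //; lra.
move: (e / _) eE g2 f2 => d -> g2 f2.
apply: (le_lt_trans (modulusD _ _)); rewrite modulusM.
apply: (@le_lt_trans _ _ (modulus (f u - f t) * modulus (g u - g t) +
   modulus (f u - f t) * modulus (g t) + modulus (f t) * modulus (g u - g t))).
  by rewrite lerD2r -!modulusM modulusD.
have := modulus_ge0 (f u - f t); have := modulus_ge0 (g u - g t).
have := modulus_ge0 (f t); have := modulus_ge0 (g t).
by rewrite /K; nra.
Qed.

Lemma cont_onN D f : cont_on D f -> cont_on D (fun t => - f t).
Proof.
move=> cf; apply: (@cont_on_ext _ (fun t => -1 * f t)) => [t _|].
  by rewrite mulN1r.
exact: cont_onM (@cont_on_cst _ _) cf.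
Qed.

Lemma cont_onV D f : (forall t, D t -> f t != 0) -> cont_on D f ->
  cont_on D (fun t => (f t)^-1).
Proof.
move=> f0 cf t Dt e e0; have m0 : 0 < modulus (f t) by rewrite modulus_gt0 f0.
have d0 : 0 < Num.min (modulus (f t) / 2) (e * modulus (f t) ^+ 2 / 2).
  by rewrite lt_min !divr_gt0 // mulr_gt0 // exprn_gt0.
have := cf t Dt _ d0; apply: filterS => u hf Du.
have {hf} := hf Du; rewrite !lt_min => /andP[f1 f2].
have fu0 := f0 u Du; have ft0 := f0 t Dt.
have -> : (f u)^-1 - (f t)^-1 = (f t - f u) / (f u * f t) by field; rewrite ft0 fu0.
rewrite modulusM modulusV modulusM ltr_pdivrMr ?mulr_gt0 ?modulus_gt0 //.
rewrite modulus_distC; apply: (lt_trans f2).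
have := modulus_ge_dist (f t) (f u); rewrite modulus_distC => h.
have UV : 0 < modulus (f u) - modulus (f t) / 2 by lra.
by have := mulr_gt0 (mulr_gt0 e0 m0) UV; lra.
Qed.

Lemma cont_onX D f n : cont_on D f -> cont_on D (fun t => f t ^+ n).
Proof.
move=> cf; elim: n => [|n IH].
  by apply: cont_on_ext (@cont_on_cst D 1) => t _; rewrite expr0.
by apply: cont_on_ext (cont_onM cf IH) => t _; rewrite exprS.
Qed.

Lemma cont_on_sum D I (s : seq I) (F : I -> T -> R[i]) :
  (forall i, cont_on D (F i)) -> cont_on D (fun t => \sum_(i <- s) F i t).
Proof.
move=> cF; elim: s => [|i s IH].
  by apply: cont_on_ext (@cont_on_cst D 0) => t _; rewrite big_nil.
by apply: cont_on_ext (cont_onD (cF i) IH) => t _; rewrite big_cons.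
Qed.

Lemma cont_on_prod D I (s : seq I) (F : I -> T -> R[i]) :
  (forall i, cont_on D (F i)) -> cont_on D (fun t => \prod_(i <- s) F i t).
Proof.
move=> cF; elim: s => [|i s IH].
  by apply: cont_on_ext (@cont_on_cst D 1) => t _; rewrite big_nil.
by apply: cont_on_ext (cont_onM (cF i) IH) => t _; rewrite big_cons.
Qed.

End ContinuousOn.

Lemma cont_on_comp (R : realType) (T S : topologicalType) (D : set T)
    (E : set S) (f : T -> S) (g : S -> R[i]) :
  continuous f -> (forall t, D t -> E (f t)) -> cont_on E g ->
  cont_on D (g \o f).
Proof.
move=> cf DE cg t Dt e e0.
have : \forall u \near t, E (f u) -> modulus (g (f u) - g (f t)) < e.
  exact: cf t _ (cg _ (DE _ Dt) e e0).
by apply: filterS => u h Du; apply: h; apply: DE.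
Qed.

Section ComplexTopology.
Variable R : realType.

Lemma nbhs_modulus (z : R[i]^o) (P : set R[i]) :
  nbhs z P <-> exists2 d : R, 0 < d & forall w, modulus (w - z) < d -> P w.
Proof.
split=> [/nbhs_normP[e /= e0 zP]|[d d0 zP]].
  exists (Re e); first by move: e0; rewrite ltcE => /andP[].
  move=> w wz; apply: zP => /=; rewrite distrC normE.
  by move: e0; rewrite !ltcE /= => /andP[/eqP-> _]; rewrite eqxx.
apply: (nbhs_normP (z : R[i]^o) P).2; exists d%:C%C; first by rewrite /= ltcR.
by move=> w /=; rewrite distrC normE ltcR; apply: zP.
Qed.

Lemma cont_onP (D : set R[i]^o) (f : R[i] -> R[i]) :
  cont_on D f <-> forall z, D z -> forall e : R, 0 < e -> exists2 d : R, 0 < d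
    & forall w, D w -> modulus (w - z) < d -> modulus (f w - f z) < e.
Proof.
split=> [cf z Dz e e0|cf z Dz e e0].
  have /nbhs_modulus[d d0 h] := cf z Dz e e0.
  by exists d => // w Dw wz; apply: h.
have [d d0 h] := cf z Dz e e0.
by apply/nbhs_modulus; exists d => // w wz Dw; apply: h.
Qed.

Lemma cont_on_id (D : set R[i]^o) : cont_on D (id : R[i]^o -> R[i]).
Proof. by apply/cont_onP => z _ e e0; exists e. Qed.

Lemma continuous_modulus (T : topologicalType) (f : T -> R[i]^o) :
  cont_on setT (f : T -> R[i]) -> continuous f.
Proof.
move=> cf t P /nbhs_modulus[d d0 zP]; have := cf t I d d0.
by apply: filterS => u /(_ I); apply: zP.
Qed.

Lemma cont_on_real (T : topologicalType) (f : T -> R) :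
  continuous f -> cont_on setT (fun t => (f t)%:C%C).
Proof.
move=> cf t _ e e0; have /cvgrPdist_lt/(_ e e0) := cf t; apply: filterS => u h _.
by rewrite -rmorphB modulus_real distrC.
Qed.

Lemma expiE (t : R) : expi t = (cos t)%:C%C + 'i%C * (sin t)%:C%C.
Proof. by rewrite [LHS]complexE. Qed.

Lemma cont_expi (T : topologicalType) (f : T -> R) :
  continuous f -> cont_on setT (fun t => expi (f t)).
Proof.
move=> cf; apply: (@cont_on_ext _ _ _
  (fun t => (cos (f t))%:C%C + 'i%C * (sin (f t))%:C%C)) => [t _|].
  by rewrite expiE.
apply: cont_onD; last apply: cont_onM (@cont_on_cst _ _ _ _) _.
  apply: (@cont_on_real _ (fun t => cos (f t))) => t.
  by apply: (continuous_comp (cf t)); apply: continuous_cos.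
apply: (@cont_on_real _ (fun t => sin (f t))) => t.
by apply: (continuous_comp (cf t)); apply: continuous_sin.
Qed.

Definition cdisc (rho : R) : set R[i]^o := [set w | modulus w <= rho].

Lemma polarE (w : R[i]) : exists2 t, 0 <= t <= 2 * pi
  & w = (modulus w)%:C%C * expi t.
Proof.
have [->|w0] := eqVneq w 0.
  by exists 0; rewrite ?modulus0 ?mul0r // lexx mulr_ge0 // pi_ge0.
have m0 : (modulus w)%:C%C != 0 :> R[i] by rewrite -modulus_eq0 modulus_real normr_eq0 modulus_eq0.
have /expi_onto[t t_in wE] : modulus (w / (modulus w)%:C%C) = 1.
  rewrite modulusM modulusV modulus_real ger0_norm ?modulus_ge0 // divff //.
  by rewrite modulus_eq0.
by exists t => //; rewrite -wE mulrC divfK.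
Qed.

(** A closed disc is the image of a rectangle by polar coordinates. *)
Lemma compact_cdisc rho : compact (cdisc rho).
Proof.
pose phi (x : R * R) : R[i]^o := x.1%:C%C * expi x.2.
have -> : cdisc rho = phi @` (`[0, rho] `*` `[0, 2 * pi]).
  apply/seteqP; split=> [w wr|_ [[x t] /= [x_in t_in] <-]].
    have [t t_in wE] := polarE w; exists (modulus w, t) => //=.
    by rewrite !in_itv /= modulus_ge0 t_in.
  move: x_in; rewrite in_itv /= => /andP[x0 xr].
  change (is_true (modulus (x%:C%C * expi t : R[i]) <= rho)).
  by rewrite modulusM modulus_expi modulus_real mulr1 ger0_norm.
apply: continuous_compact; last by apply: compact_setX; apply: segment_compact.
apply: continuous_subspaceT; apply: continuous_modulus; apply: cont_onM.
  by apply: cont_on_real => x; apply: cvg_fst.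
by apply: cont_expi => x; apply: cvg_snd.
Qed.

(** The form in which compactness of the closed disc is used: a property
    that holds near every point for all small enough parameters holds on the
    whole disc for one parameter. *)
Lemma cdisc_uniform rho (P : R -> R[i] -> Prop) :
  (forall w, modulus w <= rho -> exists2 e : R, 0 < e & forall d w', 0 < d < e ->
     modulus (w' - w) < e -> modulus w' <= rho -> P d w') ->
  exists2 d : R, 0 < d & forall w, modulus w <= rho -> P d w.
Proof.
move=> locP; have /compact_near_coveringP/near_covering_withinP := @compact_cdisc rho.
move=> /(_ _ (0^'+ : set_system R) P _) [].
  move=> w wr; have [e e0 we] := locP w wr.
  exists ([set w' | modulus (w' - w) < e], [set d | 0 < d < e]).
    split; first by apply/nbhs_modulus; exists e.
    near=> d; apply/andP; split; [near: d; exact: nbhs_right_gt|].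
    by near: d; exact: nbhs_right_lt.
  by move=> [w' d] /= [w'e de] w'r; apply: we.
move=> e /= e0 eP; exists (e / 2); first lra.
move=> w wr; apply: eP => //=; last lra.
by rewrite sub0r normrN ger0_norm; lra.
Unshelve. all: by end_near. Qed.

Lemma cont_on_bounded rho (f : R[i] -> R[i]) : cont_on (cdisc rho) f ->
  exists2 M : R, 0 < M & forall w, modulus w <= rho -> modulus (f w) <= M.
Proof.
move=> cf; have [|d d0 dP] := @cdisc_uniform rho (fun d w => modulus (f w) <= d^-1).
  move=> w wr; have [d d0 h] := (cont_onP _ f).1 cf w wr 1 ltr01.
  pose K := modulus (f w) + 1.
  have K0 : 0 < K by have := modulus_ge0 (f w); rewrite /K; lra.
  exists (Num.min d K^-1); first by rewrite lt_min d0 invr_gt0.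
  move=> d' w'; rewrite !lt_min => /and3P[d'0 d'd d'K] /andP[w'd _] w'r.
  have {}h := h w' w'r w'd; apply: (@le_trans _ _ K).
    by have := modulus_ge_dist (f w') (f w); rewrite /K; lra.
  by rewrite -[K]invrK lef_pV2 ?posrE ?invr_gt0 // ltW.
by exists d^-1 => //; rewrite invr_gt0.
Qed.

Lemma cont_on_away rho (f : R[i] -> R[i]) : cont_on (cdisc rho) f ->
  (forall w, modulus w <= rho -> f w != 0) ->
  exists2 c : R, 0 < c & forall w, modulus w <= rho -> c <= modulus (f w).
Proof.
move=> cf f0; have [M M0 h] := cont_on_bounded (@cont_onV R R[i]^o (cdisc rho) f f0 cf).
exists M^-1 => [|w wr]; first by rewrite invr_gt0.
have := h w wr; rewrite modulusV -[X in _ -> _ <= X]invrK => ?.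
by rewrite lef_pV2 // posrE invr_gt0 modulus_gt0 f0.
Qed.

Lemma cont_on_uniform rho (f : R[i] -> R[i]) : cont_on (cdisc rho) f ->
  forall e : R, 0 < e -> exists2 d : R, 0 < d & forall w w',
    modulus w <= rho -> modulus w' <= rho -> modulus (w - w') < d ->
    modulus (f w - f w') < e.
Proof.
move=> cf e e0; have [|d d0 dP] := @cdisc_uniform rho (fun d w => forall w',
    modulus w' <= rho -> modulus (w - w') < d -> modulus (f w - f w') < e).
  move=> w wr; have e20 : 0 < e / 2 by lra.
  have [d d0 h] := (cont_onP _ f).1 cf w wr _ e20.
  exists (d / 2); first lra.
  move=> d' w' /andP[d'0 d'd] w'w w'r w'' w''r w''w.
  have w''d : modulus (w'' - w) < d.
    by apply: le_lt_trans (modulus_dist3 _ w' _) _; rewrite modulus_distC; lra.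
  apply: le_lt_trans (modulus_dist3 _ (f w) _) _.
  have := h w' w'r; have := h w'' w''r w''d; rewrite (modulus_distC (f w'')).
  by move=> h1 /(_ _); have w'd : modulus (w' - w) < d by [lra]; move=> /(_ w'd); lra.
by exists d => // w w' wr w'r; apply: dP.
Qed.

End ComplexTopology.

(** * Averages over roots of unity: Parseval and the mean value property *)

Section CircleAverage.
Variable R : realType.
Local Notation C := R[i].

Definition omega L : C := expi (2 * pi / L%:R).

Definition cavg L (rho : R) (f : C -> C) : C :=
  L%:R^-1 * \sum_(k < L) f (rho%:C%C * omega L ^+ k).

Lemma expi_neq1 (t : R) : 0 < t < 2 * pi -> expi t != 1.
Proof.
move=> t_in; apply/eqP => et1.
have : 0 < sin (t / 2) by apply: sin_gt0_pi; lra.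
suff -> : sin (t / 2) = 0 by rewrite ltxx.
have /eqP : expi (t / 2) ^+ 2 = 1.
  by rewrite -expiMn -et1; congr expi; rewrite mulr2n; lra.
by rewrite sqrf_eq1 /expi !eq_complex /= oppr0 => /orP[] /andP[_ /eqP].
Qed.

Lemma modulus_omega L k : modulus (omega L ^+ k) = 1.
Proof. by rewrite modulusX modulus_expi expr1n. Qed.

Lemma omegaX L k : (0 < L)%N -> omega L ^+ k = expi (2 * pi * (k%:R / L%:R)).
Proof. by move=> L0; rewrite /omega -expiMn -mulr_natr; congr expi; ring. Qed.

Lemma omega_prim L : (0 < L)%N -> L.-primitive_root (omega L).
Proof.
move=> L0; have L0R : 0 < L%:R :> R by rewrite ltr0n.
apply/andP; split=> //; apply/forallP => -[k kL] /=.
rewrite unity_rootE omegaX //; have [->|neq] := eqVneq k.+1 L.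
  by rewrite divff ?mulr1 ?expi2pi ?eqxx // gt_eqF.
have ltkL : (k.+1 < L)%N by rewrite ltn_neqAle neq.
rewrite (negbTE (expi_neq1 _)) //.
have k1 : 0 < k.+1%:R / L%:R :> R by rewrite divr_gt0.
have k2 : k.+1%:R / L%:R < 1 :> R by rewrite ltr_pdivrMr // mul1r ltr_nat.
by have := @pi_gt0 R; nra.
Qed.

(** The summands are powers of x = omega^n / omega^m, an L-th root of unity
    that differs from 1 unless n = m. *)
Lemma sum_omega L (n m : nat) : (n < L)%N -> (m < L)%N ->
  \sum_(k < L) omega L ^+ k ^+ n * ((omega L ^+ k)^*%C ^+ m) =
  (if n == m then L%:R else 0).
Proof.
move=> nL mL; have L0 : (0 < L)%N by apply: leq_ltn_trans nL.
have om0 k : omega L ^+ k != 0 by rewrite -modulus_eq0 modulus_omega oner_eq0.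
have om0' : omega L != 0 by have := om0 1%N; rewrite expr1.
pose x := omega L ^+ n / omega L ^+ m.
have termE (k : 'I_L) : omega L ^+ k ^+ n * ((omega L ^+ k)^*%C ^+ m) = x ^+ k.
  have -> : (omega L ^+ k)^*%C = (omega L ^+ k)^-1.
    apply: (mulfI (om0 k)); rewrite divff // mul_conj modulus_omega.
    by congr (_%:C%C); apply: expr1n.
  by rewrite /x exprMn !exprVn -!exprM mulnC (mulnC k m).
rewrite (eq_bigr _ (fun k _ => termE k)); have [nm|nm] := eqVneq n m.
  rewrite /x nm divff //; under eq_bigr => k _ do rewrite expr1n.
  by rewrite sumr_const card_ord.
have x1 : x - 1 != 0.
  rewrite subr_eq0 -(inj_eq (mulIf (om0 m))) mulfVK // mul1r.
  by rewrite (eq_prim_root_expr (omega_prim L0)) /= !modn_small.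
apply: (mulfI x1); rewrite mulr0 -subrX1 /x exprMn exprVn -!exprM mulnC (mulnC m).
by rewrite !exprM (prim_expr_order (omega_prim L0)) !expr1n divff ?subrr ?oner_eq0.
Qed.

Lemma conjcM : {morph (fun z : C => z^*%C) : x y / x * y}.
Proof. exact: (rmorphM (@conjc R)). Qed.

Lemma conjcX (z : C) n : (z ^+ n)^*%C = z^*%C ^+ n.
Proof. exact: (rmorphXn (@conjc R)). Qed.

Lemma polar_conj (rho : R) (z : C) :
  (rho%:C%C * z)^*%C = rho%:C%C * z^*%C.
Proof. by rewrite rmorphM /= oppr0. Qed.

Lemma sum_circle_monom L (rho : R) (n m : nat) : (n < L)%N -> (m < L)%N ->
  \sum_(k < L) (rho%:C%C * omega L ^+ k) ^+ n *
     (rho%:C%C * omega L ^+ k)^*%C ^+ m =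
  (if n == m then L%:R * (rho ^+ (2 * n))%:C%C else 0).
Proof.
move=> nL mL; under eq_bigr => k _ do rewrite polar_conj !exprMn mulrACA.
rewrite -mulr_sumr sum_omega //; case: eqP => [->|_]; last by rewrite mulr0.
by rewrite mulrC -exprD addnn -mul2n rmorphXn.
Qed.

(** By sum_omega the nodes separate the monomials of degree less than L, so
    the discrete form of Parseval's identity is exact. *)
Lemma parseval_poly L (rho : R) (p : {poly C}) : (size p <= L)%N ->
  \sum_(k < L) modulus (p.[rho%:C%C * omega L ^+ k]) ^+ 2 =
  L%:R * \sum_(n < L) modulus p`_n ^+ 2 * rho ^+ (2 * n).
Proof.
move=> pL; apply: (@complexI R); rewrite rmorph_sum /=.
under eq_bigr => k _ do rewrite -mul_conj !(horner_coef_wide _ pL) rmorph_sum /= big_distrlr /=.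
rewrite exchange_big /= rmorphM rmorph_nat rmorph_sum mulr_sumr /=.
apply: eq_bigr => n _; rewrite exchange_big /= (bigD1 n) //=.
rewrite [X in _ + X]big1 ?addr0 => [|m mn].
  under eq_bigr => k _ do rewrite conjcM mulrACA conjcX.
  by rewrite -mulr_sumr mul_conj sum_circle_monom // eqxx mulrCA -rmorphM.
under eq_bigr => k _ do rewrite conjcM mulrACA conjcX.
rewrite -mulr_sumr sum_circle_monom // eq_sym.
by rewrite -[_ == _ :> nat]/(m == n) (negbTE mn) mulr0.
Qed.

Lemma modulus_cavg_le L rho (f : C -> C) (M : R) :
  (0 < L)%N -> (forall k, modulus (f (rho%:C%C * omega L ^+ k)) <= M) ->
  modulus (cavg L rho f) <= M.
Proof.
move=> L0 fM; rewrite modulusM modulusV modulus_nat mulrC.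
rewrite ler_pdivrMr ?ltr0n //; apply: (le_trans (modulus_sum _ _ _)).
apply: (@le_trans _ _ (\sum_(k < L) M)); first by apply: ler_sum => k _.
by rewrite sumr_const card_ord -[M *+ L]mulr_natr.
Qed.

Lemma omega_near1 (d : R) : 0 < d -> exists2 L0 : nat, (1 < L0)%N &
  forall L, (L0 <= L)%N -> modulus (omega L - 1) < d.
Proof.
move=> d0; have := @cont_expi R _ id (fun x => cvg_id) 0 I d d0.
move=> /nbhs_ballP[e e0 ball_e]; have {}e0 : 0 < e by [].
pose L0 := maxn 2 (Num.truncn (2 * pi / e)).+1; exists L0; first by rewrite leq_max.
move=> L; rewrite geq_max => /andP[L2 Le].
have L0R : 0 < L%:R :> R by rewrite ltr0n (leq_trans _ L2).
have /ball_e/(_ I) : ball (0 : R) e (2 * pi / L%:R).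
  rewrite /ball /= sub0r normrN ger0_norm; last first.
    by rewrite mulr_ge0 ?mulr_ge0 ?pi_ge0 ?invr_ge0 // ltW.
  rewrite ltr_pdivrMr // [e * _]mulrC -ltr_pdivrMr //.
  by apply: (lt_le_trans (truncnS_gt _)); rewrite ler_nat.
by rewrite expi0.
Qed.

(** The derivative of the mean with respect to the radius s is close to the
    mean of omega^k * F w w over the nodes w = s * omega^k. That mean is
    close to the one of omega^k * F (omega * w) w, which is zero: up to the
    factor s * (omega - 1) its terms are the differences of f between
    consecutive nodes, and they telescope around the circle. Summing over
    small steps of s from 0 to rho keeps the mean within e of f 0. *)
Lemma mean_value (rho : R) (f : C -> C) (F : C -> C -> C) : 0 <= rho ->
  (forall w w', modulus w <= rho -> modulus w' <= rho ->
     f w - f w' = (w - w') * F w w') ->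
  (forall w0, modulus w0 <= rho -> forall e : R, 0 < e -> exists2 d : R, 0 < d &
     forall w w', modulus w <= rho -> modulus w' <= rho -> modulus (w - w0) < d ->
     modulus (w' - w0) < d -> modulus (F w w' - F w0 w0) < e) ->
  forall e : R, 0 < e -> exists L0 : nat, forall L, (L0 <= L)%N ->
    modulus (cavg L rho f - f 0) < e.
Proof.
move=> rho0 fF cF e e0; pose e' := e / (4 * (rho + 1)).
have rho1 : 0 < 4 * (rho + 1) by lra.
have e'0 : 0 < e' by rewrite divr_gt0.
have e'E : e = e' * (4 * (rho + 1)) by rewrite divfK // gt_eqF.
have [|d d0 dP] := @cdisc_uniform R rho (fun d w => forall w', modulus w' <= rho ->
    modulus (w' - w) < d -> modulus (F w' w - F w w) < e').
  move=> w0 w0r; have e20 : 0 < e' / 2 by lra.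
  have [d d0 dF] := cF w0 w0r _ e20; exists (d / 2) => [|d' w]; first lra.
  move=> /andP[_ d'd] ww0 wr w' w'r w'w.
  have wd : modulus (w - w0) < d by lra.
  have w'd : modulus (w' - w0) < d.
    by apply: (le_lt_trans (modulus_dist3 _ w _)); lra.
  apply: (le_lt_trans (modulus_dist3 _ (F w0 w0) _)).
  have := dF w' w w'r wr w'd wd; have := dF w w wr wr wd wd.
  by rewrite (modulus_distC (F w w)); lra.
have d10 : 0 < d / (rho + 1) by rewrite divr_gt0 //; lra.
have [L0 L01 L0P] := omega_near1 d10; exists L0 => L L0L.
have L1 : (1 < L)%N by apply: leq_trans L0L.
have L00 : (0 < L)%N by apply: ltnW.
have L0R : 0 < L%:R :> R by rewrite ltr0n.
have node_le s k : 0 <= s -> modulus (s%:C%C * omega L ^+ k) = s.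
  by move=> s0; rewrite modulusM modulus_omega mulr1 modulus_real ger0_norm.
(* On one circle, by rotation of the nodes. *)
have rot s : 0 <= s <= rho ->
    modulus (\sum_(k < L) omega L ^+ k *
      F (s%:C%C * omega L ^+ k) (s%:C%C * omega L ^+ k)) <= L%:R * e'.
  move=> /andP[s0 sr]; have [->|sn0] := eqVneq s 0.
    under eq_bigr => k _ do rewrite !mul0r.
    have sum0 : \sum_(k < L) omega L ^+ k = 0.
      transitivity (\sum_(k < L) omega L ^+ k ^+ 1 * ((omega L ^+ k)^*%C ^+ 0)).
        by apply: eq_bigr => k _; rewrite expr1 expr0 mulr1.
      exact: (@sum_omega L 1 0 L1 L00).
    by rewrite -mulr_suml sum0 mul0r modulus0 mulr_ge0 // ltW.
  have : \sum_(k < L) omega L ^+ k *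
      F (s%:C%C * omega L ^+ k.+1) (s%:C%C * omega L ^+ k) = 0.
    have om1 : omega L - 1 != 0.
      by rewrite subr_eq0 -[omega L]expr1 -(prim_order_dvd (omega_prim L00)) dvdn1 gtn_eqF.
    have sC0 : s%:C%C != 0 :> C by rewrite -modulus_eq0 modulus_real normr_eq0.
    apply: (mulfI sC0); apply: (mulfI om1); rewrite !mulr0 !mulr_sumr.
    transitivity (\sum_(k < L) (f (s%:C%C * omega L ^+ k.+1) - f (s%:C%C * omega L ^+ k))).
      apply: eq_bigr => k _; rewrite fF ?node_le // exprS; ring.
    rewrite -(big_mkord xpredT
      (fun k => f (s%:C%C * omega L ^+ k.+1) - f (s%:C%C * omega L ^+ k))).
    rewrite telescope_sumr // (prim_expr_order (omega_prim L00)) expr0; exact: subrr.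
  move=> rot0; rewrite -[X in modulus X]subr0 -[X in _ - X]rot0 -sumrB.
  apply: (le_trans (modulus_sum _ _ _)).
  apply: (@le_trans _ _ (\sum_(k < L) e')); last first.
    by rewrite sumr_const card_ord -[e' *+ _]mulr_natr mulrC.
  apply: ler_sum => k _; rewrite -mulrBr modulusM modulus_omega mul1r modulus_distC.
  apply/ltW/dP; rewrite ?node_le //.
  have -> : s%:C%C * omega L ^+ k.+1 - s%:C%C * omega L ^+ k =
      (omega L - 1) * (s%:C%C * omega L ^+ k) by rewrite exprS; ring.
  rewrite modulusM node_le //; have := L0P L L0L; rewrite ltr_pdivlMr; last lra.
  by have := modulus_ge0 (omega L - 1); nra.
(* From one circle to a close one. *)
have step s s' : 0 <= s -> s <= s' -> s' <= rho -> s' - s < d ->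
    modulus (cavg L s' f - cavg L s f) <= 2 * e' * (s' - s).
  move=> s0 ss' s'r s'd; have s'0 : 0 <= s' by lra.
  have sr : s <= rho by lra.
  rewrite /cavg -mulrBr -sumrB modulusM modulusV modulus_nat.
  rewrite mulrC ler_pdivrMr //.
  have -> : \sum_(k < L) (f (s'%:C%C * omega L ^+ k) - f (s%:C%C * omega L ^+ k)) =
      (s' - s)%:C%C * (\sum_(k < L) omega L ^+ k *
         (F (s'%:C%C * omega L ^+ k) (s%:C%C * omega L ^+ k) -
          F (s%:C%C * omega L ^+ k) (s%:C%C * omega L ^+ k)) +
      \sum_(k < L) omega L ^+ k *
         F (s%:C%C * omega L ^+ k) (s%:C%C * omega L ^+ k)).
    rewrite -big_split mulr_sumr; apply: eq_bigr => k _ /=.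
    rewrite fF ?node_le //.
    by rewrite -[RHS]/(_ * _) rmorphB /=; ring.
  rewrite modulusM modulus_real ger0_norm ?subr_ge0 //.
  have rs : modulus (\sum_(k < L) omega L ^+ k *
         F (s%:C%C * omega L ^+ k) (s%:C%C * omega L ^+ k)) <= L%:R * e'.
    by apply: rot; lra.
  set S1 := \sum_(_ < _) _; set S2 := (X in modulus X <= _) in rs.
  have S1e : modulus S1 <= L%:R * e'.
    apply: (le_trans (modulus_sum _ _ _)).
    apply: (@le_trans _ _ (\sum_(k < L) e')); last first.
      by rewrite sumr_const card_ord -[e' *+ _]mulr_natr mulrC.
    apply: ler_sum => k _; rewrite modulusM modulus_omega mul1r.
    apply/ltW/dP; rewrite ?node_le //.
    rewrite -mulrBl -rmorphB modulusM modulus_omega mulr1 modulus_real.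
    by rewrite ger0_norm // subr_ge0.
  have S12 : modulus (S1 + S2) <= 2 * (L%:R * e') by have := modulusD S1 S2; lra.
  have ds0 : 0 <= s' - s by lra.
  by have := ler_wpM2l ds0 S12; lra.
(* K steps of length less than d lead from the radius 0 to rho. *)
pose K := (Num.truncn (rho / d)).+1.
have K0 : 0 < K%:R :> R by rewrite ltr0n.
have Kd : rho / K%:R < d.
  by rewrite ltr_pdivrMr // mulrC -ltr_pdivrMr // truncnS_gt.
have tel : forall j, (j <= K)%N -> modulus (cavg L (rho * (j%:R / K%:R)) f - cavg L 0 f)
    <= 2 * e' * (rho * (j%:R / K%:R)).
  elim=> [_|j IH jK]; first by rewrite mul0r mulr0 subrr modulus0 mulr0.
  apply: (le_trans (modulus_dist3 _ (cavg L (rho * (j%:R / K%:R)) f) _)).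
  have jE : rho * (j.+1%:R / K%:R) = rho * (j%:R / K%:R) + rho / K%:R.
    by rewrite -natr1; ring.
  have j0 : 0 <= rho * (j%:R / K%:R) by rewrite mulr_ge0 // divr_ge0.
  have r0 : 0 <= rho / K%:R by rewrite divr_ge0.
  have jr : rho * (j.+1%:R / K%:R) <= rho.
    rewrite -[leRHS]mulr1 ler_wpM2l // ler_pdivrMr // mul1r ler_nat //.
  have := step (rho * (j%:R / K%:R)) (rho * (j.+1%:R / K%:R)).
  have := IH (ltnW jK); move: jr; rewrite jE.
  move=> jr h1 /(_ j0 _ jr) h2; have {h2} := h2 _ _; rewrite (addrC _ (rho / _)) addrK.
  by rewrite lerDr => /(_ r0 Kd); lra.
have := tel K (leqnn _); rewrite divff ?gt_eqF // mulr1.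
have -> : cavg L 0 f = f 0.
  rewrite /cavg; under eq_bigr => k _ do rewrite mul0r.
  rewrite sumr_const card_ord -[f 0 *+ L]mulr_natl mulKf //.
  by rewrite -modulus_eq0 modulus_nat gt_eqF.
by move/le_lt_trans; apply; rewrite e'E; nra.
Qed.

End CircleAverage.

(** * Jensen's bound without Cauchy's theorem *)

Section DividedDifferences.
Variable R : realType.
Local Notation C := R[i].

(** A substitute for the algebra of holomorphic functions on the open unit
    disc. Each function has a divided difference F w w' = (f w - f w') / (w
    - w') that is continuous on the diagonal and belongs to the algebra in
    its first variable, so that zeros can be divided out and Taylor
    remainders formed without Cauchy's theorem. *)
Record dd_algebra (S : (C -> C) -> Prop) : Prop := DDAlgebra {
  dda_cst : forall c, S (fun=> c);
  dda_id : S id;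
  ddaD : forall f g, S f -> S g -> S (fun w => f w + g w);
  ddaM : forall f g, S f -> S g -> S (fun w => f w * g w);
  dda_dd : forall f, S f -> exists F : C -> C -> C,
    [/\ forall w w', modulus w < 1 -> modulus w' < 1 ->
          f w - f w' = (w - w') * F w w',
        forall w', modulus w' < 1 -> S (fun w => F w w')
      & forall w0, modulus w0 < 1 -> forall e : R, 0 < e ->
          exists2 d : R, 0 < d & forall w w', modulus w < 1 -> modulus w' < 1 ->
            modulus (w - w0) < d -> modulus (w' - w0) < d ->
            modulus (F w w' - F w0 w0) < e] }.

Variable S : (C -> C) -> Prop.
Hypothesis SA : dd_algebra S.

Lemma dda_opp f : S f -> S (fun w => - f w).
Proof.
move=> Sf; have := ddaM SA (dda_cst SA (-1)) Sf.
by congr S; apply/funext => w; rewrite mulN1r.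
Qed.

Lemma dda_exp f n : S f -> S (fun w => f w ^+ n).
Proof.
move=> Sf; elim: n => [|n IH]; first by have := dda_cst SA 1; congr S; apply/funext.
by have := ddaM SA Sf IH; congr S; apply/funext => w; rewrite exprS.
Qed.

Lemma dda_prod I (s : seq I) (F : I -> C -> C) :
  (forall i, S (F i)) -> S (fun w => \prod_(i <- s) F i w).
Proof.
move=> SF; elim: s => [|i s IH].
  by have := dda_cst SA 1; congr S; apply/funext => w; rewrite big_nil.
by have := ddaM SA (SF i) IH; congr S; apply/funext => w; rewrite big_cons.
Qed.

Lemma dda_quotient f w0 : S f -> modulus w0 < 1 -> exists g, S g /\
  forall w, modulus w < 1 -> f w = f w0 + (w - w0) * g w.
Proof.
move=> Sf w01; have [F [fF SF _]] := dda_dd SA Sf.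
exists (F ^~ w0); split; first exact: SF.
by move=> w w1; rewrite -fF // addrC subrK.
Qed.

Lemma dda_bounded_near f w0 : S f -> modulus w0 < 1 -> exists d M : R,
  [/\ 0 < d, 0 < M & forall w, modulus w < 1 -> modulus (w - w0) < d ->
    modulus (f w - f w0) <= M * modulus (w - w0)].
Proof.
move=> Sf w01; have [F [fF _ cF]] := dda_dd SA Sf.
have [d d0 dF] := cF w0 w01 1 ltr01.
exists d, (1 + modulus (F w0 w0)); split=> //.
  by have := modulus_ge0 (F w0 w0); lra.
move=> w w1 wd; rewrite fF // modulusM mulrC ler_wpM2r ?modulus_ge0 //.
have := dF w w0 w1 w01 wd; rewrite subrr modulus0 => /(_ d0).
by have := modulus_ge_dist (F w w0) (F w0 w0); lra.
Qed.

Lemma dda_mean f rho : S f -> 0 <= rho < 1 -> forall e : R, 0 < e ->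
  exists L0 : nat, forall L, (L0 <= L)%N -> modulus (cavg L rho f - f 0) < e.
Proof.
move=> Sf /andP[rho0 rho1]; have [F [fF _ cF]] := dda_dd SA Sf.
have in1 w : modulus w <= rho -> modulus w < 1 by move/le_lt_trans; apply.
apply: (@mean_value R rho f F) => // [w w' /in1 w1 /in1 w'1|w0 /in1 w01 e e0].
  exact: fF.
have [d d0 dF] := cF w0 w01 e e0.
by exists d => // w w' /in1 w1 /in1 w'1; apply: dF.
Qed.

(** The value at the centre is the limit of the means over the circle. *)
Lemma dda_max0 f rho (M : R) : S f -> 0 <= rho < 1 ->
  (forall w, modulus w = rho -> modulus (f w) <= M) -> modulus (f 0) <= M.
Proof.
move=> Sf rho01 fM; apply/ler_addgt0Pr => e e0.
have [L0 h] := dda_mean Sf rho01 e0.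
have {}h := h L0.+1 (leqnSn _); move/andP: rho01 => [rho0 _].
have := @modulus_cavg_le R L0.+1 rho f M isT _.
have := modulus_ge_dist (f 0) (cavg L0.+1 rho f); rewrite modulus_distC.
suff : forall k, modulus (f (rho%:C%C * omega R L0.+1 ^+ k)) <= M.
  by move=> hk h1 /(_ hk); lra.
move=> k; apply: fM.
by rewrite modulusM modulus_omega mulr1 modulus_real ger0_norm.
Qed.

(** Every zero i of f is traded for the Blaschke factor (rho^2 - conj i * w)
    / rho, which has the modulus of w - i on the circle of radius rho and
    the modulus rho at 0; the maximum principle at 0 applies to the result. *)
Lemma jensen_bound f g (s : seq C) (rho rho0 M : R) : S g -> 0 < rho < 1 ->
  (forall w, modulus w < 1 -> f w = \prod_(i <- s) (w - i) * g w) ->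
  (forall i, i \in s -> modulus i <= rho0) ->
  (forall w, modulus w = rho -> modulus (f w) <= M) ->
  modulus (f 0) * rho ^+ size s <= M * rho0 ^+ size s.
Proof.
move=> Sg /andP[rho_gt0 rho1] fE s_le fM.
have rhoC0 : rho%:C%C != 0 :> C by rewrite -modulus_eq0 modulus_real normr_eq0 gt_eqF.
pose G w := \prod_(i <- s) ((rho ^+ 2)%:C%C / rho%:C%C + - (i^*%C / rho%:C%C) * w) * g w.
have SG : S G.
  apply: (ddaM SA _ Sg); apply: dda_prod => i.
  exact: (ddaD SA (dda_cst SA _) (ddaM SA (dda_cst SA _) (dda_id SA))).
have G_le : modulus (G 0) <= M.
  apply: (dda_max0 SG (rho := rho)); first by rewrite ltW.
  move=> w wrho; suff -> : modulus (G w) = modulus (f w) by apply: fM.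
  rewrite fE ?wrho // !modulusM; congr (_ * _); rewrite !modulus_prod.
  apply: eq_bigr => i _.
  have -> : (rho ^+ 2)%:C%C / rho%:C%C + - (i^*%C / rho%:C%C) * w =
      w / rho%:C%C * (w - i)^*%C.
    by rewrite -wrho -mul_conj wrho (rmorphB (@conjc R)) /=; ring.
  rewrite !modulusM modulusV modulus_real wrho modulus_conj ger0_norm ?ltW //.
  by rewrite divff ?mul1r // gt_eqF.
have G0E : modulus (G 0) = rho ^+ size s * modulus (g 0).
  rewrite modulusM modulus_prod; congr (_ * _).
  rewrite (eq_bigr (fun=> rho)) => [|i _].
    by rewrite big_const_seq count_predT iter_mulr_1.
  rewrite mulr0 addr0 modulusM modulusV !modulus_real !ger0_norm ?exprn_ge0 ?ltW //.
  by rewrite expr2 mulfK // gt_eqF.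
have f0E : modulus (f 0) = \prod_(i <- s) modulus i * modulus (g 0).
  rewrite fE ?modulus0 // modulusM modulus_prod; congr (_ * _).
  by apply: eq_bigr => i _; rewrite sub0r modulusN.
have prod_le : \prod_(i <- s) modulus i <= rho0 ^+ size s.
  rewrite -[size s]count_predT -iter_mulr_1 -big_const_seq !big_seq.
  by apply: ler_prod => i si; rewrite modulus_ge0 s_le.
have prod_ge : 0 <= \prod_(i <- s) modulus i by apply: prodr_ge0 => i _; exact: modulus_ge0.
rewrite f0E -mulrA [_ * rho ^+ _]mulrC -G0E.
have := modulus_ge0 (G 0); nra.
Qed.

Lemma exp_unbounded (x M : R) : 1 < x -> exists n, M < x ^+ n.
Proof.
move=> x1; exists (Num.truncn (M / (x - 1))).+1; set n := _.+1.
have x10 : 0 < x - 1 by lra.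
have : M < n%:R * (x - 1) by rewrite -ltr_pdivrMr // truncnS_gt.
suff : n%:R * (x - 1) <= x ^+ n by lra.
elim: (n) => [|k IH]; first by rewrite mul0r expr0.
have xk : 1 <= x ^+ k by rewrite exprn_ege1 // ltW.
by rewrite exprS -natr1; nra.
Qed.

(** Zeros are divided out one at a time. Jensen's bound limits the number of
    divisions, because rho > rho0 makes (rho / rho0)^n unbounded while f 0
    is not zero. *)
Lemma dda_factor f (rho0 : R) : S f -> f 0 != 0 -> 0 < rho0 < 1 ->
  cont_on (cdisc ((rho0 + 1) / 2)) f ->
  (forall w, rho0 < modulus w < 1 -> f w != 0) ->
  exists (s : seq C) (g : C -> C), [/\ S g,
    forall w, modulus w < 1 -> f w = \prod_(i <- s) (w - i) * g w,
    forall w, modulus w < 1 -> g w != 0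
    & forall i, i \in s -> modulus i <= rho0].
Proof.
move=> Sf f00 /andP[rho0_gt0 rho01] cf f_zero; set rho := (rho0 + 1) / 2 in cf.
have rho_gt0 : rho0 < rho by rewrite /rho; lra.
have rho1 : rho < 1 by rewrite /rho; lra.
apply: contrapT => nofactor.
have all_sizes : forall n, exists (s : seq C) (g : C -> C), [/\ S g,
    forall w, modulus w < 1 -> f w = \prod_(i <- s) (w - i) * g w,
    forall i, i \in s -> modulus i <= rho0 & size s = n].
  elim=> [|n [s [g [Sg fE s_le sz]]]].
    exists [::], f; split=> // w _; first by rewrite big_nil mul1r.
  have [i [i1 gi0]] : exists i, modulus i < 1 /\ g i = 0.
    apply: contrapT => g0; apply: nofactor; exists s, g; split=> // w w1.
    by apply/eqP => gw; apply: g0; exists w.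
  have [h [Sh gE]] := dda_quotient Sg i1.
  exists (i :: s), h; split=> //; last by rewrite /= sz.
    by move=> w w1; rewrite fE // gE // gi0 add0r big_cons; ring.
  move=> j; rewrite inE => /predU1P[->|]; last exact: s_le.
  rewrite leNgt; apply/negP => i_gt; have := f_zero i; rewrite i_gt i1 => /(_ isT).
  by rewrite fE // gi0 mulr0 eqxx.
have [M M0 fM] := cont_on_bounded cf.
have f0_gt0 : 0 < modulus (f 0) by rewrite modulus_gt0.
have ratio1 : 1 < rho / rho0 by rewrite ltr_pdivlMr // mul1r.
have [n nM] := exp_unbounded (M / modulus (f 0)) ratio1.
have [s [g [Sg fE s_le sz]]] := all_sizes n.
have rho_in : 0 < rho < 1 by rewrite rho1 (lt_trans rho0_gt0).
have fM' w : modulus w = rho -> modulus (f w) <= M by move=> wr; apply: fM; rewrite wr.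
have := jensen_bound Sg rho_in fE s_le fM'; rewrite sz.
apply/negP; rewrite -ltNge -ltr_pdivrMl // mulrA [_^-1 * M]mulrC.
by rewrite -ltr_pdivlMr ?exprn_gt0 // -expr_div_n.
Qed.

End DividedDifferences.

(** * Taylor coefficients and the multiplier bound *)

Section TaylorCoefficients.
Variable R : realType.
Local Notation C := R[i].
Variable S : (C -> C) -> Prop.
Hypothesis SA : dd_algebra S.

(** An expansion with remainders in the algebra, instead of a convergent
    series. *)
Definition taylor (f : C -> C) (c : nat -> C) := forall N, exists g, S g /\
  forall w, modulus w < 1 -> f w = \sum_(n < N) c n * w ^+ n + w ^+ N * g w.

(** The coefficients are the values at 0 of the iterated quotients (f w - f
    0) / w. *)
Lemma taylor_ext f f' c : (forall w, modulus w < 1 -> f w = f' w) ->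
  taylor f c -> taylor f' c.
Proof.
move=> ff' fc N; have [g [Sg fE]] := fc N; exists g; split=> // w w1.
by rewrite -ff' // fE.
Qed.

Lemma taylor_ex f : S f -> exists c, taylor f c.
Proof.
move=> Sf; have dq_ex (h : C -> C) : exists g : C -> C, S h -> S g /\
    forall w, modulus w < 1 -> h w = h 0 + w * g w.
  have [Sh|nSh] := pselect (S h); last by exists h.
  have [|g [Sg hE]] := dda_quotient SA Sh (w0 := 0).
    by rewrite modulus0.
  by exists g => _; split=> // w w1; rewrite [LHS]hE // subr0.
have [dq dqP] := choice dq_ex.
have Sdq n : S (iter n dq f) by elim: n => //= n IH; have [] := dqP _ IH.
exists (fun n => iter n dq f 0) => N; exists (iter N dq f); split=> // w w1.
elim: N => [|N IH]; first by rewrite big_ord0 add0r expr0 mul1r.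
rewrite big_ord_recr /= {1}IH -addrA; congr (_ + _).
by rewrite {1}(dqP _ (Sdq N)).2 // exprSr; ring.
Qed.

(** Two expansions that agree below degree n give c n - c' n = - w * h w
    with h bounded near 0, and w tends to 0. *)
Lemma taylor_uniq f c c' : taylor f c -> taylor f c' -> c =1 c'.
Proof.
move=> fc fc' n; elim/ltn_ind: n => n IH.
have [g [Sg fE]] := fc n.+1; have [g' [Sg' fE']] := fc' n.+1.
have m01 : modulus (0 : C) < 1 by rewrite modulus0.
have [d [M [d0 M0 dM]]] := dda_bounded_near SA (ddaD SA Sg (dda_opp SA Sg')) m01.
pose h w := g w - g' w; rewrite -/h in dM.
have diffE w : modulus w < 1 -> w != 0 -> c n - c' n = - w * h w.
  move=> w1 w0; have := fE w w1; rewrite fE' // !big_ord_recr /=.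
  have -> : \sum_(i < n) c' i * w ^+ i = \sum_(i < n) c i * w ^+ i.
    by apply: eq_bigr => i _; rewrite IH.
  move=> E; apply: (mulIf (expf_neq0 n w0)); rewrite /h.
  move: E; rewrite exprSr -!addrA => /addrI E.
  apply/eqP; rewrite -subr_eq0.
  have -> : (c n - c' n) * w ^+ n - - w * (g w - g' w) * w ^+ n =
    (c n * w ^+ n + w ^+ n * w * g w) - (c' n * w ^+ n + w ^+ n * w * g' w) by ring.
  by rewrite E subrr.
apply/eqP; rewrite -subr_eq0 -modulus_eq0 eq_le modulus_ge0 andbT.
apply/ler_addgt0Pr => e e0; rewrite add0r.
pose K := modulus (h 0) + M * d.
have K0 : 0 < K by have := modulus_ge0 (h 0); rewrite /K; nra.
pose t := Num.min (Num.min (d / 2) (1 / 2)) (e / K).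
have t0 : 0 < t by rewrite !lt_min !divr_gt0.
have td : t < d by rewrite /t !gt_min; apply/orP; left; apply/orP; left; lra.
have t1 : t < 1 by rewrite /t !gt_min; apply/orP; left; apply/orP; right; lra.
have te : t <= e / K by rewrite /t ge_min lexx orbT.
have mt : modulus (t%:C%C : C) = t by rewrite modulus_real ger0_norm // ltW.
have tC0 : t%:C%C != 0 :> C by rewrite -modulus_eq0 mt gt_eqF.
rewrite (diffE t%:C%C) ?mt // modulusM modulusN mt.
have := dM t%:C%C; rewrite subr0 mt => /(_ t1 td) ht.
have hK : modulus (h t%:C%C) <= K.
  have := modulus_ge_dist (h t%:C%C) (h 0); rewrite /K -/(h _) => ?.
  have : M * t <= M * d by rewrite ler_wpM2l // ltW.
  by move: ht; rewrite -/(h _) -/(h 0); lra.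
have eE : e = e / K * K by rewrite divfK // gt_eqF.
by rewrite [leRHS]eE; apply: ler_pM; rewrite ?modulus_ge0 // ltW.
Qed.

Lemma taylorD f f' c c' : taylor f c -> taylor f' c' ->
  taylor (fun w => f w + f' w) (fun n => c n + c' n).
Proof.
move=> fc fc' N; have [g [Sg fE]] := fc N; have [g' [Sg' fE']] := fc' N.
exists (fun w => g w + g' w); split; first exact: (ddaD SA).
move=> w w1; rewrite fE // fE' // mulrDr addrACA -big_split /=; congr (_ + _).
by apply: eq_bigr => i _; rewrite mulrDl.
Qed.

Lemma taylorZ f c a : taylor f c -> taylor (fun w => a * f w) (fun n => a * c n).
Proof.
move=> fc N; have [g [Sg fE]] := fc N.
exists (fun w => a * g w); split; first exact: (ddaM SA (dda_cst SA a)).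
move=> w w1; rewrite fE // mulrDr mulr_sumr mulrCA; congr (_ + _).
by apply: eq_bigr => i _; rewrite mulrA.
Qed.

Lemma taylorX f c : taylor f c ->
  taylor (fun w => w * f w) (fun n => if n is k.+1 then c k else 0).
Proof.
move=> fc [|N].
  have [g [Sg fE]] := fc 0%N; exists (fun w => w * g w); split.
    exact: (ddaM SA (dda_id SA)).
  by move=> w w1; rewrite fE // !big_ord0 !add0r !expr0 !mul1r.
have [g [Sg fE]] := fc N; exists g; split=> // w w1.
rewrite big_ord_recl mul0r add0r fE // mulrDr mulr_sumr exprS mulrA; congr (_ + _).
by apply: eq_bigr => i _; rewrite /= exprS mulrCA.
Qed.

Lemma taylor_cst a : taylor (fun=> a) (fun n => if n is 0 then a else 0).
Proof.
move=> [|N]; last first.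
  exists (fun=> 0); split=> [|w _]; first exact: (dda_cst SA).
  rewrite big_ord_recl big1 => [|i _]; last by rewrite mul0r.
  by rewrite mulr0 !addr0 expr0 mulr1.
exists (fun=> a); split=> [|w _]; first exact: (dda_cst SA).
by rewrite big_ord0 add0r expr0 mul1r.
Qed.

Lemma taylor_sum I (s : seq I) (f : I -> C -> C) (c : I -> nat -> C) :
  (forall i, taylor (f i) (c i)) ->
  taylor (fun w => \sum_(i <- s) f i w) (fun n => \sum_(i <- s) c i n).
Proof.
move=> fc; elim: s => [|i s IH].
  move=> N; exists (fun=> 0); split=> [|w _]; first exact: (dda_cst SA).
  rewrite big_nil mulr0 addr0 big1 // => i _.
  by rewrite big_nil mul0r.
move=> N; have [g [Sg fE]] := taylorD (fc i) IH N.
exists g; split=> // w w1; rewrite big_cons fE //; congr (_ + _).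
by apply: eq_bigr => j _; rewrite big_cons.
Qed.

Lemma taylorXn f c k : taylor f c ->
  taylor (fun w => w ^+ k * f w) (fun n => if (k <= n)%N then c (n - k)%N else 0).
Proof.
move=> fc; elim: k => [|k IH].
  move=> N; have [g [Sg fE]] := fc N; exists g; split=> // w w1.
  by rewrite expr0 mul1r fE //; congr (_ + _); apply: eq_bigr => i _; rewrite subn0.
move=> N; have [g [Sg fE]] := taylorX IH N; exists g; split=> // w w1.
rewrite exprS -mulrA fE //; congr (_ + _).
by apply: eq_bigr => -[[|i] iN] _ //=; rewrite ltnS subSS.
Qed.

(** Multiplication by a function bounded by M has norm at most M on the
    square-summable functions on a circle. The convolved sequence is the
    beginning P of the expansion of f * G, where G is the polynomial with
    coefficients g. On the circle of radius x the remainder w^N * r w is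
    orthogonal to P in the limit of many nodes, by the mean value property
    of the functions w^(N - n) * r w, which vanish at 0. Hence the mean of
    |P|^2 is at most that of |f * G|^2, and Parseval's identity computes
    both sides. *)
Lemma taylor_multiplier f c (M x : R) (g : nat -> C) N : S f -> taylor f c ->
  0 <= M -> (forall w, modulus w < 1 -> modulus (f w) <= M) -> 0 < x < 1 ->
  \sum_(n < N) modulus (\sum_(k < n.+1) c (n - k)%N * g k) ^+ 2 * x ^+ (2 * n) <=
  M ^+ 2 * \sum_(n < N) modulus (g n) ^+ 2 * x ^+ (2 * n).
Proof.
move=> Sf fc M0 fM /andP[x0 x1].
pose h n := \sum_(k < n.+1) c (n - k)%N * g k.
pose P := \poly_(n < N) h n; pose G := \poly_(n < N) g n.
have [r [Sr HE]] : exists r, S r /\ forall w, modulus w < 1 ->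
    f w * G.[w] = P.[w] + w ^+ N * r w.
  have Hc : taylor (fun w => f w * G.[w])
      (fun n => \sum_(k < N) g k * (if (k <= n)%N then c (n - k)%N else 0)).
    apply: (@taylor_ext (fun w => \sum_(k < N) g k * (w ^+ k * f w))) => [w _|].
      rewrite (horner_coef_wide _ (size_poly _ _)) mulr_sumr; apply: eq_bigr => k _.
      by rewrite coef_poly ltn_ord; ring.
    by apply: taylor_sum => k; apply/taylorZ/taylorXn.
  have [r [Sr HE]] := Hc N; exists r; split=> // w w1; rewrite HE //; congr (_ + _).
  rewrite (horner_coef_wide _ (size_poly _ _)); apply: eq_bigr => n _.
  rewrite coef_poly ltn_ord /h; congr (_ * _).
  rewrite (big_ord_widen_cond N predT (fun k => c (n - k)%N * g k)) // [RHS]big_mkcond /=.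
  by apply: eq_bigr => k _; rewrite ltnS; case: ifP => _; rewrite ?mulr0 // mulrC.
set A := (X in X <= _); set B := (X in _ <= _ * X).
pose cross n w := w ^+ (N - n) * r w.
have cross0 (n : 'I_N) : cross n 0 = 0.
  by rewrite /cross expr0n subn_eq0 leqNgt ltn_ord mul0r.
have Scross n : S (cross n) by apply: (ddaM SA (dda_exp SA _ (dda_id SA)) Sr).
pose K := \sum_(n < N) modulus (h n) * x ^+ (2 * n).
have K0 : 0 <= K.
  by apply: sumr_ge0 => n _; rewrite mulr_ge0 ?modulus_ge0 ?exprn_ge0 // ltW.
apply/ler_addgt0Pr => e e0; pose e' := e / (2 * (K + 1)).
have K10 : 0 < 2 * (K + 1) by lra.
have e'0 : 0 < e' by rewrite divr_gt0.
have eE : e = e' * (2 * (K + 1)) by rewrite divfK // gt_eqF.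
have x01 : 0 <= x < 1 by rewrite ltW.
have [L0 L0P] : exists L0 : nat, forall L, (L0 <= L)%N -> forall n : 'I_N,
    modulus (cavg L x (cross n)) < e'.
  have cex (n : 'I_N) : exists L0 : nat, forall L, (L0 <= L)%N ->
      modulus (cavg L x (cross n)) < e'.
    have [L0 h0] := dda_mean SA (Scross n) x01 e'0.
    by exists L0 => L L0L; have := h0 L L0L; rewrite cross0 subr0.
  have [L0 hL0] := choice cex.
  exists (\max_(n < N) L0 n)%N => L Lmax n; apply: hL0.
  by apply: leq_trans Lmax; apply: leq_bigmax.
pose L := (maxn L0 N).+1.
have L0L : (L0 <= L)%N by rewrite leqW // leq_maxl.
have NL : (N <= L)%N by rewrite leqW // leq_maxr.
have LR0 : 0 < L%:R :> R by rewrite ltr0n.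
pose y (k : 'I_L) : C := x%:C%C * omega R L ^+ k.
have my k : modulus (y k) = x.
  by rewrite modulusM modulus_omega mulr1 modulus_real ger0_norm // ltW.
have pars (p : nat -> C) : \sum_(k < L) modulus ((\poly_(n < N) p n).[y k]) ^+ 2 =
    L%:R * \sum_(n < N) modulus (p n) ^+ 2 * x ^+ (2 * n).
  rewrite parseval_poly; last exact: leq_trans (size_poly _ _) NL.
  congr (_ * _); rewrite (big_ord_widen_cond L predT
    (fun n => modulus (p n) ^+ 2 * x ^+ (2 * n)) NL) [RHS]big_mkcond /=.
  apply: eq_bigr => n _; rewrite coef_poly; case: ifP => // _.
  by rewrite modulus0 expr0n mul0r.
have upper : \sum_(k < L) modulus (f (y k) * G.[y k]) ^+ 2 <= L%:R * (M ^+ 2 * B).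
  rewrite mulrCA -pars mulr_sumr; apply: ler_sum => k _.
  rewrite modulusM exprMn ler_wpM2r ?sqr_ge0 // ler_sqr ?nnegrE ?modulus_ge0 //.
  by apply: fM; rewrite my.
have sq (a b : C) : modulus a ^+ 2 + 2 * Re (a^*%C * b) <= modulus (a + b) ^+ 2.
  case: a b => [a1 a2] [b1 b2]; rewrite /modulus /= !sqr_sqrtr ?addr_ge0 ?sqr_ge0 //.
  by have := sqr_ge0 b1; have := sqr_ge0 b2; rewrite !expr2; lra.
pose X := \sum_(k < L) (P.[y k])^*%C * (y k ^+ N * r (y k)).
have lower : L%:R * A + 2 * Re X <= \sum_(k < L) modulus (f (y k) * G.[y k]) ^+ 2.
  have -> : Re X = \sum_(k < L) Re ((P.[y k])^*%C * (y k ^+ N * r (y k))).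
    have ReD : {morph (@complex.Re R) : a b / a + b} by case=> ? ? [].
    exact: (big_morph _ ReD).
  rewrite -[A]/(\sum_(n < N) modulus (h n) ^+ 2 * x ^+ (2 * n)) -pars mulr_sumr.
  rewrite -big_split /=; apply: ler_sum => k _.
  by rewrite HE ?my //; apply: sq.
have XE : X = L%:R * \sum_(n < N) (h n)^*%C * (x ^+ (2 * n))%:C%C * cavg L x (cross n).
  rewrite /X mulr_sumr.
  under eq_bigr => k _ do rewrite (horner_coef_wide _ (size_poly _ _)) rmorph_sum mulr_suml.
  rewrite exchange_big /=; apply: eq_bigr => n _.
  rewrite /cavg [RHS]mulrCA mulVKf; last first.
    by rewrite -modulus_eq0 modulus_nat gt_eqF.
  rewrite mulr_sumr; apply: eq_bigr => k _; rewrite coef_poly ltn_ord -/(y k).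
  have -> : y k ^+ N = y k ^+ n * y k ^+ (N - n) by rewrite -exprD subnKC // ltnW.
  have -> : (x ^+ (2 * n))%:C%C = (y k)^*%C ^+ n * y k ^+ n.
    by rewrite -exprMn mulrC mul_conj my exprM rmorphXn.
  by rewrite /cross conjcM conjcX; ring.
have Xle : modulus X <= L%:R * (K * e').
  rewrite XE modulusM modulus_nat ler_wpM2l ?ler0n //.
  apply: (le_trans (modulus_sum _ _ _)); rewrite mulr_suml; apply: ler_sum => n _.
  rewrite (modulusM (_ * _) (cavg L x (cross n))) (modulusM (h n)^*%C).
  rewrite modulus_conj modulus_real ger0_norm ?exprn_ge0 ?(ltW x0) //.
  apply: ler_wpM2l; last exact: ltW (L0P _ L0L n).
  by rewrite mulr_ge0 ?modulus_ge0 ?exprn_ge0 ?(ltW x0).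
have ReX : - (L%:R * (K * e')) <= Re X.
  by have := modulus_Re X; have := ler_norm (- Re X); rewrite normrN; lra.
have : L%:R * A <= L%:R * (M ^+ 2 * B + 2 * (K * e')) by lra.
by rewrite ler_pM2l // => /le_trans; apply; rewrite lerD2l eE; nra.
Qed.

End TaylorCoefficients.

(** * Winding numbers *)

Section Winding.
Variable R : realType.
Local Notation C := R[i].
Implicit Types (gamma nu e : R -> C).

Local Notation wind gamma k := (is_winding_number gamma 0 k).

(** The difference h of two arguments takes its values in the multiples of 2
    pi, and a continuous real function with two different such values also
    takes a value at a distance in ]0, pi] from one of them. *)
Lemma wind_uniq gamma k k' : (forall t, 0 <= t <= 2 * pi -> gamma t != 0) ->
  wind gamma k -> wind gamma k' -> k = k'.
Proof.
move=> gamma0 [phi [cphi phiE phik]] [psi [cpsi psiE psik]].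
have pi0 := @pi_gt0 R; have pi20 : 0 <= 2 * pi :> R by lra.
pose h t := phi t - psi t.
have ch : {within `[0, 2 * pi], continuous h}.
  by move=> t; apply: cvgB; [exact: cphi|exact: cpsi].
have h1 t : 0 <= t <= 2 * pi -> expi (h t) = 1.
  move=> t_in; have g0 := gamma0 t t_in; have := phiE t t_in.
  rewrite {1}(psiE t t_in) subr0 => /mulfI E.
  by rewrite expiD expiV -E ?normr_eq0 // divff // expi_neq0.
have h_cst : h (2 * pi) = h 0.
  apply/eqP; apply/negPn/negP => neq.
  pose a := Num.min (h 0) (h (2 * pi)); pose b := Num.max (h 0) (h (2 * pi)).
  have ab : a < b.
    rewrite /a /b; move: neq; rewrite neq_lt => /orP[] hl.
      by rewrite max_l ?min_r // ltW.
    by rewrite max_r ?min_l // ltW.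
  have a1 : expi a = 1.
    by rewrite /a; case: (leP (h 0) (h (2 * pi))) => _; apply: h1; lra.
  pose s := Num.min (b - a) pi.
  have s0 : 0 < s by rewrite lt_min pi0 andbT subr_gt0.
  have spi : s <= pi by rewrite /s ge_min lexx orbT.
  have sb : s <= b - a by rewrite /s ge_min lexx.
  have [|t t_in ht] := IVT pi20 ch (v := a + s).
    by rewrite -/a -/b; apply/andP; split; lra.
  have t_in' : 0 <= t <= 2 * pi by move: t_in; rewrite in_itv.
  have : expi s = 1 by have := h1 t t_in'; rewrite ht expiD a1 mul1r.
  by apply/eqP; apply: expi_neq1; lra.
move: h_cst; rewrite /h => h_cst.
have : 2 * pi * k%:~R = 2 * pi * k'%:~R :> R by rewrite -phik -psik; lra.
have pin0 : 2 * pi != 0 :> R by rewrite gt_eqF //; lra.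
by move=> /(mulfI pin0) /intr_inj.
Qed.

Lemma winding_numberE gamma k : (forall t, 0 <= t <= 2 * pi -> gamma t != 0) ->
  wind gamma k -> winding_number gamma 0 = k.
Proof.
move=> gamma0 gk; apply: (@wind_uniq gamma) => //.
by rewrite /winding_number; apply: (@xgetPex _ 0 [set k | wind gamma k]); exists k.
Qed.

Lemma windM gamma gamma' k k' : wind gamma k -> wind gamma' k' ->
  wind (fun t => gamma t * gamma' t) (k + k').
Proof.
move=> [phi [cphi phiE phik]] [psi [cpsi psiE psik]].
exists (fun t => phi t + psi t); split.
- by move=> t; apply: cvgD; [exact: cphi|exact: cpsi].
- move=> t t_in; move: (phiE t t_in) (psiE t t_in); rewrite !subr0 => E1 E2.
  by rewrite {1}E1 {1}E2 normrM expiD mulrACA.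
- rewrite /= intrD; move: phik psik; move: (phi _) (phi 0) (psi _) (psi 0) => *; lra.
Qed.

Lemma wind_cst (c : C) : wind (fun=> c) 0.
Proof.
have [t _ cE] := polarE c; exists (fun=> t); split.
- by move=> x; apply: cvg_cst.
- by move=> x _; rewrite subr0 normE -cE.
- by rewrite subrr mulr0.
Qed.

Lemma wind_expi : wind (@expi R) 1.
Proof.
exists id; split.
- by apply: continuous_subspaceT => t; apply: cvg_id.
- by move=> t _; rewrite subr0 normE modulus_expi mul1r.
- by rewrite subr0 mulr1.
Qed.

Lemma wind_expiX n : wind (fun t : R => expi t ^+ n) n%:Z.
Proof.
elim: n => [|n IH].
  by have := wind_cst (1 : C); congr is_winding_number; apply/funext.
have -> : (fun t : R => expi t ^+ n.+1) = (fun t => expi t * expi t ^+ n).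
  by apply/funext => t; rewrite exprS.
by rewrite -add1n PoszD; apply: windM; first exact: wind_expi.
Qed.

Lemma wind_expiN : wind (fun t => expi (- t : R)) (-1).
Proof.
exists -%R; split.
- by apply: continuous_subspaceT => t; apply: opp_continuous.
- by move=> t _; rewrite subr0 normE modulus_expi mul1r.
- by rewrite oppr0 subr0 mulrN1.
Qed.

Lemma continuous_ReIm nu : cont_on setT nu ->
  continuous (fun t => Re (nu t)) /\ continuous (fun t => Im (nu t)).
Proof.
move=> cnu; split=> t; apply/cvgrPdist_lt => e e0; have := cnu t I e e0;
  apply: filterS => u /(_ I); apply: le_lt_trans; rewrite distrC.
  by have := modulus_Re (nu u - nu t); case: (nu u) (nu t) => ? ? [].
by have := modulus_Im (nu u - nu t); case: (nu u) (nu t) => ? ? [].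
Qed.

Lemma expi_atan (x y : R) : 0 < x ->
  Complex x y = (modulus (Complex x y))%:C%C * expi (atan (y / x)).
Proof.
move=> x0; set t := y / x.
have yE : y = t * x by rewrite divfK // gt_eqF.
have t0 : 0 < 1 + t ^+ 2 by have := sqr_ge0 t; lra.
have sq0 : Num.sqrt (1 + t ^+ 2) != 0 by rewrite sqrtr_eq0 -ltNge.
have mE : modulus (Complex x y) = x * Num.sqrt (1 + t ^+ 2).
  rewrite /modulus /= yE -[x in RHS]ger0_norm ?(ltW x0) // -sqrtr_sqr.
  by rewrite -sqrtrM ?sqr_ge0 //; congr Num.sqrt; ring.
have c0 : cos (atan t) != 0 by rewrite cos_atan invr_eq0.
have sE : sin (atan t) = t * (Num.sqrt (1 + t ^+ 2))^-1.
  by rewrite -cos_atan; apply: (canRL (divfK c0)); exact: atanK.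
rewrite mE /expi cos_atan sE; apply/eqP; rewrite eq_complex /= !mul0r subr0 addr0.
by rewrite yE; apply/andP; split; apply/eqP; field.
Qed.

(** The principal argument atan (Im / Re) is continuous on the right
    half-plane. *)
Lemma wind_half_plane nu : cont_on setT nu -> (forall t, 0 < Re (nu t)) ->
  nu 0 = nu (2 * pi) -> wind nu 0.
Proof.
move=> cnu nu0 nuE; have [cRe cIm] := continuous_ReIm cnu.
exists (fun t => atan (Im (nu t) / Re (nu t))); split.
- apply: continuous_subspaceT => t.
  apply: (@continuous_comp _ _ _ (fun t => Im (nu t) / Re (nu t)) (@atan R)).
    by apply: cvgM; [exact: cIm|apply: cvgV; [rewrite gt_eqF|exact: cRe]].
  exact: continuous_atan.
- move=> t _; rewrite subr0 normE; have := nu0 t.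
  by case: (nu t) => x y /= x0; apply: expi_atan.
- by rewrite nuE subrr mulr0.
Qed.

Lemma Re_gt0_near1 (z : C) : modulus (z - 1) < 1 -> 0 < Re z.
Proof.
case: z => x y h; have := le_lt_trans (modulus_Re _) h => /=.
by rewrite ltr_norml => /andP[]; lra.
Qed.

(** The winding numbers are computed along both orientations of the circle:
    expi theta for the variable z, and expi (- theta) for w = 1 / z. *)
Definition unit_loop e :=
  [/\ cont_on setT e, forall t, modulus (e t) = 1 & e 0 = e (2 * pi)].

Lemma unit_loop_expi : unit_loop (@expi R).
Proof.
split; [exact: (cont_expi (fun t => cvg_id))|exact: modulus_expi|].
by rewrite expi0 expi2pi.
Qed.

Lemma unit_loop_expiN : unit_loop (fun t : R => expi (- t)).
Proof.
split=> [|t|]; [exact/cont_expi/opp_continuous|exact: modulus_expi|].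
by rewrite !expiV expi0 expi2pi.
Qed.

Lemma cont_on_loop e (f : C -> C) (D : set R[i]^o) : cont_on setT e ->
  cont_on D f -> (forall t, D (e t)) -> cont_on setT (fun t => f (e t)).
Proof.
move=> ce cf De; apply: (@cont_on_comp R R R[i]^o setT D e f) => //.
exact: (@continuous_modulus R R e ce).
Qed.

(** The factor e t - a is e t times 1 - a / e t if a is inside the circle,
    and - a times 1 - e t / a if it is outside; the second factors stay in
    the right half-plane. *)
Lemma wind_factor e k (a : C) : unit_loop e -> wind e k -> modulus a != 1 ->
  wind (fun t => e t - a) (if modulus a < 1 then k else 0).
Proof.
move=> [ce me e2pi] ek; rewrite neq_lt => /orP[a1|a1].
  rewrite a1.
  have e0 t : e t != 0 by rewrite -modulus_eq0 me oner_eq0.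
  have -> : (fun t => e t - a) = (fun t => e t * (1 - a / e t)).
    by apply/funext => t; field.
  rewrite -[k]addr0; apply: windM => //; apply: wind_half_plane.
  - apply: cont_onD; [exact: cont_on_cst|apply: cont_onN].
    by apply: cont_onM; [exact: cont_on_cst|apply: cont_onV].
  - move=> t; apply: Re_gt0_near1; rewrite addrC addKr modulusN modulusM modulusV.
    by rewrite me invr1 mulr1.
  - by rewrite e2pi.
rewrite ltNge ltW //=.
have a0 : a != 0 by rewrite -modulus_gt0 (lt_trans ltr01).
have -> : (fun t => e t - a) = (fun t => - a * (1 - e t / a)).
  by apply/funext => t; field.
rewrite -[X in is_winding_number _ _ X]addr0; apply: windM; first exact: wind_cst.
apply: wind_half_plane.
- apply: cont_onD; [exact: cont_on_cst|apply: cont_onN].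
  by apply: cont_onM => //; exact: cont_on_cst.
- move=> t; apply: Re_gt0_near1; rewrite addrC addKr modulusN modulusM modulusV.
  by rewrite me mul1r invf_lt1 // (lt_trans ltr01).
- by rewrite e2pi.
Qed.

Lemma wind_prod e k (s : seq C) : unit_loop e -> wind e k ->
  (forall a, a \in s -> modulus a != 1) ->
  wind (fun t => \prod_(a <- s) (e t - a)) (k *+ count (fun a => modulus a < 1) s).
Proof.
move=> le ek; elim: s => [|a s IH] s1.
  have -> : (fun t => \prod_(a <- [::]) (e t - a)) = fun=> 1.
    by apply/funext => t; rewrite big_nil.
  exact: wind_cst.
have -> : (fun t => \prod_(b <- a :: s) (e t - b)) =
    (fun t => (e t - a) * \prod_(b <- s) (e t - b)).
  by apply/funext => t; rewrite big_cons.
have -> : k *+ count (fun a => modulus a < 1) (a :: s) =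
    (if modulus a < 1 then k else 0) + k *+ count (fun a => modulus a < 1) s.
  by rewrite /= mulrnDr; case: ifP.
apply: windM; first by apply: wind_factor => //; apply: s1; rewrite mem_head.
by apply: IH => b bs; apply: s1; rewrite inE bs orbT.
Qed.

(** A curve g (e t) with g continuous and without zero on the closed disc
    shrinks to the constant g 0 through the curves g (rho * e t); two of
    these curves with close radii differ by a factor in the right
    half-plane. *)
Lemma wind_disc e (g : C -> C) : unit_loop e -> cont_on (cdisc 1) g ->
  (forall w, modulus w <= 1 -> g w != 0) -> wind (fun t => g (e t)) 0.
Proof.
move=> [ce me e2pi] cg g0; have [c c0 gc] := cont_on_away cg g0.
have [d d0 gd] := cont_on_uniform cg c0.
pose K := (Num.truncn (1 / d)).+1.
have K0 : 0 < K%:R :> R by rewrite ltr0n.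
have Kd : 1 / K%:R < d.
  by rewrite ltr_pdivrMr // mulrC -ltr_pdivrMr // truncnS_gt.
pose y (j : nat) t := (j%:R / K%:R)%:C%C * e t.
have my j t : modulus (y j t) = j%:R / K%:R.
  by rewrite modulusM me mulr1 modulus_real ger0_norm // divr_ge0.
have jK1 j : (j <= K)%N -> j%:R / K%:R <= 1 :> R.
  by move=> jK; rewrite ler_pdivrMr // mul1r ler_nat.
have cy j : (j <= K)%N -> cont_on setT (fun t => g (y j t)).
  move=> jK; apply: (@cont_on_loop (y j) g (cdisc 1)) => [|//|t].
    by apply: cont_onM => //; exact: cont_on_cst.
  by rewrite /cdisc /= my jK1.
have steps : forall j, (j <= K)%N -> wind (fun t => g (y j t)) 0.
  elim=> [_|j IH jK].
    have -> : (fun t => g (y 0%N t)) = fun=> g 0.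
      by apply/funext => t; rewrite /y mul0r mul0r.
    exact: wind_cst.
  have gj t : g (y j t) != 0 by apply: g0; rewrite my jK1 // ltnW.
  have -> : (fun t => g (y j.+1 t)) = (fun t => g (y j t) * (g (y j.+1 t) / g (y j t))).
    by apply/funext => t; rewrite mulrCA divff ?mulr1.
  rewrite -[X in is_winding_number _ _ X]addr0; apply: windM; first exact: IH (ltnW jK).
  apply: wind_half_plane.
  - by apply: cont_onM; [exact: cy|apply: cont_onV => //; exact/cy/ltnW].
  - move=> t; apply: Re_gt0_near1.
    have -> : g (y j.+1 t) / g (y j t) - 1 = (g (y j.+1 t) - g (y j t)) / g (y j t).
      by rewrite mulrBl divff.
    have my1 : modulus (y j t) <= 1 by rewrite my jK1 // ltnW.
    rewrite modulusM modulusV ltr_pdivrMr ?modulus_gt0 // mul1r.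
    apply: (lt_le_trans _ (gc _ my1)); apply: gd => //; first by rewrite my jK1.
    rewrite -mulrBl -rmorphB modulusM me mulr1 modulus_real -mulrBl -natr1.
    by rewrite addrC addKr ger0_norm // divr_ge0.
  - by rewrite /y e2pi.
have := steps K (leqnn _); congr (wind _ _); apply/funext => t.
by rewrite /y divff ?gt_eqF // mul1r.
Qed.

End Winding.

(** * Polynomials and their roots: continuity *)

Section PolynomialRoots.
Variable R : realType.
Local Notation C := R[i].
Implicit Types (P : {poly C}) (s t : seq C).

Definition pnorm P : R := \sum_(i < size P) modulus P`_i.

Lemma pnormE n P : (size P <= n)%N -> pnorm P = \sum_(i < n) modulus P`_i.
Proof.
move=> Pn; rewrite /pnorm (big_ord_widen_cond n predT (fun i => modulus P`_i)) //.
rewrite big_mkcond /=; apply: eq_bigr => i _; case: ltnP => // Pi.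
by rewrite nth_default // modulus0.
Qed.

Lemma pnorm_ge0 P : 0 <= pnorm P.
Proof. by apply: sumr_ge0 => i _; apply: modulus_ge0. Qed.

Lemma pnorm0 : pnorm 0 = 0.
Proof. by rewrite /pnorm size_poly0 big_ord0. Qed.

Lemma modulus_coef_le P i : modulus P`_i <= pnorm P.
Proof.
have [iP|Pi] := ltnP i (size P); last first.
  by rewrite nth_default // modulus0 pnorm_ge0.
rewrite /pnorm (bigD1 (Ordinal iP)) //= lerDl.
by apply: sumr_ge0 => j _; apply: modulus_ge0.
Qed.

Lemma pnormD P P' : pnorm (P + P') <= pnorm P + pnorm P'.
Proof.
have PP' := size_polyD P P'; rewrite (pnormE PP') (@pnormE _ P (leq_maxl _ (size P'))).
rewrite (@pnormE _ P' (leq_maxr (size P) _)) -big_split /=.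
by apply: ler_sum => i _; rewrite coefD modulusD.
Qed.

Lemma pnormZ (c : C) P : pnorm (c *: P) = modulus c * pnorm P.
Proof.
rewrite (pnormE (size_scale_leq c P)) /pnorm mulr_sumr.
by apply: eq_bigr => i _; rewrite coefZ modulusM.
Qed.

Lemma pnormN P : pnorm (- P) = pnorm P.
Proof. by rewrite -scaleN1r pnormZ modulusN modulus1 mul1r. Qed.

Lemma pnorm_distC P P' : pnorm (P - P') = pnorm (P' - P).
Proof. by rewrite -pnormN opprB. Qed.

Lemma pnorm_dist3 P P' P'' : pnorm (P - P'') <= pnorm (P - P') + pnorm (P' - P'').
Proof. by rewrite (le_trans _ (pnormD _ _)) // addrA subrK. Qed.

Lemma pnorm_sum I (l : seq I) (F : I -> {poly C}) :
  pnorm (\sum_(i <- l) F i) <= \sum_(i <- l) pnorm (F i).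
Proof.
elim/big_rec2: _ => [|i u v _ le_vu]; first by rewrite pnorm0.
by rewrite (le_trans (pnormD _ _)) // lerD2l.
Qed.

Lemma pnormXnM n P : pnorm ('X^n * P) = pnorm P.
Proof.
have le_n : (size ('X^n * P)%R <= n + size P)%N.
  by rewrite (leq_trans (size_polyMleq _ _)) // size_polyXn.
rewrite (pnormE le_n) big_split_ord /= big1 => [|i _]; last first.
  by rewrite coefXnM ltn_ord modulus0.
rewrite add0r; apply: eq_bigr => i _.
by rewrite coefXnM ltnNge leq_addr /= addKn.
Qed.

Lemma pnormM P P' : pnorm (P * P') <= pnorm P * pnorm P'.
Proof.
have -> : P * P' = \sum_(i < size P) P`_i *: ('X^i * P').
  rewrite -{1}[P]coefK poly_def mulr_suml; apply: eq_bigr => i _.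
  by rewrite scalerAl.
apply: (le_trans (pnorm_sum _ _)); rewrite /pnorm mulr_suml.
by apply: ler_sum => i _; rewrite -/(pnorm _) pnormZ pnormXnM.
Qed.

Lemma pnormC (c : C) : pnorm c%:P = modulus c.
Proof. by rewrite (pnormE (size_polyC_leq1 c)) big_ord1 coefC eqxx. Qed.

Lemma pnorm_XsubC (c : C) : pnorm ('X - c%:P) <= 1 + modulus c.
Proof.
rewrite -pnormC -(pnormN c%:P) (le_trans (pnormD _ _)) // lerD2r.
by rewrite -['X]mulr1 -['X]expr1 pnormXnM pnormC modulus1.
Qed.

Lemma horner_le P (x : C) (K : R) n : (size P <= n)%N -> 1 <= K ->
  modulus x <= K -> modulus P.[x] <= pnorm P * K ^+ n.
Proof.
move=> Pn K1 xK; rewrite (horner_coef_wide _ Pn) (pnormE Pn) mulr_suml.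
apply: (le_trans (modulus_sum _ _ _)); apply: ler_sum => i _.
rewrite modulusM ler_wpM2l ?modulus_ge0 // modulusX.
apply: (@le_trans _ _ (K ^+ i)); first by rewrite lerXn2r ?nnegrE ?modulus_ge0 //; lra.
by rewrite ler_weXn2l // ltnW.
Qed.

Lemma pnorm_eq0 P : (forall e : R, 0 < e -> pnorm P < e) -> P = 0.
Proof.
move=> P0; apply/polyP => i; rewrite coef0; apply/eqP.
rewrite -modulus_eq0 eq_le modulus_ge0 andbT; apply/ler_addgt0Pr => e e0.
by rewrite add0r (le_trans (modulus_coef_le _ _)) // ltW // P0.
Qed.

(** The coefficients of the quotient by X - a are computed from the top by
    Horner's scheme, each step multiplying the size by at most 1 + K. *)
Lemma pnorm_divXsubC (P Q : {poly C}) (a : C) (K : R) n : (size Q <= n)%N ->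
  0 <= K -> modulus a <= K -> ('X - a%:P) * Q = P ->
  pnorm Q <= n%:R * (1 + K) ^+ n * pnorm P.
Proof.
move=> Qn K0 aK PE; have P0 := pnorm_ge0 P.
have coefE i : Q`_i = P`_i.+1 + a * Q`_i.+1.
  by rewrite -PE mulrBl coefB coefXM coefCM /= subrK.
have K1 : 1 <= 1 + K by lra.
have Qj j : modulus Q`_(n - j)%N <= pnorm P * (1 + K) ^+ j.
  elim: j => [|j IH].
    by rewrite subn0 nth_default // modulus0 mulr_ge0 // expr0.
  have [nj|jn] := leqP n j.
    have -> : (n - j.+1 = n - j)%N by lia.
    apply: (le_trans IH); rewrite ler_wpM2l // exprS ler_peMl ?exprn_ge0 //; lra.
  rewrite coefE (_ : (n - j.+1).+1 = n - j)%N; last by lia.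
  apply: (le_trans (modulusD _ _)); rewrite modulusM.
  have := modulus_coef_le P (n - j); have := modulus_ge0 Q`_(n - j).
  have := modulus_ge0 a; have Kj : 1 <= (1 + K) ^+ j by apply: exprn_ege1.
  rewrite exprS; move: (modulus P`_(n - j)) (modulus Q`_(n - j)) (modulus a) IH aK => u v b; nra.
rewrite (pnormE Qn); apply: (@le_trans _ _ (\sum_(i < n) pnorm P * (1 + K) ^+ n)).
  apply: ler_sum => i _; have := Qj (n - i)%N; rewrite subKn; last exact: ltnW.
  move/le_trans; apply; rewrite ler_wpM2l // ler_weXn2l //; lia.
by rewrite sumr_const card_ord -[_ *+ n]mulr_natl -mulrA (mulrC (pnorm P)).
Qed.

Definition rpoly s : {poly C} := \prod_(a <- s) ('X - a%:P).

Lemma rpoly_cons a s : rpoly (a :: s) = ('X - a%:P) * rpoly s.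
Proof. by rewrite /rpoly big_cons. Qed.

Lemma size_rpoly s : size (rpoly s) = (size s).+1.
Proof. exact: size_prod_XsubC. Qed.

Lemma rpoly_nseq0 n : rpoly (nseq n 0) = 'X^n.
Proof. by rewrite /rpoly big_nseq polyC0 subr0 iter_mulr_1. Qed.

Lemma rpoly_perm s t : perm_eq s t -> rpoly s = rpoly t.
Proof. exact: perm_big. Qed.

Lemma lead_rpoly s : (rpoly s)`_(size s) = 1.
Proof.
have /monicP := monic_prod_XsubC s predT id.
by rewrite lead_coefE -/(rpoly s) size_rpoly.
Qed.

Lemma horner_rpoly s x : (rpoly s).[x] = \prod_(a <- s) (x - a).
Proof. by rewrite horner_prod; apply: eq_bigr => a _; rewrite hornerXsubC. Qed.

(** Masks select sublists of matched roots; all masks are treated at once,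
    so that d does not depend on the sublist. *)
Lemma rpoly_mask_cont s (e : R) : 0 < e -> exists2 d : R, 0 < d & forall t b,
  size t = size s -> (forall i, (i < size s)%N -> modulus (t`_i - s`_i) < d) ->
  pnorm (rpoly (mask b t) - rpoly (mask b s)) < e.
Proof.
elim: s e => [|a s IH] e e0.
  exists 1 => // -[|? t] //= b _ _; rewrite !mask0 subrr pnorm0 //.
pose K := 2 + modulus a; have K0 : 2 <= K by rewrite /K lerDl modulus_ge0.
have e1 : 0 < Num.min e (e / (2 * K)) by rewrite lt_min e0 divr_gt0 //; lra.
have [d d0 dP] := IH _ e1.
have [M M0 MP] : exists2 M : R, 0 < M & forall b, pnorm (rpoly (mask b s)) <= M.
  elim: (s) => [|x s' [M M0 MP]].
    by exists 1 => // b; rewrite mask0 /rpoly big_nil pnormC modulus1.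
  exists ((1 + 1 + modulus x) * M).
    by rewrite mulr_gt0 //; have := modulus_ge0 x; lra.
  case=> [|[] b].
  - have := MP [::]; rewrite /= /rpoly big_nil pnormC modulus1.
    by have := modulus_ge0 x; nra.
  - rewrite /= rpoly_cons; apply: (le_trans (pnormM _ _)).
    have := MP b; have := pnorm_XsubC x; have := pnorm_ge0 (rpoly (mask b s')).
    by have := modulus_ge0 x; have := pnorm_ge0 ('X - x%:P); nra.
  - by rewrite /=; have := MP b; have := modulus_ge0 x; nra.
exists (Num.min (Num.min d 1) (e / (2 * M))).
  by rewrite !lt_min d0 ltr01 divr_gt0 //; lra.
move=> [|a' t] //= b [sz] ts.
have t_s i : (i < size s)%N -> modulus (t`_i - s`_i) < d.
  by move=> i_s; have := ts i.+1 i_s; rewrite !lt_min /= => /andP[/andP[]].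
have := ts 0%N isT; rewrite !lt_min /= => /andP[/andP[_ a'1] a'M].
case: b => [|[] b].
- by rewrite /= subrr pnorm0.
- rewrite /= !rpoly_cons.
  have -> : ('X - a'%:P) * rpoly (mask b t) - ('X - a%:P) * rpoly (mask b s) =
    ('X - a'%:P) * (rpoly (mask b t) - rpoly (mask b s)) -
    (a' - a)%:P * rpoly (mask b s) by rewrite polyCB; ring.
  apply: (le_lt_trans (pnormD _ _)); rewrite pnormN.
  have h1 : pnorm (('X - a'%:P) * (rpoly (mask b t) - rpoly (mask b s))) < e / 2.
    apply: (le_lt_trans (pnormM _ _)).
    have := dP t b sz t_s; rewrite lt_min => /andP[_ h].
    have a'K : pnorm ('X - a'%:P) <= K.
      apply: (le_trans (pnorm_XsubC _)); rewrite /K.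
      by have := modulus_ge_dist a' a; lra.
    apply: (@le_lt_trans _ _ (K * pnorm (rpoly (mask b t) - rpoly (mask b s)))).
      by rewrite ler_wpM2r ?pnorm_ge0.
    have eE : e / 2 = K * (e / (2 * K)) by field; lra.
    by rewrite eE ltr_pM2l //; lra.
  have h2 : pnorm ((a' - a)%:P * rpoly (mask b s)) <= e / 2.
    apply: (le_trans (pnormM _ _)); rewrite pnormC.
    have eE : e / 2 = e / (2 * M) * M by field; lra.
    by rewrite eE; apply: ler_pM; rewrite ?modulus_ge0 ?pnorm_ge0 // ltW.
  by lra.
- by have := dP t b sz t_s; rewrite lt_min => /andP[].
Qed.

Lemma rpoly_cont s (e : R) : 0 < e -> exists2 d : R, 0 < d & forall t,
  size t = size s -> (forall i, (i < size s)%N -> modulus (t`_i - s`_i) < d) ->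
  pnorm (rpoly t - rpoly s) < e.
Proof.
move=> e0; have [d d0 dP] := rpoly_mask_cont s e0; exists d => // t ts t_s.
have := dP t (nseq (size s) true) ts t_s.
by rewrite !mask_true ?ts.
Qed.

(** Continuity of the roots. If rpoly t is close to rpoly s, some root in t
    is close to the first root a of s, because the product of the distances
    from a to the roots in t is the small number (rpoly t - rpoly s).[a];
    then both roots are divided out. *)
Lemma roots_match s (e : R) : 0 < e -> exists2 d : R, 0 < d & forall t,
  size t = size s -> pnorm (rpoly t - rpoly s) < d ->
  exists2 t', perm_eq t' t & forall i, (i < size s)%N -> modulus (t'`_i - s`_i) < e.
Proof.
move=> e0; elim: s => [|a s [d d0 IH]]; first by exists 1 => // -[|? t] // _ _; exists [::].
set n := size s; pose K := 1 + modulus a; pose N := pnorm (rpoly s) + 1.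
have K1 : 1 <= K by rewrite /K lerDl modulus_ge0.
have N1 : 1 <= N by rewrite /N lerDr pnorm_ge0.
have N0 : 0 < N by apply: lt_le_trans N1.
pose Z := n.+1%:R * (1 + K) ^+ n.+1.
have Z0 : 0 < Z by rewrite mulr_gt0 // exprn_gt0 // addr_gt0 // (lt_le_trans ltr01).
have Z20 : 0 < 2 * Z by apply: mulr_gt0.
have ZN0 : 0 < 2 * Z * N by apply: mulr_gt0.
pose h := Num.min (Num.min e 1) (d / (2 * Z * N)).
have h0 : 0 < h by rewrite !lt_min e0 ltr01 /= divr_gt0.
(* The first bound is for the quotients by X - b and X - a, the second one for
   the existence of b. *)
pose g := Num.min (d / (2 * Z)) (h ^+ n.+1 / K ^+ n.+2).
have Kn0 : 0 < K ^+ n.+2 by rewrite exprn_gt0 //; lra.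
have g0 : 0 < g.
  by rewrite lt_min; apply/andP; split; apply: divr_gt0 => //; rewrite exprn_gt0.
exists g => // t tn tg.
have size_diff : (size (rpoly t - rpoly (a :: s))%R <= n.+2)%N.
  rewrite (leq_trans (size_polyD _ _)) // size_polyN !size_rpoly tn /= geq_max.
  by rewrite !leqnn.
have aK : modulus a <= K by rewrite /K lerDr.
have small : modulus (rpoly t).[a] < h ^+ n.+1.
  have := horner_le size_diff K1 aK; rewrite hornerD hornerN.
  rewrite (horner_rpoly (a :: s)) big_cons subrr mul0r subr0 => /le_lt_trans; apply.
  rewrite -ltr_pdivlMr //; apply: (lt_le_trans tg).
  by rewrite /g ge_min lexx orbT.
have /hasP[b bt ab] : has (fun b => modulus (a - b) < h) t.
  apply/negPn/negP => /hasPn far; move: small; apply/negP; rewrite -leNgt.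
  rewrite horner_rpoly modulus_prod -[n.+1]/(size (a :: s)) -tn.
  rewrite -[size t]count_predT -iter_mulr_1 -big_const_seq !big_seq.
  by apply: ler_prod => b /far; rewrite -leNgt (ltW h0).
have t_perm := perm_to_rem bt; set t1 := rem b t in t_perm.
have t1n : size t1 = n by have := perm_size t_perm; rewrite tn => -[].
have [hd1 hd2 hd3] : [/\ h <= e, h <= 1 & h <= d / (2 * Z * N)].
  by rewrite /h; split; rewrite !ge_min lexx ?orbT.
have [||t2 t2_perm t2s] := IH t1 => //.
  have bK : modulus b <= K.
    by have := modulus_ge_dist b a; rewrite modulus_distC /K; lra.
  have szd : (size (rpoly t1 - rpoly s)%R <= n.+1)%N.
    rewrite (leq_trans (size_polyD _ _)) // size_polyN !size_rpoly t1n geq_max.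
    by rewrite !leqnn.
  have K0 : 0 <= K by lra.
  have eqd : ('X - b%:P) * (rpoly t1 - rpoly s) =
      (rpoly t - rpoly (a :: s)) + (b - a)%:P * rpoly s.
    by rewrite (rpoly_perm t_perm) !rpoly_cons polyCB; ring.
  apply: (le_lt_trans (pnorm_divXsubC szd K0 bK eqd)); rewrite -/Z.
  have : pnorm ((rpoly t - rpoly (a :: s)) + (b - a)%:P * rpoly s) < d / Z.
    apply: (le_lt_trans (pnormD _ _)).
    have : pnorm ((b - a)%:P * rpoly s) <= d / (2 * Z).
      apply: (le_trans (pnormM _ _)); rewrite pnormC modulus_distC.
      have -> : d / (2 * Z) = d / (2 * Z * N) * N by field; apply/andP; split; lra.
      apply: ler_pM; rewrite ?modulus_ge0 ?pnorm_ge0 //; first by lra.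
      by rewrite /N lerDl.
    have : pnorm (rpoly t - rpoly (a :: s)) < d / (2 * Z).
      by apply: (lt_le_trans tg); rewrite /g ge_min lexx.
    have -> : d / Z = d / (2 * Z) + d / (2 * Z) by field; lra.
    by lra.
  by rewrite -(ltr_pM2l Z0) mulrCA divff ?mulr1 // gt_eqF.
exists (b :: t2).
  by rewrite perm_sym (perm_trans t_perm) // perm_cons perm_sym.
case=> [_|i i_s] /=; last exact: t2s.
by rewrite modulus_distC; lra.
Qed.

End PolynomialRoots.

(** The hypotheses on the interior scheme, gathered to be passed as one. *)
Definition admissible (R : realType) (r p : nat) (a : int -> R[i]) : Prop :=
  [/\ (0 < r)%N, (0 < p)%N, a (- r%:Z) != 0, a p%:Z != 0 & cauchy_stable r p a].

Section StableFactor.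
Variables (R : realType) (r p : nat) (a : int -> R[i]).
Local Notation C := R[i].
Hypothesis adm : admissible r p a.

Let r_gt0 : (0 < r)%N. Proof. by case: adm. Qed.
Let p_gt0 : (0 < p)%N. Proof. by case: adm. Qed.
Let a_left : a (- r%:Z) != 0. Proof. by case: adm. Qed.
Let a_right : a p%:Z != 0. Proof. by case: adm. Qed.
Let a_stable : cauchy_stable r p a. Proof. by case: adm. Qed.

(** X^r times the amplification polynomial: on the unit circle its modulus
    is that of the amplification factor of the scheme. *)
Definition symbol : {poly C} := \poly_(s < (r + p).+1) a (offset r s).

Local Notation charp := (char_poly_at r p a).
Local Notation inner := (interior_roots r p a).

Lemma symbol_circle (x : C) : modulus x = 1 -> modulus symbol.[x] <= 1.
Proof.
move=> /expi_onto[t _ ->]; have := a_stable t; rewrite normE lecR.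
suff -> : symbol.[expi t] = expi t ^+ r *
    \sum_(s < (r + p).+1) a (offset r s) * expi ((offset r s)%:~R * t).
  by rewrite modulusM modulusX modulus_expi expr1n mul1r.
rewrite (horner_coef_wide _ (size_poly _ _)) mulr_sumr; apply: eq_bigr => s _.
rewrite coef_poly ltn_ord mulrCA -!expiMn -expiD; congr (_ * expi _).
by rewrite /offset rmorphB /= -!pmulrn -[t *+ s]mulr_natl -[t *+ r]mulr_natl; ring.
Qed.

Lemma symbol_lead : symbol`_(r + p) = a p%:Z.
Proof. by rewrite coef_poly ltnSn /offset; congr a; lia. Qed.

Lemma symbol0 : symbol.[0] = a (- r%:Z).
Proof. by rewrite horner_coef0 coef_poly ltn0Sn /offset; congr a; lia. Qed.

Lemma charpE z : charp z = symbol - z *: 'X^r. Proof. by []. Qed.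

Lemma charp_lead z : (charp z)`_(r + p) = a p%:Z.
Proof.
rewrite charpE coefB symbol_lead coefZ coefXn.
have -> : (r + p == r)%N = false by lia.
by rewrite mulr0 subr0.
Qed.

Lemma size_charp z : size (charp z) = (r + p).+1.
Proof.
apply/eqP; rewrite eqn_leq; apply/andP; split; last first.
  rewrite ltnNge; apply/negP => /leq_sizeP/(_ (r + p)%N (leqnn _)).
  by rewrite charp_lead; apply/eqP.
rewrite charpE (leq_trans (size_polyD _ _)) // size_polyN geq_max size_poly /=.
by rewrite (leq_trans (size_scale_leq _ _)) // size_polyXn; lia.
Qed.

Lemma charp_roots z : charp z = a p%:Z *: rpoly (poly_roots (charp z)).
Proof.
rewrite /poly_roots; case: (closed_field_poly_normal _) => s E /=.
by rewrite [LHS]E lead_coefE size_charp /= charp_lead.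
Qed.

Lemma size_poly_roots z : size (poly_roots (charp z)) = (r + p)%N.
Proof.
by have := size_charp z; rewrite {1}charp_roots size_scale // size_rpoly => -[].
Qed.

Lemma charp_horner z x : (charp z).[x] = symbol.[x] - z * x ^+ r.
Proof. by rewrite charpE !hornerE. Qed.

Lemma charp0 z : (charp z).[0] = a (- r%:Z).
Proof. by rewrite charp_horner symbol0 expr0n gtn_eqF // mulr0 subr0. Qed.

Lemma charp_circle z x : 1 < modulus z -> modulus x = 1 -> (charp z).[x] != 0.
Proof.
move=> z1 x1; rewrite charp_horner subr_eq0; apply/eqP => E.
have := symbol_circle x1; rewrite E modulusM modulusX x1 expr1n mulr1.
by rewrite leNgt z1.
Qed.

Lemma mem_poly_roots z x : (x \in poly_roots (charp z)) = root (charp z) x.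
Proof. by rewrite {2}charp_roots rootZ // root_prod_XsubC. Qed.

Lemma poly_roots_circle z x : 1 < modulus z -> x \in poly_roots (charp z) ->
  modulus x != 1.
Proof.
by move=> z1; rewrite mem_poly_roots; apply: contraTneq => x1; apply: charp_circle.
Qed.

(** On the unit circle the term z x^r dominates the symbol, by Cauchy
    stability, so the curve described by the characteristic polynomial winds
    r times around the origin; this is also the number of its roots in the
    disc. *)
Lemma size_inner z : 1 < modulus z -> size (inner z) = r.
Proof.
move=> z1; have z0 : z != 0 by rewrite -modulus_gt0 (lt_trans ltr01).
pose e := @expi R; have le : unit_loop e := unit_loop_expi R.
have e0 t : e t != 0 by exact: expi_neq0.
have [ce _ e2pi] := le; pose s := poly_roots (charp z).
have -> : size (inner z) = count (fun x => modulus x < 1) s.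
  by rewrite size_filter; apply: eq_count => x; rewrite norm_lt1.
have w1 : is_winding_number (fun t => (charp z).[e t]) 0
    (1%Z *+ count (fun x => modulus x < 1) s).
  have -> : (fun t => (charp z).[e t]) = (fun t => a p%:Z * \prod_(x <- s) (e t - x)).
    by apply/funext => t; rewrite charp_roots hornerZ horner_rpoly.
  rewrite -[_ *+ _]add0r; apply: windM; first exact: wind_cst.
  apply: wind_prod => //; [exact: wind_expi|move=> x; exact: poly_roots_circle].
have w2 : is_winding_number (fun t => (charp z).[e t]) 0 (0 + (r%:Z + 0)).
  have -> : (fun t => (charp z).[e t]) =
      (fun t => - z * (e t ^+ r * (1 - symbol.[e t] / (z * e t ^+ r)))).
    by apply/funext => t; rewrite charp_horner; field; rewrite z0 expf_neq0.
  apply: windM; first exact: wind_cst.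
  apply: windM; first exact: wind_expiX.
  apply: wind_half_plane.
  - apply: cont_onD; first exact: cont_on_cst.
    apply: cont_onN; apply: cont_onM.
      have -> : (fun t => symbol.[e t]) = (fun t => \sum_(i < size symbol) symbol`_i * e t ^+ i).
        by apply/funext => t; rewrite horner_coef.
      by apply: cont_on_sum => i; apply: cont_onM (cont_onX i ce); exact: cont_on_cst.
    apply: cont_onV => [t _|]; first by rewrite mulf_neq0 // expf_neq0.
    by apply: cont_onM (cont_onX r ce); exact: cont_on_cst.
  - move=> t; apply: Re_gt0_near1; rewrite addrC addKr modulusN modulusM modulusV.
    rewrite modulusM modulusX modulus_expi expr1n mulr1.
    have z1' : 0 < modulus z by rewrite modulus_gt0.
    rewrite ltr_pdivrMr // mul1r; apply: le_lt_trans z1.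
    by apply: symbol_circle; rewrite modulus_expi.
  - by rewrite e2pi.
have := wind_uniq _ w1 w2; rewrite addr0 add0r => /(_ _) E.
have {E} : (1%Z *+ count (fun x => modulus x < 1) s) = r%:Z.
  by apply: E => t _; apply: charp_circle; rewrite ?modulus_expi.
by rewrite natz => -[].
Qed.

(** The factor of X^r - w * symbol, a multiple of the characteristic
    polynomial at z = 1 / w, that carries the stable roots. The value w = 0
    stands for z = oo, where all r stable roots tend to 0. *)
Definition sfactor (w : C) : {poly C} :=
  if w == 0 then 'X^r else rpoly (stable_roots r p a w^-1).

(** The cofactor of sfactor w when modulus w < 1, which carries the roots
    outside the disc. *)
Definition ufactor (w : C) : {poly C} :=
  if w == 0 then 1 else
  - (w * a p%:Z) *: rpoly [seq x <- poly_roots (charp w^-1) | ~~ (`|x| < 1)].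

Lemma disc_inv (w : C) : w != 0 -> modulus w < 1 -> 1 < modulus w^-1.
Proof. by move=> w0 w1; rewrite modulusV invf_gt1 // modulus_gt0. Qed.

Lemma sfactor_roots (w : C) : w != 0 -> sfactor w = rpoly (stable_roots r p a w^-1).
Proof. by rewrite /sfactor => /negbTE ->. Qed.

Lemma sfactor_inner (w : C) : w != 0 -> modulus w < 1 -> sfactor w = rpoly (inner w^-1).
Proof.
move=> w0 w1; rewrite /sfactor (negbTE w0) /stable_roots norm_gt1.
by rewrite disc_inv.
Qed.

Lemma sfactor_mul w : modulus w < 1 ->
  sfactor w * ufactor w = 'X^r - w *: symbol.
Proof.
move=> w1; have [->|w0] := eqVneq w 0.
  by rewrite /sfactor /ufactor eqxx mulr1 scale0r subr0.
rewrite sfactor_inner // /ufactor (negbTE w0) -scalerAr.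
have -> : rpoly (inner w^-1) *
    rpoly [seq x <- poly_roots (charp w^-1) | ~~ (`|x| < 1)] =
    rpoly (poly_roots (charp w^-1)).
  by rewrite /rpoly -big_cat; apply: perm_big; rewrite perm_filterC.
rewrite scaleNr -scalerA -charp_roots charpE scalerBr scalerA divff //.
by rewrite scale1r opprB.
Qed.

Lemma sfactor_monic w : modulus w < 1 -> exists2 s, size s = r &
  sfactor w = rpoly s /\ forall x, x \in s -> modulus x < 1.
Proof.
move=> w1; have [->|w0] := eqVneq w 0.
  exists (nseq r 0); first by rewrite size_nseq.
  split; last by move=> x /nseqP[-> _]; rewrite modulus0.
  by rewrite /sfactor eqxx rpoly_nseq0.
exists (inner w^-1); first by rewrite size_inner // disc_inv.
split; first exact: sfactor_inner.
by move=> x; rewrite mem_filter norm_lt1 => /andP[].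
Qed.

Lemma ufactor_neq0 w x : modulus w < 1 -> modulus x <= 1 -> (ufactor w).[x] != 0.
Proof.
move=> w1 x1; rewrite /ufactor; have [_|w0] := eqVneq w 0.
  by rewrite hornerC oner_eq0.
rewrite hornerZ mulf_eq0 oppr_eq0 mulf_eq0 (negbTE w0) (negbTE a_right) /=.
rewrite -rootE root_prod_XsubC mem_filter norm_lt1 -leNgt negb_and -ltNge.
move: x1; rewrite le_eqVlt => /predU1P[x1|->//].
apply/orP; right; apply/negP => /(poly_roots_circle (disc_inv w0 w1)).
by rewrite x1 eqxx.
Qed.

Lemma ufactor_roots w : w != 0 -> modulus w < 1 -> exists (c : C) (s : seq C),
  [/\ ufactor w = c *: rpoly s, c != 0 & forall x, x \in s -> 1 < modulus x].
Proof.
move=> w0 w1; exists (- (w * a p%:Z)), [seq x <- poly_roots (charp w^-1) | ~~ (`|x| < 1)].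
split; first by rewrite /ufactor (negbTE w0).
  by rewrite oppr_eq0 mulf_neq0.
move=> x; rewrite mem_filter norm_lt1 -leNgt => /andP[x1].
move=> /(poly_roots_circle (disc_inv w0 w1)) xn1.
by rewrite lt_def xn1.
Qed.

Lemma symbol_le (x : C) : modulus x <= 1 -> modulus symbol.[x] <= pnorm symbol.
Proof.
by move=> x1; have := horner_le (leqnn (size symbol)) (lexx 1) x1; rewrite expr1n mulr1.
Qed.

(** A root x of the stable factor satisfies x^r = w * symbol.[x], hence
    tends to 0 with w. *)
Lemma sfactor_cont0 (e : R) : 0 < e -> exists2 d : R, 0 < d &
  forall w, modulus w < 1 -> modulus w < d -> pnorm (sfactor w - sfactor 0) < e.
Proof.
move=> e0; have [d d0 dP] := rpoly_cont (nseq r (0 : C)) e0.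
have N0 : 0 < pnorm symbol + 1 by have := pnorm_ge0 symbol; lra.
exists (d ^+ r / (pnorm symbol + 1)); first by rewrite divr_gt0 // exprn_gt0.
move=> w w1 wd; have [->|w0] := eqVneq w 0; first by rewrite subrr pnorm0.
have w1' := disc_inv w0 w1.
have -> : sfactor 0 = rpoly (nseq r 0).
  by rewrite /sfactor eqxx rpoly_nseq0.
rewrite sfactor_inner //; apply: dP; first by rewrite size_nseq size_inner.
move=> i; rewrite size_nseq => ir; rewrite nth_nseq ir subr0.
set x := _`_i; have : x \in inner w^-1 by rewrite mem_nth // size_inner.
rewrite mem_filter norm_lt1 mem_poly_roots => /andP[x1].
rewrite /root charp_horner subr_eq0 => /eqP E.
have xE : x ^+ r = w * symbol.[x] by rewrite E mulVKf.
rewrite -(@ltr_pXn2r _ r) ?nnegrE ?modulus_ge0 ?(ltW d0) //.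
rewrite -modulusX xE modulusM; apply: (@le_lt_trans _ _ (modulus w * pnorm symbol)).
  by rewrite ler_wpM2l ?modulus_ge0 // symbol_le // ltW.
move: wd; rewrite ltr_pdivlMr // => wd; apply: le_lt_trans wd.
by rewrite ler_wpM2l ?modulus_ge0 // lerDl.
Qed.

(** The roots for w near w0 are matched with those for w0; the roots in the
    disc form a sublist of them, here a mask. *)
Lemma inner_near (w0 : C) (e : R) : w0 != 0 -> 0 < e -> exists2 d : R, 0 < d &
  forall w, modulus w < 1 -> modulus (w - w0) < d -> w != 0 /\
    exists2 t, size t = (r + p)%N /\
      (forall i, (i < r + p)%N -> modulus (t`_i - (poly_roots (charp w0^-1))`_i) < e)
    & perm_eq (inner w^-1) (mask [seq modulus x < 1 | x <- t] t).
Proof.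
move=> w00 e0; set s := poly_roots (charp w0^-1).
have [d d0 dP] := roots_match s e0.
have m0 : 0 < modulus w0 by rewrite modulus_gt0.
have ma : 0 < modulus (a p%:Z) by rewrite modulus_gt0.
pose d1 := Num.min (modulus w0 / 2) (d * modulus (a p%:Z) * modulus w0 ^+ 2 / 2).
exists d1.
  by rewrite lt_min !divr_gt0 //; apply: mulr_gt0; rewrite ?exprn_gt0 ?mulr_gt0.
move=> w w1; rewrite lt_min => /andP[wd1 wd2].
have wbig : modulus w0 / 2 < modulus w.
  by have := modulus_ge_dist w0 w; rewrite modulus_distC; lra.
have w_0 : w != 0 by rewrite -modulus_gt0; lra.
split=> //; have sz : size (poly_roots (charp w^-1)) = size s by rewrite !size_poly_roots.
have [|t t_perm t_s] := dP _ sz.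
  have -> : rpoly (poly_roots (charp w^-1)) - rpoly s =
      ((w0^-1 - w^-1) / a p%:Z) *: 'X^r.
    apply: (scalerI a_right); rewrite scalerBr -!charp_roots !charpE.
    by rewrite scalerA mulrCA divff // mulr1 scalerBl; ring.
  rewrite pnormZ -['X^r]mulr1 pnormXnM pnormC modulus1 mulr1 modulusM modulusV.
  have -> : w0^-1 - w^-1 = (w - w0) / (w * w0) by field; rewrite w_0 w00.
  rewrite modulusM modulusV modulusM -mulrA -invfM ltr_pdivrMr; last first.
    by rewrite !mulr_gt0 // modulus_gt0.
  apply: (lt_le_trans wd2).
  have mm : modulus w0 * modulus w0 / 2 <= modulus w * modulus w0.
    by rewrite mulrAC; rewrite ler_wpM2r // ltW.
  have -> : d * modulus (a p%:Z) * modulus w0 ^+ 2 / 2 =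
    d * (modulus w0 * modulus w0 / 2 * modulus (a p%:Z)) by ring.
  apply: ler_wpM2l; first exact: ltW.
  by apply: ler_wpM2r; first exact: ltW.
exists t.
  split; first by rewrite (perm_size t_perm) size_poly_roots.
  by move=> i ir; apply: t_s; rewrite size_poly_roots.
rewrite -filter_mask perm_sym (perm_trans (perm_filter _ t_perm)) //.
suff -> : inner w^-1 = [seq x <- poly_roots (charp w^-1) | modulus x < 1] by [].
by apply: eq_filter => x; rewrite norm_lt1.
Qed.

(** Inside the disc no root for w0 lies on the unit circle, so that a small
    perturbation keeps the mask that selects the stable roots. *)
Lemma sfactor_cont_disc (w0 : C) (e : R) : modulus w0 < 1 -> 0 < e ->
  exists2 d : R, 0 < d & forall w, modulus w < 1 -> modulus (w - w0) < d ->
    pnorm (sfactor w - sfactor w0) < e.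
Proof.
move=> w01 e0; have [->|w00] := eqVneq w0 0.
  have [d d0 dP] := sfactor_cont0 e0; exists d => // w w1; rewrite subr0; exact: dP.
set s := poly_roots (charp w0^-1).
have [d d0 dP] := rpoly_mask_cont s e0.
have [g g0 gP] : exists2 g : R, 0 < g & forall x, x \in s -> g < `|modulus x - 1|.
  have : forall x, x \in s -> modulus x != 1.
    by move=> x; apply: poly_roots_circle; exact: disc_inv.
  elim: (s) => [|y l IH] l1; first by exists 1.
  have [|g g0 gP] := IH; first by move=> x xl; apply: l1; rewrite inE xl orbT.
  have y1 : 0 < `|modulus y - 1| by rewrite normr_gt0 subr_eq0 l1 ?mem_head.
  exists (Num.min g (`|modulus y - 1| / 2)); first by rewrite lt_min g0 divr_gt0.
  move=> x; rewrite inE => /predU1P[->|xl]; rewrite gt_min; last by rewrite gP.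
  by apply/orP; right; lra.
have dg0 : 0 < Num.min d g by rewrite lt_min d0.
have [h h0 hP] := inner_near w00 dg0; exists h => // w w1 wh.
have [w_0 [t [t_sz ts] t_perm]] := hP w w1 wh.
have s_sz : size s = (r + p)%N by rewrite size_poly_roots.
have maskE : [seq modulus x < 1 | x <- t] = [seq modulus x < 1 | x <- s].
  apply: (@eq_from_nth _ false); first by rewrite !size_map t_sz s_sz.
  move=> i; rewrite size_map => i_t; rewrite !(nth_map 0) ?s_sz -?t_sz //.
  rewrite t_sz in i_t; have := ts i i_t; rewrite lt_min => /andP[_].
  have := gP s`_i; rewrite mem_nth ?s_sz // => /(_ isT).
  have := modulus_ge_dist t`_i s`_i; have := modulus_ge_dist s`_i t`_i.
  rewrite (modulus_distC s`_i) -/s; move: (modulus (_ - _)) => D h1 h2.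
  rewrite lter_normr => /orP[h3|h3] h4; apply/idP/idP; lra.
rewrite sfactor_inner // (sfactor_inner w00 w01) (rpoly_perm t_perm) maskE.
have -> : inner w0^-1 = mask [seq modulus x < 1 | x <- s] s.
  by rewrite -filter_mask; apply: eq_filter => x; rewrite norm_lt1.
apply: dP; first by rewrite t_sz s_sz.
by move=> i; rewrite s_sz => /ts; rewrite lt_min => /andP[].
Qed.

End StableFactor.

Global Opaque sfactor ufactor.

(** * The stable factor on the circle *)

Section LimitOfCandidates.
Variable R : realType.
Local Notation C := R[i].

Lemma pnorm_separated (l : seq ({poly C} * {poly C})) : exists2 e : R, 0 < e &
  forall x, x \in l -> x.1 != x.2 -> e <= pnorm (x.1 - x.2).
Proof.
elim: l => [|y l [e e0 le_e]]; first by exists 1.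
have [yE|yn] := eqVneq y.1 y.2.
  exists e => // x; rewrite inE => /predU1P[->|]; [by rewrite yE eqxx|exact: le_e].
have y0 : 0 < pnorm (y.1 - y.2).
  rewrite lt_def pnorm_ge0 andbT; apply: contra yn => /eqP y0.
  rewrite -subr_eq0; apply/eqP; apply: pnorm_eq0 => g g0.
  by rewrite y0.
exists (Num.min e (pnorm (y.1 - y.2))); first by rewrite lt_min e0.
move=> x; rewrite inE ge_min => /predU1P[-> _|xl xn]; first by rewrite lexx orbT.
by rewrite le_e.
Qed.

(** The point (1 - t) * w0 for a small t. *)
Lemma circle_approach (w0 : C) (d : R) : modulus w0 = 1 -> 0 < d ->
  exists2 w, modulus w < 1 & modulus (w - w0) < d.
Proof.
move=> w01 d0; pose t := Num.min (1 / 2) (d / 2) : R.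
have t0 : 0 < t by rewrite lt_min !divr_gt0.
have t1 : t < 1 by rewrite gt_min; apply/orP; left; lra.
have td : t < d by rewrite gt_min; apply/orP; right; lra.
exists ((1 - t)%:C%C * w0).
  by rewrite modulusM w01 modulus_real mulr1 ger0_norm; lra.
have -> : (1 - t)%:C%C * w0 - w0 = - t%:C%C * w0 by rewrite rmorphB /=; ring.
by rewrite modulusM modulusN w01 modulus_real mulr1 ger0_norm // ltW.
Qed.

(** Along a segment in the disc the distance from Q to a candidate is
    continuous and cannot cross the gap between two candidates, so a single
    candidate serves near w0. *)
Lemma limit_of_candidates (Q : C -> {poly C}) (w0 : C) (cands : seq {poly C}) :
  modulus w0 = 1 ->
  (forall w, modulus w < 1 -> forall e : R, 0 < e -> exists2 d : R, 0 < d &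
     forall w', modulus w' < 1 -> modulus (w' - w) < d -> pnorm (Q w' - Q w) < e) ->
  (forall e : R, 0 < e -> exists2 d : R, 0 < d & forall w, modulus w < 1 ->
     modulus (w - w0) < d -> exists2 c, c \in cands & pnorm (Q w - c) < e) ->
  exists2 c, c \in cands & forall e : R, 0 < e -> exists2 d : R, 0 < d &
    forall w, modulus w < 1 -> modulus (w - w0) < d -> pnorm (Q w - c) < e.
Proof.
move=> w01 cQ near_c.
have [g g0 sep] := pnorm_separated [seq (c, c') | c <- cands, c' <- cands].
have {}sep c c' : c \in cands -> c' \in cands -> pnorm (c - c') < g -> c = c'.
  move=> cc cc' lt_g; apply/eqP/negPn/negP => neq; move: lt_g; apply/negP.
  rewrite -leNgt; apply: (sep (c, c')) => //.
  by apply/allpairsP; exists (c, c').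
have g30 : 0 < g / 3 by lra.
have [d d0 dP] := near_c _ g30.
have [w1 w1_in w1d] := circle_approach w01 d0.
have [c cc w1c] := dP w1 w1_in w1d.
have near_g w : modulus w < 1 -> modulus (w - w0) < d -> pnorm (Q w - c) < g / 2.
  move=> w_in wd; rewrite ltNge; apply/negP => far.
  pose y (s : R) : C := w1 + s%:C%C * (w - w1).
  have yE s (v : C) : y s - v = (1 - s)%:C%C * (w1 - v) + s%:C%C * (w - v).
    by rewrite /y rmorphB /=; ring.
  have y_lt s v (K : R) : 0 <= s <= 1 -> modulus (w1 - v) < K -> modulus (w - v) < K ->
      modulus (y s - v) < K.
    move=> /andP[s0 s1] h1 h2; rewrite yE; apply: (le_lt_trans (modulusD _ _)).
    rewrite !modulusM !modulus_real !ger0_norm ?subr_ge0 //.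
    have [->|s_n0] := eqVneq s 0; first by rewrite subr0 mul0r addr0 mul1r.
    have s_gt0 : 0 < s by rewrite lt_def s_n0.
    have h3 : s * modulus (w - v) < s * K by rewrite ltr_pM2l.
    have h4 : (1 - s) * modulus (w1 - v) <= (1 - s) * K.
      by rewrite ler_wpM2l ?subr_ge0 // ltW.
    lra.
  have y_in s : 0 <= s <= 1 -> modulus (y s) < 1.
    by move=> s01; have := y_lt s 0 1 s01; rewrite !subr0; apply.
  pose f s := pnorm (Q (y s) - c).
  have cf : {within `[0, 1], continuous f}.
    apply/subspace_continuousP => s /=; rewrite in_itv /= => s01.
    apply/cvgrPdist_lt => e e0.
    have [h h0 hP] := cQ (y s) (y_in s s01) e e0.
    have ww1 : 0 < modulus (w - w1) + 1 by have := modulus_ge0 (w - w1); lra.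
    have k0 : 0 < h / (modulus (w - w1) + 1) by rewrite divr_gt0.
    apply/nbhs_ballP; exists (h / (modulus (w - w1) + 1)) => // u.
    rewrite /ball /= in_itv /= => us u01.
    have yy : modulus (y u - y s) < h.
      have -> : y u - y s = (u - s)%:C%C * (w - w1) by rewrite /y rmorphB /=; ring.
      rewrite modulusM modulus_real distrC.
      move: us; rewrite ltr_pdivlMr // => us; apply: le_lt_trans us.
      by rewrite ler_wpM2l // lerDl.
    have := hP _ (y_in u u01) yy; rewrite /f => lt_e.
    have := pnorm_dist3 (Q (y u)) (Q (y s)) c; have := pnorm_dist3 (Q (y s)) (Q (y u)) c.
    rewrite (pnorm_distC (Q (y s)) (Q (y u))) ltr_norml => h1 h2.
    by apply/andP; split; rewrite /from_subspace /=; lra.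
  have y0 : y 0 = w1 by rewrite /y mul0r addr0.
  have y1 : y 1 = w by rewrite /y mul1r addrCA subrr addr0.
  have f01 : Num.min (f 0) (f 1) <= g / 2 <= Num.max (f 0) (f 1).
    rewrite /f y0 y1 ge_min le_max far orbT andbT.
    by apply/orP; left; apply/ltW/(lt_trans w1c); lra.
  have [s] := IVT ler01 cf f01; rewrite in_itv /= => s01 fs.
  have [c' cc' yc'] := dP (y s) (y_in s s01) (y_lt s w0 d s01 w1d wd).
  have c'c : c' = c.
    apply: sep => //; apply: (le_lt_trans (pnorm_dist3 _ (Q (y s)) _)).
    by rewrite pnorm_distC; move: fs yc'; rewrite /f => -> *; lra.
  by move: fs yc'; rewrite /f c'c => ->; lra.
exists c => // e e0.
have eg0 : 0 < Num.min e (g / 3) by rewrite lt_min e0.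
have [d' d'0 d'P] := near_c _ eg0.
exists (Num.min d d'); first by rewrite lt_min d0.
move=> w w_in; rewrite lt_min => /andP[wd wd'].
have [c' cc'] := d'P w w_in wd'; rewrite lt_min => /andP[we wg].
suff <- : c' = c by [].
apply: sep => //; apply: (le_lt_trans (pnorm_dist3 _ (Q w) _)).
by have := near_g w w_in wd; rewrite (pnorm_distC c'); lra.
Qed.

End LimitOfCandidates.

Section StableFactorOnCircle.
Variables (R : realType) (r p : nat) (a : int -> R[i]).
Local Notation C := R[i].
Hypothesis adm : admissible r p a.

Let a_left : a (- r%:Z) != 0. Proof. by case: adm. Qed.

Local Notation charp := (char_poly_at r p a).
Local Notation inner := (interior_roots r p a).
Local Notation Q := (sfactor r p a).

Lemma sfactor_lead (w : C) : modulus w < 1 -> (Q w)`_r = 1.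
Proof.
move=> w1; have [s sr [-> _]] := sfactor_monic adm w1.
by rewrite -sr lead_rpoly.
Qed.

Lemma size_sfactor (w : C) : modulus w < 1 -> size (Q w) = r.+1.
Proof.
move=> w1; have [s sr [-> _]] := sfactor_monic adm w1.
by rewrite size_rpoly sr.
Qed.

(** At a point of the circle some roots may lie on the unit circle and the
    mask of the stable roots may vary with w; the polynomials of all
    sublists of the roots at w0 are the candidates for the limit. *)
Lemma sfactor_limit (w0 : C) : modulus w0 = 1 -> exists s, [/\ size s = r,
  forall x, x \in s -> root (charp w0^-1) x
  & forall e : R, 0 < e -> exists2 d : R, 0 < d & forall w, modulus w < 1 ->
      modulus (w - w0) < d -> w != 0 /\ pnorm (Q w - rpoly s) < e].
Proof.
move=> w01; have w00 : w0 != 0 by rewrite -modulus_gt0 w01.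
set s0 := poly_roots (charp w0^-1).
have s0_sz : size s0 = (r + p)%N by rewrite size_poly_roots.
pose cands := [seq rpoly (mask (tval b) s0) | b <- enum {: (r + p).-tuple bool}].
have near_c (e : R) : 0 < e -> exists2 d : R, 0 < d & forall w, modulus w < 1 ->
    modulus (w - w0) < d -> exists2 c, c \in cands & pnorm (Q w - c) < e.
  move=> e0; have [g g0 gP] := rpoly_mask_cont s0 e0.
  have [d d0 dP] := inner_near adm w00 g0; exists d => // w w1 wd.
  have [w_0 [t [t_sz ts] t_perm]] := dP w w1 wd.
  have bt_sz : size [seq modulus x < 1 | x <- t] == (r + p)%N by rewrite size_map t_sz.
  exists (rpoly (mask (Tuple bt_sz) s0)).
    by apply: (map_f (fun b : (r + p).-tuple bool => rpoly (mask (tval b) s0))); rewrite mem_enum.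
  rewrite sfactor_inner // (rpoly_perm t_perm); apply: gP; first by rewrite t_sz s0_sz.
  by move=> i; rewrite s0_sz => /ts.
have [|_ /mapP[b _ ->] limQ] := limit_of_candidates w01 _ near_c.
  by move=> w w1 e e0; apply: sfactor_cont_disc.
exists (mask b s0); split.
- have [d d0 dP] := limQ 1 ltr01; have [w w1 wd] := circle_approach w01 d0.
  have := dP w w1 wd; set s := mask b s0 => lt1.
  apply/eqP; apply/negPn/negP => neq; move: lt1; apply/negP; rewrite -leNgt.
  apply: (le_trans _ (modulus_coef_le _ (maxn (size s) r))); rewrite coefB.
  have [sr|rs] := ltnP (size s) r.
    rewrite sfactor_lead // [_`_r]nth_default ?size_rpoly //.
    by rewrite subr0 modulus1.
  rewrite lead_rpoly nth_default ?sub0r ?modulusN ?modulus1 //.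
  by rewrite size_sfactor // ltn_neqAle rs eq_sym neq.
- by move=> x /mem_mask; rewrite mem_poly_roots.
- move=> e e0; have [d d0 dP] := limQ e e0.
  exists (Num.min d 1); first by rewrite lt_min d0 ltr01.
  move=> w w1; rewrite lt_min => /andP[wd wd1]; split; last exact: dP.
  by apply/eqP => w_0; move: wd1; rewrite w_0 sub0r modulusN w01 ltxx.
Qed.

Lemma near_inv (z0 : C) (d : R) : modulus z0 = 1 -> 0 < d ->
  exists2 h : R, 0 < h & forall z, modulus (z - z0) < h ->
    z != 0 /\ modulus (z^-1 - z0^-1) < d.
Proof.
move=> z01 d0; have z00 : z0 != 0 by rewrite -modulus_gt0 z01.
exists (Num.min (1 / 2) (d / 2)); first by rewrite lt_min !divr_gt0.
move=> z; rewrite lt_min => /andP[h1 h2].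
have zbig : 1 / 2 < modulus z.
  by have := modulus_ge_dist z0 z; rewrite modulus_distC z01; lra.
have z_0 : z != 0 by rewrite -modulus_gt0; lra.
split=> //; have -> : z^-1 - z0^-1 = (z0 - z) / (z * z0) by field; rewrite z_0 z00.
rewrite modulusM modulusV modulusM z01 mulr1 modulus_distC ltr_pdivrMr ?modulus_gt0 //.
by nra.
Qed.

(** By continuity of the roots, a list whose monic polynomial is the limit
    of the stable factors is a limit of the lists of stable roots. *)
Lemma limit_multiset_ex (z0 : C) : modulus z0 = 1 ->
  exists s, is_limit_multiset r p a z0 s.
Proof.
move=> z01; have w01 : modulus z0^-1 = 1 by rewrite modulusV z01 invr1.
have [s [s_sz _ limQ]] := sfactor_limit w01; exists s => eps eps0.
have e0 : 0 < Re eps by move: eps0; rewrite ltcE => /andP[].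
have epsE : eps = (Re eps)%:C%C.
  by move: eps0; rewrite ltcE => /andP[/eqP/= + _]; case: (eps) => ? ? /= ->.
have [g g0 gP] := roots_match s e0; have [d d0 dP] := limQ g g0.
have [h h0 hP] := near_inv z01 d0.
apply/nbhs_modulus; exists h => // z zh; rewrite /exterior /= norm_gt1 => z1.
have [z_0 zd] := hP z zh.
have zV1 : modulus z^-1 < 1 by rewrite modulusV invf_lt1 // (lt_trans ltr01).
have [_] := dP _ zV1 zd; rewrite sfactor_inner ?invr_eq0 // invrK => lt_g.
have sz : size (inner z) = size s by rewrite size_inner.
have [t t_perm ts] := gP _ sz lt_g; exists t; split=> //.
  by rewrite (perm_size t_perm).
by move=> i i_s; rewrite normE epsE ltcR ts.
Qed.

Lemma stable_roots_circle (w0 : C) : modulus w0 = 1 ->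
  is_limit_multiset r p a w0^-1 (stable_roots r p a w0^-1).
Proof.
move=> w01; have z01 : modulus w0^-1 = 1 by rewrite modulusV w01 invr1.
rewrite /stable_roots norm_gt1 z01 ltxx.
exact: (@xgetPex _ _ [set s | is_limit_multiset r p a w0^-1 s] (limit_multiset_ex z01)).
Qed.

(** Whichever limit multiset is chosen to define the stable roots at a point
    of the circle, its polynomial is the limit of the stable factors. The
    stable roots there are not 0, since all candidates are made of roots of
    the characteristic polynomial, whose constant coefficient is a (- r). *)
Lemma sfactor_circle (w0 : C) : modulus w0 = 1 ->
  [/\ Q w0 = rpoly (stable_roots r p a w0^-1),
      size (stable_roots r p a w0^-1) = r,
      0 \notin stable_roots r p a w0^-1
    & forall e : R, 0 < e -> exists2 d : R, 0 < d & forall w, modulus w < 1 ->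
        modulus (w - w0) < d -> pnorm (Q w - Q w0) < e].
Proof.
move=> w01; have w00 : w0 != 0 by rewrite -modulus_gt0 w01.
have QE : Q w0 = rpoly (stable_roots r p a w0^-1).
  exact: sfactor_roots.
set s := stable_roots r p a w0^-1 in QE *.
have lim_s : is_limit_multiset r p a w0^-1 s := stable_roots_circle w01.
have near_s (e : C) : 0 < e -> exists2 d : R, 0 < d & forall w, modulus w < 1 ->
    modulus (w - w0) < d -> w != 0 /\ exists t, [/\ perm_eq t (inner w^-1),
      size t = size s & forall i, (i < size s)%N -> `|t`_i - s`_i| < e].
  move=> e0; have /nbhs_modulus[d d0 dP] := lim_s e e0.
  have [h h0 hP] := near_inv w01 d0; exists h => // w w1 wh.
  have [w_0 wd] := hP w wh; split=> //; apply: dP => //.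
  by rewrite /exterior /= norm_gt1 disc_inv.
have limQ (e : R) : 0 < e -> exists2 d : R, 0 < d & forall w, modulus w < 1 ->
    modulus (w - w0) < d -> pnorm (Q w - Q w0) < e.
  move=> e0; have [g g0 gP] := rpoly_cont s e0.
  have gC0 : 0 < g%:C%C :> C by rewrite ltcR.
  have [d d0 dP] := near_s _ gC0; exists d => // w w1 wd.
  have [w_0 [t [t_perm t_sz ts]]] := dP w w1 wd.
  rewrite sfactor_inner // -(rpoly_perm t_perm) QE; apply: gP => // i i_s.
  by have := ts i i_s; rewrite normE ltcR.
have s_sz : size s = r.
  have [d d0 dP] := near_s 1 ltr01; have [w w1 wd] := circle_approach w01 d0.
  have [w_0 [t [t_perm <- _]]] := dP w w1 wd.
  by rewrite (perm_size t_perm) size_inner // disc_inv.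
split=> //; have [s' [_ s'_root lim']] := sfactor_limit w01.
have s's : rpoly s' = rpoly s.
  apply/eqP; rewrite -subr_eq0; apply/eqP; apply: pnorm_eq0 => e e0.
  have e20 : 0 < e / 2 by lra.
  have [d d0 dP] := lim' _ e20; have [d' d'0 d'P] := limQ _ e20.
  have dd0 : 0 < Num.min d d' by rewrite lt_min d0.
  have [w w1] := circle_approach w01 dd0; rewrite lt_min => /andP[wd wd'].
  have [_ h1] := dP w w1 wd; have h2 := d'P w w1 wd'; rewrite QE in h2.
  by apply: (le_lt_trans (pnorm_dist3 _ (Q w) _)); rewrite pnorm_distC; lra.
apply/negP => s0; have : root (rpoly s) 0 by rewrite root_prod_XsubC.
rewrite -s's root_prod_XsubC => /s'_root.
by rewrite /root (charp0 adm) (negbTE a_left).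
Qed.

(** At a point of the circle, nearby points of the circle are replaced by
    points of the open disc where the stable factor is almost the same. *)
Lemma sfactor_cont i : cont_on (cdisc 1) (fun w => (Q w)`_i).
Proof.
apply/cont_onP => w0 w0_le e e0; suff [d d0 dP] : exists2 d : R, 0 < d &
    forall w, modulus w <= 1 -> modulus (w - w0) < d -> pnorm (Q w - Q w0) < e.
  exists d => // w w1 wd; rewrite -coefB; apply: le_lt_trans (dP w w1 wd).
  exact: modulus_coef_le.
move: w0_le; rewrite /cdisc /= le_eqVlt => /predU1P[w01|w01]; last first.
  have [d d0 dP] := sfactor_cont_disc adm w01 e0.
  exists (Num.min d (1 - modulus w0)); first by rewrite lt_min d0 subr_gt0.
  move=> w _; rewrite lt_min => /andP[wd ww0]; apply: dP => //.
  by have := modulus_ge_dist w w0; lra.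
have e20 : 0 < e / 2 by lra.
have [_ _ _ /(_ _ e20)[d d0 dP]] := sfactor_circle w01.
have d20 : 0 < d / 2 by lra.
exists (d / 2) => // w; rewrite le_eqVlt => /predU1P[w1|w1] wd; last first.
  apply: (@lt_trans _ _ (e / 2)); last by lra.
  by apply: dP => //; lra.
have [_ _ _ /(_ _ e20)[d' d'0 d'P]] := sfactor_circle w1.
have dd0 : 0 < Num.min (d / 2) d' by rewrite lt_min d20.
have [w' w'1] := circle_approach w1 dd0; rewrite lt_min => /andP[w'd w'd'].
have w'w0 : modulus (w' - w0) < d by have := modulus_dist3 w' w w0; lra.
have h1 := dP w' w'1 w'w0; have h2 := d'P w' w'1 w'd'.
apply: (le_lt_trans (pnorm_dist3 (Q w) (Q w') (Q w0))).
have h3 : pnorm (Q w - Q w') < e / 2 by rewrite -pnormN opprB.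
by apply: (lt_le_trans (ltrD h3 h1)); rewrite -splitr.
Qed.

End StableFactorOnCircle.

(** * From confluent Vandermonde matrices to companion matrices *)

Section Companion.
Variables (F : fieldType) (k : nat).
Implicit Types (P Q : {poly F}).

Definition compmx Q : 'M[F]_k.+1 :=
  \matrix_(i < k.+1, j < k.+1) (if i == k :> nat then - Q`_j else (i.+1 == j)%:R).

(** For N the companion matrix of Q, row q lists the coefficients of the
    remainder of X^q modulo Q. *)
Definition powmx n (N : 'M[F]_k.+1) : 'M[F]_(n, k.+1) :=
  \matrix_(q < n, c < k.+1) (N ^+ q) 0 c.

Lemma compmx_expr0 Q i j : (i < k.+1)%N -> (compmx Q ^+ i) 0 j = (i == j)%:R.
Proof.
elim: i j => [|i IH] j ik; first by rewrite expr0 mxE.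
rewrite exprSr mxE (bigD1 (Ordinal (ltnW ik))) //= IH ?(ltnW ik) // eqxx mul1r.
rewrite big1 => [|l li].
  rewrite addr0 mxE /=; have -> : (i == k) = false by lia.
  by [].
rewrite IH ?(ltnW ik) //; have -> : (i == l) = false.
  by apply/negbTE; move: li; apply: contraNneq => il; apply/eqP/val_inj.
by rewrite mul0r.
Qed.

Lemma horner_mx_sum (N : 'M[F]_k.+1) P n : (size P <= n)%N ->
  horner_mx N P = \sum_(i < n) P`_i *: N ^+ i.
Proof.
move=> Pn; have {1}-> : P = \sum_(i < n) P`_i *: 'X^i.
  rewrite -poly_def; apply/polyP => i; rewrite coef_poly.
  by case: ltnP => // ni; rewrite nth_default // (leq_trans Pn).
rewrite rmorph_sum; apply: eq_bigr => i _ /=.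
by rewrite linearZ rmorphXn /= horner_mx_X.
Qed.

(** The first row of the matrix N^i is the i-th vector of the canonical
    basis for i <= k. *)
Lemma horner_compmx0 Q P j : (size P <= k.+1)%N ->
  (horner_mx (compmx Q) P) 0 j = P`_j.
Proof.
move=> Pk; rewrite (horner_mx_sum _ Pk) summxE (bigD1 j) //= mxE compmx_expr0 //.
rewrite eqxx mulr1 big1 ?addr0 // => i ij.
by rewrite mxE compmx_expr0 // val_eqE (negbTE ij) mulr0.
Qed.

Lemma compmx_exprk Q j : (compmx Q ^+ k.+1) 0 j = - Q`_j.
Proof.
rewrite exprSr mxE (bigD1 ord_max) //= compmx_expr0 // eqxx mul1r.
rewrite mxE eqxx big1 ?addr0 // => l lk; rewrite compmx_expr0 //.
have -> : (k == l) = false.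
  by apply/negbTE; move: lk; apply: contraNneq => kl; apply/eqP/val_inj.
by rewrite mul0r.
Qed.

(** Cayley-Hamilton, read on the first row; the row i is the first one
    multiplied by N^i, which commutes with Q N. *)
Lemma horner_compmx_self Q : size Q = k.+2 -> Q`_k.+1 = 1 ->
  horner_mx (compmx Q) Q = 0.
Proof.
move=> Qs Q1; set N := compmx Q.
have row0 j : (horner_mx N Q) 0 j = 0.
  rewrite (horner_mx_sum N (n := k.+2)) ?Qs // big_ord_recr /= Q1 scale1r mxE.
  rewrite compmx_exprk summxE (bigD1 j) //= mxE compmx_expr0 // eqxx mulr1.
  rewrite big1 ?addr0 ?subrr // => i ij.
  by rewrite mxE compmx_expr0 // val_eqE (negbTE ij) mulr0.
apply/matrixP => i j; rewrite [RHS]mxE.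
have : (N ^+ i * horner_mx N Q) 0 j = (horner_mx N Q * N ^+ i) 0 j.
  congr (fun_of_matrix _ 0 j); apply: comm_mx_horner.
  by apply/commr_sym/commrX.
rewrite [LHS]mxE (bigD1 i) //= compmx_expr0 // eqxx mul1r [X in _ + X = _]big1 => [|l li].
  rewrite addr0 => ->; rewrite mxE big1 // => l _.
  by rewrite row0 mul0r.
by rewrite compmx_expr0 // val_eqE eq_sym (negbTE li) mul0r.
Qed.

(** The companion matrix shifts the window v q, ..., v (q + k) of a solution
    of the recurrence. *)
Lemma compmx_recurrence Q (v : nat -> F) : Q`_k.+1 = 1 ->
  (forall q, \sum_(i < k.+2) Q`_i * v (q + i)%N = 0) ->
  forall q, v q = \sum_(c < k.+1) (compmx Q ^+ q) 0 c * v c.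
Proof.
move=> Q1 rec q; pose V q : 'cV[F]_k.+1 := \col_i v (q + i)%N.
have step q' : compmx Q *m V q' = V q'.+1.
  apply/matrixP => i j; rewrite !mxE; have [ik|ik] := eqVneq (i : nat) k.
    have := rec q'; rewrite big_ord_recr /= Q1 mul1r ik => /eqP.
    rewrite addrC addr_eq0 addSnnS => /eqP ->; rewrite -sumrN.
    by apply: eq_bigr => l _; rewrite !mxE ik eqxx mulNr.
  have ik' : (i.+1 < k.+1)%N by rewrite ltn_neqAle eqSS ik ltn_ord.
  rewrite (bigD1 (Ordinal ik')) //= !mxE (negbTE ik) eqxx mul1r big1 => [|l li].
    by rewrite addr0 addSnnS.
  rewrite !mxE (negbTE ik); have -> : (i.+1 == l :> nat) = false.
    by apply/negbTE; move: li; apply: contraNneq => il; apply/eqP/val_inj.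
  by rewrite mul0r.
have powV : forall q', compmx Q ^+ q' *m V 0%N = V q'.
  elim=> [|q' IH]; first by rewrite expr0 mul1mx.
  by rewrite exprS -mulmxA IH step.
have := congr1 (fun A : 'cV[F]_k.+1 => A 0 0) (powV q).
rewrite !mxE addn0 => <-; apply: eq_bigr => c _.
by rewrite mxE add0n.
Qed.

(** P vanishes at the companion matrix N of its divisor Q, and the sum is
    the first entry of N^q P(N) u. *)
Lemma powmx_recurrence Q P (u : 'cV[F]_k.+1) q : size Q = k.+2 -> Q`_k.+1 = 1 ->
  Q %| P -> \sum_(i < size P) P`_i * (compmx Q ^+ (q + i) *m u) 0 0 = 0.
Proof.
move=> Qs Q1 QP; set N := compmx Q.
have PN : horner_mx N P = 0.
  by rewrite -(divpK QP) rmorphM /= horner_compmx_self ?mulr0.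
have : (N ^+ q * horner_mx N P *m u) 0 0 = 0 by rewrite PN mulr0 mul0mx mxE.
rewrite (horner_mx_sum N (leqnn (size P))) mulr_sumr mulmx_suml summxE => h0.
rewrite -[RHS]h0; apply: eq_bigr => i _; rewrite -scalerAr -exprD -scalemxAl.
by rewrite [RHS]mxE.
Qed.

(** The inverse is given by a Bezout relation modulo Q. *)
Lemma compmx_unit Q P : size Q = k.+2 -> Q`_k.+1 = 1 -> coprimep P Q ->
  horner_mx (compmx Q) P \in unitmx.
Proof.
move=> Qs Q1 /Bezout_eq1_coprimepP[[u v] /= uv1].
have := congr1 (horner_mx (compmx Q)) uv1.
rewrite rmorphD !rmorphM /= horner_compmx_self // mulr0 addr0 rmorph1 => h.
by have [] := mulmx1_unit h.
Qed.

End Companion.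

Section ConfluentColumns.
Variable R : realType.
Local Notation C := R[i].
Implicit Types (P : {poly C}) (kappa : C) (s : seq C).

(** X d/dX, for which X^q is an eigenvector with eigenvalue q: its iterates
    evaluated at kappa produce the columns q^s * kappa^q. *)
Definition euler_op P : {poly C} := 'X * P^`().

Lemma coef_euler_iter t P i : (iter t euler_op P)`_i = P`_i * i%:R ^+ t.
Proof.
elim: t => [|t IH]; first by rewrite expr0 mulr1.
rewrite /= /euler_op coefXM coef_deriv; case: i IH => [|i] IH.
  by rewrite expr0n mulr0.
by rewrite IH /= exprSr mulrA -[LHS]mulr_natr.
Qed.

Lemma horner_euler_iter t P n x : (size P <= n)%N ->
  (iter t euler_op P).[x] = \sum_(i < n) P`_i * (i%:R ^+ t * x ^+ i).
Proof.
move=> Pn; have sz : (size (iter t euler_op P) <= n)%N.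
  apply/leq_sizeP => j nj; rewrite coef_euler_iter nth_default ?mul0r //.
  exact: leq_trans nj.
rewrite (horner_coef_wide _ sz); apply: eq_bigr => i _.
by rewrite coef_euler_iter mulrA.
Qed.

Lemma dvdp_euler n P x : ('X - x%:P) ^+ n.+1 %| P -> ('X - x%:P) ^+ n %| euler_op P.
Proof.
move=> /dvdpP[T ->]; rewrite /euler_op derivM deriv_exp derivXsubC mul1r.
rewrite dvdp_mull // dvdp_add //; first by rewrite exprS mulrA dvdp_mull.
by rewrite dvdp_mull //= -mulr_natr dvdp_mulr.
Qed.

Lemma dvdp_euler_iter t n P x :
  ('X - x%:P) ^+ (n + t) %| P -> ('X - x%:P) ^+ n %| iter t euler_op P.
Proof.
elim: t n => [|t IH] n; first by rewrite addn0.
by rewrite -addSnnS => /IH h; apply: dvdp_euler.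
Qed.

(** For x <> 0 the values at x of the first n iterates of the Euler operator
    determine the first n derivatives at x. *)
Lemma euler_dvdp n P x : x != 0 ->
  (forall t, (t < n)%N -> root (iter t euler_op P) x) -> ('X - x%:P) ^+ n %| P.
Proof.
move=> x0; elim: n P => [|n IH] P Px; first by rewrite expr0 dvd1p.
have P'n : ('X - x%:P) ^+ n %| euler_op P.
  by apply: IH => t tn; rewrite -iterSr; apply: Px.
have {}P'n : ('X - x%:P) ^+ n %| P^`().
  rewrite -(@Gauss_dvdpr _ _ 'X) //; apply: coprimep_expl.
  by rewrite coprimep_sym coprimep_XsubC rootX.
have [->|Pn0] := eqVneq P 0; first exact: dvdp0.
have [m [T]] := multiplicity_XsubC P x; rewrite Pn0 /= => Tx PE.
case: m PE => [|m] PE.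
  by have := Px 0%N isT; rewrite /= PE expr0 mulr1 (negbTE Tx).
rewrite PE dvdp_mull // dvdp_exp2l // ltnS leqNgt; apply/negP => mn.
move: P'n; rewrite PE derivM deriv_exp derivXsubC mul1r => P'n.
have : ('X - x%:P) ^+ m.+1 %| T^`() * ('X - x%:P) ^+ m.+1 + T * (('X - x%:P) ^+ m *+ m.+1).
  exact: dvdp_trans (dvdp_exp2l _ mn) P'n.
rewrite dvdp_addr; last exact: dvdp_mull.
rewrite -mulr_natr mulrCA exprSr.
rewrite dvdp_mul2l ?expf_neq0 ?polyXsubC_eq0 // dvdp_XsubCl rootM (negbTE Tx) /=.
by rewrite -polyC_natr rootC pnatr_eq0.
Qed.

Lemma rpoly_count s : rpoly s = \prod_(x <- undup s) ('X - x%:P) ^+ count_mem x s.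
Proof. by rewrite /rpoly prodr_undup_exp_count. Qed.

Lemma dvdp_count_rpoly s x : ('X - x%:P) ^+ count_mem x s %| rpoly s.
Proof.
have [xs|xs] := boolP (x \in s); last by rewrite (count_memPn xs) expr0 dvd1p.
rewrite rpoly_count (big_rem x) ?mem_undup //=; exact: dvdp_mulr.
Qed.

Lemma rpoly_dvdp s P : (forall x, x \in s -> ('X - x%:P) ^+ count_mem x s %| P) ->
  rpoly s %| P.
Proof.
move=> sP; rewrite rpoly_count.
have : {subset undup s <= s} by move=> x; rewrite mem_undup.
elim: (undup s) (undup_uniq s) => [|x l IH] /=; first by rewrite big_nil dvd1p.
move=> /andP[xl ul] ls; rewrite big_cons Gauss_dvdp.
  rewrite sP ?ls ?mem_head //=; apply: IH => // y yl.
  by apply: ls; rewrite inE yl orbT.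
apply: coprimep_expl; rewrite coprimep_sym coprimep_XsubC /root horner_prod.
rewrite prodf_seq_neq0; apply/allP => y yl /=.
rewrite horner_exp hornerXsubC expf_neq0 // subr_eq0.
by apply: contraNneq xl => ->.
Qed.

Lemma mem_mode_indices s x t :
  ((x, t) \in mode_indices s) = (x \in s) && (t < count_mem x s)%N.
Proof.
apply/allpairsPdep/andP => [[y [u [ys us [-> ->]]]]|[xs tx]].
  by move: ys us; rewrite mem_undup mem_iota.
by exists x, t; rewrite mem_undup mem_iota.
Qed.

Lemma size_mode_indices s : size (mode_indices s) = size s.
Proof.
rewrite size_allpairs_dep -(perm_size (perm_count_undup s)) size_flatten /shape.
rewrite -map_comp; congr sumn; apply: eq_map => x /=.
by rewrite size_iota size_nseq.
Qed.

Definition confluent_mx (n k : nat) s : 'M[C]_(n, k) :=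
  \matrix_(q < n, c < k) let mode := nth (0, 0%N) (mode_indices s) c in
    q%:R ^+ mode.2 * mode.1 ^+ q.

Lemma rpoly_mode_recurrence s x t q : x \in s -> (t < count_mem x s)%N ->
  \sum_(i < (size s).+1) (rpoly s)`_i * ((q + i)%:R ^+ t * x ^+ (q + i)) = 0.
Proof.
move=> xs tx; have sz : (size ('X^q * rpoly s)%R <= q + (size s).+1)%N.
  by rewrite (leq_trans (size_polyMleq _ _)) // size_polyXn size_rpoly.
have : (iter t euler_op ('X^q * rpoly s)).[x] = 0.
  apply/eqP; rewrite -/(root _ x) -dvdp_XsubCl -['X - _]expr1.
  apply: dvdp_euler_iter; apply: dvdp_mull.
  by apply: dvdp_trans (dvdp_count_rpoly s x); apply: dvdp_exp2l; rewrite add1n.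
rewrite (horner_euler_iter _ _ sz) big_split_ord /= big1 => [|i _].
  rewrite add0r => h0; rewrite -[RHS]h0; apply: eq_bigr => i _.
  by rewrite coefXnM ltnNge leq_addr addKn.
by rewrite coefXnM ltn_ord mul0r.
Qed.

(** A left null vector is a polynomial of degree less than k that vanishes
    at each root with its multiplicity, hence is divisible by rpoly s, of
    degree k. *)
Lemma confluent_unit k s : size s = k -> 0 \notin s -> confluent_mx k k s \in unitmx.
Proof.
move=> sk s0; rewrite -row_free_unit; apply: inj_row_free => u uK.
have Pk : (size (rVpoly u) <= k)%N by exact: size_poly.
suff P0 : rVpoly u = 0 by rewrite -[u]rVpolyK P0 linear0.
apply/eqP; apply/negPn/negP => Pn0.
have : rpoly s %| rVpoly u.
  apply: rpoly_dvdp => x xs; apply: euler_dvdp => [|t tx].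
    by apply: contraNneq s0 => <-.
  have xt : (x, t) \in mode_indices s by rewrite mem_mode_indices xs tx.
  have ck : (index (x, t) (mode_indices s) < k)%N.
    by rewrite -sk -size_mode_indices index_mem.
  have := congr1 (fun A : 'rV[C]_k => A 0 (Ordinal ck)) uK; rewrite !mxE => uK0.
  rewrite /root (horner_euler_iter _ _ Pk) -[X in _ == X]uK0; apply/eqP.
  apply: eq_bigr => i _; rewrite !mxE /= nth_index //= coef_rVpoly_ord.
  by [].
move=> /dvdp_leq; rewrite Pn0 size_rpoly sk => /(_ isT).
by rewrite leqNgt ltnS Pk.
Qed.

Lemma confluent_mxE n k s : size s = k.+1 ->
  confluent_mx n k.+1 s = powmx n (compmx k (rpoly s)) *m confluent_mx k.+1 k.+1 s.
Proof.
move=> sk; apply/matrixP => q c; rewrite !mxE.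
have : nth (0, 0%N) (mode_indices s) c \in mode_indices s.
  by apply: mem_nth; rewrite size_mode_indices sk.
case E: (nth _ _ _) => [x t] /=; rewrite mem_mode_indices => /andP[xs tx].
have Q1 : (rpoly s)`_k.+1 = 1 by rewrite -sk lead_rpoly.
have rec q' : \sum_(i < k.+2) (rpoly s)`_i * ((q' + i)%:R ^+ t * x ^+ (q' + i)) = 0.
  by have := rpoly_mode_recurrence q' xs tx; rewrite sk.
rewrite (compmx_recurrence (v := fun q => q%:R ^+ t * x ^+ q) Q1 rec q).
apply: eq_bigr => i _; by rewrite !mxE E.
Qed.

End ConfluentColumns.

Section KreissLopatinskii.
Variables (R : realType) (k p m : nat) (a : int -> R[i]) (b : int -> nat -> R[i]).
Local Notation C := R[i].
Local Notation r := k.+1.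
Hypothesis adm : admissible r p a.

(** With z = 1 / w, this is 1 - z^-1 * B * K_{0,m-1} * K_{0,r-1}^-1, written
    in terms of the stable factor so that it extends to w = 0. *)
Definition lop_mx (w : C) : 'M[C]_r :=
  1%:M - w *: (boundary_mx r m a b *m powmx m (compmx k (sfactor r p a w))).

Lemma stable_rootsP (z : C) : 1 <= modulus z ->
  [/\ rpoly (stable_roots r p a z) = sfactor r p a z^-1,
      size (stable_roots r p a z) = r & 0 \notin stable_roots r p a z].
Proof.
rewrite le_eqVlt => /predU1P[z1|z1].
  have w1 : modulus z^-1 = 1 by rewrite modulusV -z1 invr1.
  by have := sfactor_circle adm w1; rewrite invrK => -[-> ? ? _].
have z0 : z != 0 by rewrite -modulus_gt0 (lt_trans ltr01).
have w1 : modulus z^-1 < 1 by rewrite modulusV invf_lt1 // (lt_trans ltr01).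
rewrite sfactor_inner ?invr_eq0 // invrK /stable_roots norm_gt1 z1.
split=> //; first exact: (size_inner adm).
rewrite mem_filter (mem_poly_roots adm) /root (charp0 adm).
by case: adm => _ _ /negbTE -> _ _; rewrite andbF.
Qed.

(** Each column of the confluent Vandermonde matrix satisfies the recurrence
    of the stable factor, so K_{0,m-1} is the matrix of powers of the
    companion matrix times K_{0,r-1}, which cancels in the quotient of
    determinants. *)
Lemma KL_detE (z : C) : 1 <= modulus z ->
  KL_det r p m a b z = z ^+ r * \det (lop_mx z^-1).
Proof.
move=> z1; have [QE sz s0] := stable_rootsP z1.
have z0 : z != 0 by rewrite -modulus_gt0 (lt_le_trans ltr01).
rewrite /KL_det; set s := stable_roots r p a z in QE sz s0 *.
have KE n : Kmx r p n a z = confluent_mx n r s by [].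
rewrite !KE (confluent_mxE m sz) QE; set B := boundary_mx _ _ _ _.
set M := powmx _ _; set K := confluent_mx _ _ _.
have -> : z *: K - B *m (M *m K) = (z *: lop_mx z^-1) *m K.
  rewrite /lop_mx -/B -/M scalerBr scalerA divff // scale1r mulmxBl mulmxA.
  by rewrite -scalemxAl mul1mx.
rewrite det_mulmx mulfK; first by rewrite detZ.
by rewrite -unitfE -unitmxE; exact: confluent_unit.
Qed.

End KreissLopatinskii.

(** * The algebra generated by the stable factor *)

Section RationalFunctions.
Variables (R : realType) (T : Type) (D : set T).
Local Notation C := R[i].

(** Rational expressions in the functions of G whose denominators do not
    vanish on D; the clause ratfun_ext makes the class insensitive to the
    values outside D. *)
Inductive ratfun (G : (T -> C) -> Prop) : (T -> C) -> Prop :=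
| ratfun_gen g : G g -> ratfun G g
| ratfun_cst c : ratfun G (fun=> c)
| ratfunD f g : ratfun G f -> ratfun G g -> ratfun G (fun t => f t + g t)
| ratfunM f g : ratfun G f -> ratfun G g -> ratfun G (fun t => f t * g t)
| ratfunV f : (forall t, D t -> f t != 0) -> ratfun G f -> ratfun G (fun t => (f t)^-1)
| ratfun_ext f g : (forall t, D t -> f t = g t) -> ratfun G f -> ratfun G g.

Variable G : (T -> C) -> Prop.

Lemma ratfunN f : ratfun G f -> ratfun G (fun t => - f t).
Proof.
move=> Gf; apply: ratfun_ext (ratfunM (ratfun_cst _ (-1)) Gf) => t _ /=.
by rewrite mulN1r.
Qed.

Lemma ratfun_sum I (s : seq I) (P : pred I) (F : I -> T -> C) :
  (forall i, ratfun G (F i)) -> ratfun G (fun t => \sum_(i <- s | P i) F i t).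
Proof.
move=> GF; elim: s => [|i s IH].
  by apply: ratfun_ext (ratfun_cst _ 0) => t _; rewrite big_nil.
have [Pi|nPi] := boolP (P i).
  by apply: ratfun_ext (ratfunD (GF i) IH) => t _; rewrite big_cons Pi.
by apply: ratfun_ext IH => t _; rewrite big_cons (negbTE nPi).
Qed.

Lemma ratfun_prod I (s : seq I) (P : pred I) (F : I -> T -> C) :
  (forall i, ratfun G (F i)) -> ratfun G (fun t => \prod_(i <- s | P i) F i t).
Proof.
move=> GF; elim: s => [|i s IH].
  by apply: ratfun_ext (ratfun_cst _ 1) => t _; rewrite big_nil.
have [Pi|nPi] := boolP (P i).
  by apply: ratfun_ext (ratfunM (GF i) IH) => t _; rewrite big_cons Pi.
by apply: ratfun_ext IH => t _; rewrite big_cons (negbTE nPi).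
Qed.

Definition ratmx n1 n2 (A : T -> 'M[C]_(n1, n2)) :=
  forall i j, ratfun G (fun t => A t i j).

Lemma ratmx_cst n1 n2 (A : 'M[C]_(n1, n2)) : ratmx (fun=> A).
Proof. by move=> i j; apply: ratfun_cst. Qed.

Lemma ratmxD n1 n2 (A B : T -> 'M[C]_(n1, n2)) : ratmx A -> ratmx B ->
  ratmx (fun t => A t + B t).
Proof.
by move=> GA GB i j; apply: ratfun_ext (ratfunD (GA i j) (GB i j)) => t _; rewrite mxE.
Qed.

Lemma ratmxN n1 n2 (A : T -> 'M[C]_(n1, n2)) : ratmx A -> ratmx (fun t => - A t).
Proof. by move=> GA i j; apply: ratfun_ext (ratfunN (GA i j)) => t _; rewrite mxE. Qed.

Lemma ratmxZ n1 n2 f (A : T -> 'M[C]_(n1, n2)) : ratfun G f -> ratmx A ->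
  ratmx (fun t => f t *: A t).
Proof.
by move=> Gf GA i j; apply: ratfun_ext (ratfunM Gf (GA i j)) => t _; rewrite mxE.
Qed.

Lemma ratmxM n1 n2 n3 (A : T -> 'M[C]_(n1, n2)) (B : T -> 'M[C]_(n2, n3)) :
  ratmx A -> ratmx B -> ratmx (fun t => A t *m B t).
Proof.
move=> GA GB i j; apply: (@ratfun_ext _ (fun t => \sum_l A t i l * B t l j)).
  by move=> t _; rewrite mxE.
by apply: ratfun_sum => l; apply: ratfunM.
Qed.

Lemma ratmxX n (A : T -> 'M[C]_n) e : ratmx A -> ratmx (fun t => A t ^+ e).
Proof.
move=> GA; elim: e => [|e IH]; first exact: ratmx_cst.
by move=> i j; apply: ratfun_ext (ratmxM GA IH i j) => t _; rewrite exprS.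
Qed.

Lemma ratmx_sum I (s : seq I) n1 n2 (F : I -> T -> 'M[C]_(n1, n2)) :
  (forall i, ratmx (F i)) -> ratmx (fun t => \sum_(i <- s) F i t).
Proof.
move=> GF i j; apply: (@ratfun_ext _ (fun t => \sum_(l <- s) F l t i j)).
  by move=> t _; rewrite summxE.
by apply: ratfun_sum => l; apply: GF.
Qed.

Lemma ratfun_det n (A : T -> 'M[C]_n) : ratmx A -> ratfun G (fun t => \det (A t)).
Proof.
move=> GA; apply: ratfun_sum => s; apply: ratfunM; first exact: ratfun_cst.
by apply: ratfun_prod => i; apply: GA.
Qed.

(** Cramer's rule. *)
Lemma ratmx_inv n (A : T -> 'M[C]_n) : (forall t, D t -> A t \in unitmx) ->
  ratmx A -> ratmx (fun t => invmx (A t)).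
Proof.
move=> uA GA i j; apply: (@ratfun_ext _
  (fun t => (\det (A t))^-1 * ((-1) ^+ (j + i) * \det (row' j (col' i (A t)))))).
  by move=> t Dt; rewrite /invmx uA // !mxE.
apply: ratfunM.
  apply: ratfunV; last exact: ratfun_det.
  by move=> t /uA; rewrite unitmxE unitfE.
apply: ratfunM; first exact: ratfun_cst.
by apply: ratfun_det => l l'; apply: ratfun_ext (GA _ _) => t _; rewrite !mxE.
Qed.

Lemma ratmx_horner k n (N : T -> 'M[C]_k.+1) (P : T -> {poly C}) : ratmx N ->
  (forall i, ratfun G (fun t => (P t)`_i)) ->
  (forall t, D t -> (size (P t) <= n)%N) ->
  ratmx (fun t => horner_mx (N t) (P t)).
Proof.
move=> GN GP Pn i j; apply: (@ratfun_ext _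
    (fun t => (\sum_(l < n) (P t)`_l *: N t ^+ l) i j)).
  by move=> t Dt; rewrite -(horner_mx_sum _ (Pn t Dt)).
by apply: ratmx_sum => l; apply: ratmxZ => //; apply: ratmxX.
Qed.

Lemma ratmx_compmx k (Q : T -> {poly C}) :
  (forall i, ratfun G (fun t => (Q t)`_i)) -> ratmx (fun t => compmx k (Q t)).
Proof.
move=> GQ i j; apply: (@ratfun_ext _
    (fun t => if i == k :> nat then - (Q t)`_j else (i.+1 == j)%:R)).
  by move=> t _; rewrite mxE.
by case: (i == k :> nat); [exact: ratfunN|exact: ratfun_cst].
Qed.

Lemma ratmx_powmx k n (N : T -> 'M[C]_k.+1) : ratmx N ->
  ratmx (fun t => powmx n (N t)).
Proof.
by move=> GN i j; apply: ratfun_ext (ratmxX i GN 0 j) => t _; rewrite [RHS]mxE.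
Qed.

End RationalFunctions.

Lemma ratfun_sub (R : realType) (T : Type) (D D' : set T) G (f : T -> R[i]) :
  D' `<=` D -> ratfun D G f -> ratfun D' G f.
Proof.
move=> DD'; elim=> {f} [g|c|f g _ If _ Ig|f g _ If _ Ig|f f0 _ If|f g fg _ If].
- exact: ratfun_gen.
- exact: ratfun_cst.
- exact: ratfunD.
- exact: ratfunM.
- by apply: ratfunV If => t /DD'; apply: f0.
- by apply: ratfun_ext If => t /DD'; apply: fg.
Qed.

Lemma ratfun_cont (R : realType) (T : topologicalType) (D : set T) G (f : T -> R[i]) :
  (forall g, G g -> cont_on D g) -> ratfun D G f -> cont_on D f.
Proof.
move=> cG; elim=> {f} [g|c|f g _ If _ Ig|f g _ If _ Ig|f f0 _ If|f g fg _ If].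
- exact: cG.
- exact: cont_on_cst.
- exact: cont_onD.
- exact: cont_onM.
- exact: cont_onV.
- exact: cont_on_ext If.
Qed.

Section RationalDividedDifferences.
Variable R : realType.
Local Notation C := R[i].

Definition odisc : set C := [set w | modulus w < 1].
Definition odisc2 : set (C * C) := [set x | odisc x.1 /\ odisc x.2].

Variable G : (C -> C) -> Prop.

Definition gen2 (F : C * C -> C) :=
  exists2 g, G g & F = (fun x => g x.1) \/ F = (fun x => g x.2).

Lemma ratfun_fst f : ratfun odisc G f -> ratfun odisc2 gen2 (fun x => f x.1).
Proof.
elim=> {f} [g Gg|c|f g _ If _ Ig|f g _ If _ Ig|f f0 _ If|f g fg _ If].
- by apply: ratfun_gen; exists g => //; left.
- exact: ratfun_cst.
- exact: ratfunD If Ig.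
- exact: ratfunM If Ig.
- by apply: ratfunV If => x [x1 _]; apply: f0.
- by apply: ratfun_ext If => x [x1 _]; apply: fg.
Qed.

Lemma ratfun_snd f : ratfun odisc G f -> ratfun odisc2 gen2 (fun x => f x.2).
Proof.
elim=> {f} [g Gg|c|f g _ If _ Ig|f g _ If _ Ig|f f0 _ If|f g fg _ If].
- by apply: ratfun_gen; exists g => //; right.
- exact: ratfun_cst.
- exact: ratfunD If Ig.
- exact: ratfunM If Ig.
- by apply: ratfunV If => x [_ x2]; apply: f0.
- by apply: ratfun_ext If => x [_ x2]; apply: fg.
Qed.

Lemma ratfun_slice F w' : odisc w' -> ratfun odisc2 gen2 F ->
  ratfun odisc G (fun w => F (w, w')).
Proof.
move=> w'1; elim=> {F} [_ [g Gg [->|->]]|c|f g _ If _ Ig|f g _ If _ Ig|f f0 _ If|f g fg _ If].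
- exact: ratfun_gen.
- exact: (ratfun_cst _ _ (g w')).
- exact: ratfun_cst.
- exact: ratfunD If Ig.
- exact: ratfunM If Ig.
- by apply: ratfunV If => w w1; apply: f0.
- by apply: ratfun_ext If => w w1; apply: fg.
Qed.

(** The divided differences of sums, products and inverses, given by the
    Leibniz rules, are again rational expressions in the generators of both
    variables. *)
Lemma ratfun_dda : G id -> (forall g, G g -> cont_on (odisc : set R[i]^o) g) ->
  (forall g, G g -> exists2 F, ratfun odisc2 gen2 F & forall w w', odisc w ->
     odisc w' -> g w - g w' = (w - w') * F (w, w')) ->
  dd_algebra (ratfun odisc G).
Proof.
move=> Gid cG ddG; split.
- exact: ratfun_cst.
- exact: ratfun_gen.
- exact: ratfunD.
- exact: ratfunM.
move=> f Gf; have [F GF fF] : exists2 F, ratfun odisc2 gen2 F & forall w w',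
    odisc w -> odisc w' -> f w - f w' = (w - w') * F (w, w').
  elim: Gf => {f} [g|c|f g Gf [F GF fF] Gg [H GH gH]|f g Gf [F GF fF] Gg [H GH gH]
      |f f0 Gf [F GF fF]|f g fg Gf [F GF fF]].
  - exact: ddG.
  - by exists (fun=> 0) => [|w w' _ _]; [exact: ratfun_cst|rewrite subrr mulr0].
  - exists (fun x => F x + H x); first exact: ratfunD.
    by move=> w w' w1 w'1; rewrite opprD addrACA fF // gH // mulrDr.
  - exists (fun x => F x * g x.1 + f x.2 * H x).
      apply: ratfunD; apply: ratfunM => //; [exact: ratfun_fst|exact: ratfun_snd].
    move=> w w' w1 w'1 /=.
    have -> : f w * g w - f w' * g w' = (f w - f w') * g w + f w' * (g w - g w') by ring.
    by rewrite fF // gH //; ring.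
  - exists (fun x => - F x * ((f x.1)^-1 * (f x.2)^-1)).
      apply: ratfunM; first exact: ratfunN.
      apply: ratfunM.
        by apply: ratfunV (ratfun_fst Gf) => x [x1 _]; apply: f0.
      by apply: ratfunV (ratfun_snd Gf) => x [_ x2]; apply: f0.
    move=> w w' w1 w'1 /=; have fw := f0 w w1; have fw' := f0 w' w'1.
    have -> : (f w)^-1 - (f w')^-1 = - (f w - f w') * ((f w)^-1 * (f w')^-1).
      by field; rewrite fw fw'.
    by rewrite fF //; ring.
  - by exists F => // w w' w1 w'1; rewrite -!fg // fF.
exists (fun w w' => F (w, w')); split=> // [w' w'1|w0 w01 e e0].
  exact: ratfun_slice.
have cF : cont_on (odisc2 : set (R[i]^o * R[i]^o)%type) (F : (R[i]^o * R[i]^o)%type -> C).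
  apply: (@ratfun_cont R (R[i]^o * R[i]^o)%type odisc2 gen2 F _ GF) => _ [g Gg [->|->]].
    apply: (@cont_on_comp R (R[i]^o * R[i]^o)%type R[i]^o odisc2 odisc fst g).
    - by move=> x; apply: cvg_fst.
    - by move=> x [].
    - exact: cG.
  apply: (@cont_on_comp R (R[i]^o * R[i]^o)%type R[i]^o odisc2 odisc snd g).
  - by move=> x; apply: cvg_snd.
  - by move=> x [].
  - exact: cG.
have [[U V] /= [/nbhs_modulus[d d0 dU] /nbhs_modulus[d' d'0 d'V]] UV] :=
  cF (w0, w0) (conj w01 w01) e e0.
exists (Num.min d d'); first by rewrite lt_min d0.
move=> w w' w1 w'1; rewrite !lt_min => /andP[wd _] /andP[_ w'd].
by apply: (UV (w, w')) => //; split; [exact: dU|exact: d'V].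
Qed.

End RationalDividedDifferences.

Section StableFactorDividedDifferences.
Variables (R : realType) (k p : nat) (a : int -> R[i]).
Local Notation C := R[i].
Local Notation r := k.+1.
Hypothesis adm : admissible r p a.
Local Notation Q := (sfactor r p a).
Local Notation U := (ufactor r p a).
Local Notation A := (symbol r p a).
Local Notation D := (@odisc R).
Local Notation D2 := (@odisc2 R).

Definition sgen (f : C -> C) := f = id \/ exists i, f = (fun w => (Q w)`_i).

Lemma ratfun_sfactor (E : set C) i : ratfun E sgen (fun w => (Q w)`_i).
Proof. by apply: ratfun_gen; right; exists i. Qed.

Lemma size_ufactor w : D w -> (size (U w) <= p.+1)%N.
Proof.
move=> w1; have [->|U0] := eqVneq (U w) 0; first by rewrite size_poly0.
have Qm : Q w \is monic.
  by rewrite monicE lead_coefE (size_sfactor adm) //= (sfactor_lead adm).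
have sz : (size ('X^r - w *: A)%R <= (r + p).+1)%N.
  rewrite (leq_trans (size_polyD _ _)) // size_polyN geq_max size_polyXn.
  rewrite ltnS leq_addr /=; apply: leq_trans (size_scale_leq _ _) _.
  exact: size_poly.
move: sz; rewrite -(sfactor_mul adm w1) size_monicM // (size_sfactor adm) //.
by rewrite addSn /= -addnS leq_add2l.
Qed.

(** The coefficients of the cofactor are obtained from the top by long
    division. *)
Lemma ratfun_ufactor i : ratfun D sgen (fun w => (U w)`_i).
Proof.
have [n] := ubnP (p.+1 - i)%N; elim: n i => // n IH i pin.
have [pi|ip] := ltnP p i.
  apply: ratfun_ext (ratfun_cst _ _ 0) => w w1.
  by rewrite nth_default // (leq_trans (size_ufactor w1)).
apply: (@ratfun_ext _ _ _ _ (fun w => ((r + i == r)%N%:R - w * A`_(r + i)) -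
    \sum_(j < r) (Q w)`_j * (U w)`_(r + i - j))).
  move=> w w1; have := congr1 (fun P : {poly C} => P`_(r + i)) (sfactor_mul adm w1).
  rewrite coefB coefXn coefZ => <-; rewrite coefM.
  rewrite -(big_mkord xpredT (fun j => (Q w)`_j * (U w)`_(r + i - j))).
  rewrite (big_cat_nat (n := r)) //=; last by rewrite ltnW // ltnS leq_addr.
  rewrite -[X in _ - X](big_mkord xpredT (fun j => (Q w)`_j * (U w)`_(r + i - j))).
  rewrite addrC addrK big_ltn; last by rewrite ltnS leq_addr.
  rewrite (sfactor_lead adm w1) mul1r addKn big_nat_cond big1 ?addr0 // => j.
  rewrite andbT => /andP[rj _]; rewrite nth_default ?mul0r //.
  by rewrite (size_sfactor adm w1).
apply: ratfunD.
  apply: ratfunD; first exact: ratfun_cst.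
  by apply/ratfunN/ratfunM; [apply: ratfun_gen; left|exact: ratfun_cst].
apply/ratfunN/ratfun_sum => j; apply: ratfunM; first exact: ratfun_sfactor.
by apply: IH; have := ltn_ord j; lia.
Qed.

Lemma ufactor_coprime w w' : D w -> D w' -> coprimep (U w) (Q w').
Proof.
move=> w1 w'1; have [s _ [-> s1]] := sfactor_monic adm w'1.
elim: s s1 => [|x s IH] s1; first by rewrite /rpoly big_nil coprimep1.
rewrite rpoly_cons coprimepMr coprimep_XsubC IH ?andbT => [|y ys].
  by rewrite /root (ufactor_neq0 adm) // ltW // s1 // mem_head.
by apply: s1; rewrite inE ys orbT.
Qed.

(** Modulo Q w', the identity Q w * U w = X^r - w * A gives (Q w - Q w') * U
    w = - (w - w') * A, and U w is invertible modulo Q w', because its roots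
    lie outside the closed disc. Computing modulo Q w' means evaluating at
    its companion matrix, and the first row recovers the coefficients of Q w
    - Q w', of degree less than r. *)
Lemma sfactor_dd i : exists2 F, ratfun D2 (gen2 sgen) F & forall w w', D w -> D w' ->
  (Q w)`_i - (Q w')`_i = (w - w') * F (w, w').
Proof.
have [ik|ki] := ltnP i r; last first.
  exists (fun=> 0); first exact: ratfun_cst.
  move=> w w' w1 w'1; rewrite mulr0; apply/eqP; rewrite subr_eq0; apply/eqP.
  move: ki; rewrite leq_eqVlt => /predU1P[<-|ki].
    by rewrite (sfactor_lead adm w1) (sfactor_lead adm w'1).
  rewrite nth_default ?(size_sfactor adm w1) //.
  by rewrite nth_default ?(size_sfactor adm w'1).
pose N (x : C * C) := compmx k (Q x.2).
exists (fun x => - (horner_mx (N x) A *m invmx (horner_mx (N x) (U x.1))) 0 (Ordinal ik)).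
  have GN : ratmx D2 (gen2 sgen) N.
    by apply: ratmx_compmx => j; apply: (ratfun_snd (ratfun_sfactor _ j)).
  apply: ratfunN; apply: ratmxM.
    by apply: (ratmx_horner (n := size A) GN) => // j; apply: ratfun_cst.
  apply: ratmx_inv.
    move=> [w w'] [/= w1 w'1]; apply: compmx_unit.
    - exact: (size_sfactor adm w'1).
    - exact: (sfactor_lead adm w'1).
    - exact: ufactor_coprime.
  apply: (ratmx_horner (n := p.+1) GN) => [j|[w w'] [/= w1 w'1]].
    exact: (ratfun_fst (ratfun_ufactor j)).
  exact: size_ufactor.
move=> w w' w1 w'1; rewrite /N /=; set M := compmx k (Q w').
have Q'0 : horner_mx M (Q w') = 0.
  by apply: horner_compmx_self; [exact: (size_sfactor adm w'1)|exact: (sfactor_lead adm w'1)].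
have uM : horner_mx M (U w) \in unitmx.
  apply: compmx_unit; [exact: (size_sfactor adm w'1)|exact: (sfactor_lead adm w'1)|].
  exact: ufactor_coprime.
have E : horner_mx M (Q w - Q w') = - (w - w') *: (horner_mx M A *m invmx (horner_mx M (U w))).
  apply: (can_inj (mulmxK uM)); rewrite -scalemxAl mulmxKV //.
  have -> : horner_mx M (Q w - Q w') *m horner_mx M (U w) =
      horner_mx M ('X^r - w *: A) - horner_mx M ('X^r - w' *: A).
    rewrite -!(sfactor_mul adm) // !rmorphM rmorphB /= Q'0.
    by rewrite mul0r !subr0.
  rewrite -rmorphB; have -> : 'X^r - w *: A - ('X^r - w' *: A) = - (w - w') *: A.
    by rewrite scaleNr scalerBl; ring.
  exact: horner_mxZ.
rewrite -coefB -(@horner_compmx0 _ k (Q w') (Q w - Q w') (Ordinal ik)).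
  by rewrite -/M E mxE mulrN mulNr.
apply/leq_sizeP => j; rewrite leq_eqVlt => /predU1P[<-|kj]; rewrite coefB.
  by rewrite (sfactor_lead adm w1) (sfactor_lead adm w'1) subrr.
by rewrite !nth_default ?subrr ?(size_sfactor adm w1) ?(size_sfactor adm w'1).
Qed.

Lemma sgen_cont g : sgen g -> cont_on (@cdisc R 1) g.
Proof.
by case=> [->|[i ->]]; [exact: cont_on_id|exact: (sfactor_cont adm)].
Qed.

(** All functions of the problem are built from w and the coefficients of
    the stable factor; this makes the tools for dd_algebra apply to them. *)
Lemma sgen_dda : dd_algebra (ratfun D sgen).
Proof.
apply: ratfun_dda; first by left.
  move=> g /sgen_cont; apply: cont_on_sub => w.
  by rewrite /odisc /cdisc /= => /ltW.
move=> g [->|[i ->]]; last exact: sfactor_dd.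
by exists (fun=> 1); [exact: ratfun_cst|move=> w w' _ _; rewrite mulr1].
Qed.

End StableFactorDividedDifferences.

(** * The number of zeros of the Kreiss-Lopatinskii determinant *)

Section ComplexDerivability.
Variable R : realType.
Local Notation C := R[i].

(** A difference quotient that is continuous at z0 has the derivative as its
    value there. *)
Lemma derivable_quotient (f F : C -> C) (z0 : C) :
  (\forall z \near (z0 : R[i]^o), f z - f z0 = (z - z0) * F z) ->
  (forall e : R, 0 < e -> \forall z \near (z0 : R[i]^o), modulus (F z - F z0) < e) ->
  derivable (f : R[i]^o -> R[i]^o) z0 1.
Proof.
move=> fF cF; apply/cvg_ex; exists (F z0); apply/cvgrPdist_lt => e e0.
have e0' : 0 < Re e by move: e0; rewrite ltcE => /andP[].
have eE : e = (Re e)%:C%C.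
  by move: e0; rewrite ltcE => /andP[/eqP/= + _]; case: (e) => ? ? /= ->.
have /nbhs_modulus[d d0 dP] := fF; have /nbhs_modulus[d' d'0 d'P] := cF _ e0'.
apply: (nbhs_modulus (0 : C) _).2; exists (Num.min d d'); first by rewrite lt_min d0.
move=> h; rewrite subr0 lt_min => /andP[hd hd'] h0.
have hE : (h%:A : C) + z0 - z0 = h by rewrite addrK /GRing.scale /= mulr1.
rewrite /= dP ?hE // normE eE ltcR.
have -> : (h^-1 *: (h * F (h%:A + z0)) : C) = F (h%:A + z0).
  by rewrite /GRing.scale /= mulKf.
by rewrite modulus_distC; apply: d'P; rewrite hE.
Qed.

Lemma dda_cont_on S (SA : dd_algebra S) (f : C -> C) : S f ->
  cont_on (@odisc R : set R[i]^o) f.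
Proof.
move=> Sf; apply/cont_onP => w0 w01 e e0.
have [d [M [d0 M0 dM]]] := dda_bounded_near SA Sf w01.
exists (Num.min d (e / M)); first by rewrite lt_min d0 divr_gt0.
move=> w w1; rewrite lt_min => /andP[wd we].
by apply: (le_lt_trans (dM w w1 wd)); rewrite mulrC -ltr_pdivlMr.
Qed.

Lemma cont_on_comp_inv (f : C -> C) : cont_on (@odisc R : set R[i]^o) f ->
  cont_on (exterior (R := R) : set R[i]^o) (fun z => f z^-1).
Proof.
have in_ext (z : C) : exterior z -> z != 0 /\ modulus z^-1 < 1.
  by rewrite /exterior /= norm_gt1; exact: inv_outside.
move=> cf; apply/cont_onP => z0 z01 e e0.
have [d d0 dP] := (cont_onP _ f).1 cf z0^-1 (in_ext z0 z01).2 e e0.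
have cV : cont_on (exterior (R := R) : set R[i]^o) (fun z : R[i]^o => (z : C)^-1).
  by apply: cont_onV (@cont_on_id R _) => z /in_ext[].
have [d' d'0 d'P] := (cont_onP _ _).1 cV z0 z01 d d0.
by exists d' => // z z1 /(d'P z z1); apply: dP; exact: (in_ext z z1).2.
Qed.

(** The divided differences of z^n, of 1 / z and of q combine into a
    continuous difference quotient. *)
Lemma dda_derivable_inv S (SA : dd_algebra S) (q : C -> C) (n : nat) (z0 : C) :
  S q -> 1 < modulus z0 ->
  derivable ((fun z => z ^+ n * q z^-1) : R[i]^o -> R[i]^o) z0 1.
Proof.
move=> Sq z01; have [F [qF SF _]] := dda_dd SA Sq.
have [z00 w01] := inv_outside z01.
have near_ext : \forall z \near (z0 : R[i]^o), 1 < modulus z.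
  apply/nbhs_modulus; exists (modulus z0 - 1); first by rewrite subr_gt0.
  by move=> z; have := modulus_ge_dist z0 z; rewrite modulus_distC; lra.
pose H z := (\sum_(i < n) z ^+ (n.-1 - i) * z0 ^+ i) * q z^-1 +
  - z0 ^+ n * ((z * z0)^-1 * F z^-1 z0^-1).
apply: (@derivable_quotient _ H).
  apply: filterS near_ext => z z1; have [z_0 w1] := inv_outside z1.
  have -> : z ^+ n * q z^-1 - z0 ^+ n * q z0^-1 =
    (z ^+ n - z0 ^+ n) * q z^-1 + z0 ^+ n * (q z^-1 - q z0^-1) by ring.
  rewrite qF // subrXX.
  have -> : z^-1 - z0^-1 = - (z - z0) * (z * z0)^-1 by field; rewrite z_0 z00.
  by rewrite /H; ring.
have cH : cont_on (exterior (R := R) : set R[i]^o) H.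
  have cid := @cont_on_id R (exterior (R := R)).
  apply: cont_onD; apply: cont_onM.
  - by apply: cont_on_sum => i; apply: cont_onM (cont_onX _ cid) (@cont_on_cst _ _ _ _).
  - exact: (cont_on_comp_inv (dda_cont_on SA Sq)).
  - exact: cont_on_cst.
  apply: cont_onM.
    apply: cont_onV; last by apply: cont_onM; [|exact: cont_on_cst].
    by move=> z; rewrite /exterior /= norm_gt1 => /inv_outside[? _]; rewrite mulf_neq0.
  exact: (@cont_on_comp_inv (fun w => F w z0^-1) (dda_cont_on SA (SF _ w01))).
move=> e e0; have z0_ext : exterior z0 by rewrite /exterior /= norm_gt1.
have := cH z0 z0_ext e e0; apply: filterS2 near_ext => z z1.
by apply; rewrite /exterior /= norm_gt1.
Qed.

End ComplexDerivability.

Section ArgumentPrinciple.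
Variable R : realType.
Local Notation C := R[i].
Variables (S : (C -> C) -> Prop) (f : C -> C).
Hypothesis SA : dd_algebra S.
Hypothesis Sf : S f.
Hypothesis cf : cont_on (@cdisc R 1) f.
Hypothesis f_circle : forall w, modulus w = 1 -> f w != 0.
Hypothesis f00 : f 0 != 0.

(** Compactness: f does not vanish on the circle, hence not near it either. *)
Lemma zeros_away : exists2 rho0 : R, 0 < rho0 < 1 &
  forall w, rho0 < modulus w <= 1 -> f w != 0.
Proof.
have [|d d0 dP] := @cdisc_uniform R 1 (fun d w => 1 - d < modulus w -> f w != 0).
  move=> w w1; have [F0|Fn0] := eqVneq (f w) 0.
    have {}w1 : modulus w < 1.
      rewrite lt_neqAle w1 andbT; apply/eqP => w1'.
      by have := f_circle w1'; rewrite F0 eqxx.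
    exists ((1 - modulus w) / 2) => [|d w']; first by rewrite divr_gt0 // subr_gt0.
    move=> /andP[_ d_lt] w'w _ d_gt; exfalso.
    by have := modulus_ge_dist w' w; lra.
  have m0 : 0 < modulus (f w) by rewrite modulus_gt0.
  have [d d0 dP] := (cont_onP _ _).1 cf w w1 _ m0.
  exists d => // d' w' _ w'w w'1 _; rewrite -modulus_gt0.
  have := dP w' w'1 w'w; have := modulus_ge_dist (f w) (f w').
  by rewrite modulus_distC; lra.
exists (Num.max (1 / 2) (1 - d)).
  by rewrite lt_max gt_max; apply/andP; split; [apply/orP; left|apply/andP; split]; lra.
move=> w; rewrite gt_max => /andP[/andP[_ dw] w1]; exact: dP.
Qed.

(** The zeros are divided out on the disc; the quotient extends without
    zeros to the closed disc, so its curve does not wind, and each zero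
    contributes -1 along the curve expi (- theta). *)
Lemma argument_principle : exists (s : seq C) (g : C -> C), [/\ S g,
  forall w, modulus w < 1 -> f w = \prod_(i <- s) (w - i) * g w,
  forall w, modulus w < 1 -> g w != 0,
  forall i, i \in s -> modulus i < 1
  & is_winding_number (fun theta : R => f (expi (- theta))) 0 (- (size s)%:Z)].
Proof.
have [rho0 /andP[rho0_gt0 rho01] away] := zeros_away.
have cF : cont_on (@cdisc R ((rho0 + 1) / 2)) f.
  by apply: cont_on_sub cf => w; rewrite /cdisc /=; lra.
have rho0_in : 0 < rho0 < 1 by rewrite rho0_gt0.
have [w|s [g [Sg FE g0 s_le]]] := dda_factor SA Sf f00 rho0_in cF.
  by move=> /andP[w0 w1]; apply: away; rewrite w0 ltW.
have s1 i : i \in s -> modulus i < 1 by move=> /s_le; lra.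
exists s, g; split=> //.
pose pr w := \prod_(i <- s) (w - i).
pose h w := f w / pr w.
(* The extension of g to the closed disc. *)
pose gb w := if modulus w < 1 then g w else h w.
have pr0 w : rho0 < modulus w -> pr w != 0.
  move=> w0; rewrite prodf_seq_neq0; apply/allP => i /s_le i_le /=.
  by rewrite subr_eq0; apply: contraTneq w0 => ->; rewrite -leNgt.
have gbE w : rho0 < modulus w <= 1 -> gb w = h w.
  move=> /andP[w0 w1]; rewrite /gb; case: ifP => // w1'.
  by rewrite /h FE // mulrAC divff ?mul1r // pr0.
have FgbE w : modulus w <= 1 -> f w = pr w * gb w.
  move=> w1; rewrite /gb; case: ifP => w1'; first exact: FE.
  rewrite /h mulrC divfK // pr0 //; move: w1'; rewrite ltNge => /negbFE; lra.
have gb0 w : modulus w <= 1 -> gb w != 0.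
  move=> w1; rewrite /gb; case: ifP => w1'; first exact: g0.
  have w1E : modulus w = 1 by apply/eqP; rewrite eq_le w1 leNgt w1'.
  by rewrite mulf_neq0 ?invr_eq0 ?pr0 ?w1E // f_circle.
have cgb : cont_on (@cdisc R 1) gb.
  apply/cont_onP => w0 w0_le e e0; move: (w0_le); rewrite /cdisc /= le_eqVlt.
  move=> /predU1P[w01|w01]; last first.
    have [d d0 dP] := (cont_onP _ _).1 (dda_cont_on SA Sg) w0 w01 e e0.
    exists (Num.min d (1 - modulus w0)); first by rewrite lt_min d0 subr_gt0.
    move=> w _; rewrite lt_min => /andP[wd ww0].
    have w1 : modulus w < 1 by have := modulus_ge_dist w w0; lra.
    by rewrite /gb w1 w01; apply: dP.
  pose E : set R[i]^o := [set w | rho0 < modulus w <= 1].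
  have ch : cont_on E h.
    apply: cont_onM; first by apply: cont_on_sub cf => w /andP[].
    apply: cont_onV => [w /andP[/pr0 //]|]; apply: cont_on_prod => i.
    exact: cont_onD (@cont_on_id R E) (@cont_on_cst _ _ E (- i)).
  have Ew0 : E w0 by rewrite /E /= w01 rho01 lexx.
  have [d d0 dP] := (cont_onP _ _).1 ch w0 Ew0 e e0.
  exists (Num.min d (1 - rho0)); first by rewrite lt_min d0 subr_gt0.
  move=> w w1; rewrite lt_min => /andP[wd wrho].
  have Ew : E w.
    rewrite /E /=; apply/andP; split=> //.
    by have := modulus_ge_dist w0 w; rewrite modulus_distC w01; lra.
  by rewrite !gbE //; apply: dP.
pose e t : C := expi (- t); have le : unit_loop e := unit_loop_expiN R.
have we : is_winding_number e 0 (-1) := wind_expiN R.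
have -> : (fun theta => f (expi (- theta))) = (fun t => pr (e t) * gb (e t)).
  by apply/funext => t; rewrite FgbE // modulus_expi.
have -> : - (size s)%:Z = (-1 : int) *+ count (fun i => modulus i < 1) s + 0.
  have -> : count (fun i => modulus i < 1) s = size s.
    by apply/eqP; rewrite -all_count; apply/allP.
  by rewrite addr0 mulNrn natz.
apply: windM; last exact: wind_disc.
by apply: wind_prod => // i /s1; rewrite lt_neqAle => /andP[].
Qed.

End ArgumentPrinciple.

Section ZeroCount.
Variables (R : realType) (k p m : nat) (a : int -> R[i]) (b : int -> nat -> R[i]).
Local Notation C := R[i].
Local Notation r := k.+1.
Hypothesis adm : admissible r p a.
Local Notation D := (@odisc R).
Local Notation lop w := (lop_mx k p m a b w).
Local Notation Delta := (KL_det r p m a b).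
Local Notation S := (ratfun D (sgen k p a)).

Let SA : dd_algebra S := sgen_dda adm.

Definition lop_det (w : C) : C := \det (lop w).

Lemma lop_ratmx (E : set C) : ratmx E (sgen k p a) (fun w => lop w).
Proof.
apply: ratmxD; first exact: ratmx_cst.
apply: ratmxN; apply: ratmxZ; first by apply: ratfun_gen; left.
apply: ratmxM; first exact: ratmx_cst.
by apply/ratmx_powmx/ratmx_compmx => i; apply: ratfun_sfactor.
Qed.

Lemma lop_det_dda : S lop_det.
Proof. exact: ratfun_det (@lop_ratmx D). Qed.

Lemma lop_det_cont : cont_on (@cdisc R 1) lop_det.
Proof.
apply: (@ratfun_cont R R[i]^o (cdisc 1) (sgen k p a)); first exact: sgen_cont.
exact: ratfun_det (@lop_ratmx _).
Qed.

Lemma lop_det0 : lop_det 0 = 1.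
Proof. by rewrite /lop_det /lop_mx scale0r subr0 det1. Qed.

Lemma KL_det_lop (z : C) : 1 <= modulus z -> Delta z = z ^+ r * lop_det z^-1.
Proof. exact: KL_detE. Qed.

Local Opaque lop_det KL_det.

Lemma KL_det_eq0 (z : C) : 1 <= modulus z -> (Delta z == 0) = (lop_det z^-1 == 0).
Proof.
move=> z1; have z0 : z != 0 by rewrite -modulus_gt0 (lt_le_trans ltr01).
by rewrite KL_det_lop // mulf_eq0 expf_eq0 (negbTE z0) andbF.
Qed.

Hypothesis circle_neq0 : forall z, modulus z = 1 -> Delta z != 0.

Lemma lop_det_circle (w : C) : modulus w = 1 -> lop_det w != 0.
Proof.
move=> w1; have z1 : modulus w^-1 = 1 by rewrite modulusV w1 invr1.
have := circle_neq0 z1; rewrite KL_det_eq0; last by rewrite z1.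
by rewrite invrK.
Qed.

(** On the circle Delta z is z^r * lop_det (1 / z): the power winds r times,
    and lop_det is described along the opposite orientation. *)
Lemma lop_det_factor : exists (s : seq C) (g : C -> C), [/\ S g,
  forall w, modulus w < 1 -> lop_det w = \prod_(i <- s) (w - i) * g w,
  forall w, modulus w < 1 -> g w != 0,
  forall i, i \in s -> modulus i < 1
  & is_winding_number (fun theta => Delta (expi theta)) 0 (r%:Z - (size s)%:Z)].
Proof.
have F00 : lop_det 0 != 0 by rewrite lop_det0 oner_eq0.
have [s [g [Sg FE g0 s1 wF]]] :=
  argument_principle SA lop_det_dda lop_det_cont lop_det_circle F00.
exists s, g; split=> //.
have -> : (fun theta => Delta (expi theta)) =
    (fun t => expi t ^+ r * lop_det (expi (- t))).
  apply/funext => t; have e1 : 1 <= modulus (expi t) by rewrite modulus_expi.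
  by rewrite (KL_det_lop e1) (expiV t).
by apply: windM => //; exact: wind_expiX.
Qed.

Lemma prod_split_count (s : seq C) (i0 w : C) : \prod_(i <- s) (w - i) =
  (w - i0) ^+ count_mem i0 s * \prod_(i <- s | i != i0) (w - i).
Proof.
rewrite (bigID (pred1 i0)) /=; congr (_ * _).
rewrite -big_filter (eq_big_seq (fun=> w - i0)) => [|i].
  by rewrite big_const_seq count_predT iter_mulr_1 size_filter.
by rewrite mem_filter /= => /andP[/eqP-> _].
Qed.

(** The zeros of Delta outside the disc are the inverses of those of lop_det
    in the disc, with the same multiplicities, and by lop_det_factor their
    number is r minus the winding number. *)
Lemma KL_det_zero_count :
  has_zero_count Delta (exterior (R := R))
    (r%:Z - winding_number (fun theta => Delta (expi theta)) 0).
Proof.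
have [s [g [Sg FE g0 s1 wE]]] := lop_det_factor.
rewrite (winding_numberE _ wE) => [|t _]; last by apply: circle_neq0; rewrite modulus_expi.
have s0 i : i \in s -> i != 0.
  move=> si; apply: contra_eq_neq lop_det0 => i0; rewrite FE ?modulus0 //.
  rewrite (big_rem i) //= i0 subrr !mul0r eq_sym oner_eq0 //.
have zeroP z : 1 < modulus z -> (Delta z == 0) = (z^-1 \in s).
  move=> z1; have [z0 w1] := inv_outside z1; rewrite KL_det_eq0 ?(ltW z1) // FE //.
  rewrite mulf_eq0 (negbTE (g0 _ w1)) orbF prodf_seq_eq0.
  apply/hasP/idP => [[i si /=]|si]; first by rewrite subr_eq0 => /eqP ->.
  by exists z^-1 => //=; rewrite subrr.
have memP z : (z \in [seq i^-1 | i <- s]) = (z^-1 \in s).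
  by rewrite -{1}[z]invrK mem_map //; exact: invr_inj.
exists [seq i^-1 | i <- s]; split; last first.
- by rewrite size_map opprB addrC subrK.
- move=> z0; rewrite memP => si0; set i0 := z0^-1 in si0.
  have z01 : 1 < modulus z0.
    by rewrite -[z0]invrK modulusV invf_gt1 ?s1 // modulus_gt0 s0.
  have [z00 _] := inv_outside z01.
  have -> : count_mem z0 [seq i^-1 | i <- s] = count_mem i0 s.
    by rewrite count_map; apply: eq_count => i /=; rewrite /i0 -(inj_eq invr_inj) invrK.
  set n := count_mem i0 s.
  pose h (w : C) := \prod_(i <- s | i != i0) (w - i) * g w.
  have Sh : S h.
    apply: ratfunM => //; apply: ratfun_prod => i.
    by apply: ratfunD; [apply: ratfun_gen; left|exact: ratfun_cst].
  pose q (w : C) := (- i0 * w) ^+ n * h w.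
  have Sq : S q.
    apply: (ddaM SA) Sh; apply: (dda_exp SA); apply: (ddaM SA (dda_cst SA _) (dda_id SA)).
  have hz0 : h i0 != 0.
    rewrite mulf_neq0 ?g0 ?s1 // prodf_seq_neq0; apply/allP => i _.
    by apply/implyP => ii0; rewrite subr_eq0 eq_sym.
  have near_ext : \forall z \near (z0 : R[i]^o), 1 < modulus z.
    apply/nbhs_modulus; exists (modulus z0 - 1); first by rewrite subr_gt0.
    by move=> z; have := modulus_ge_dist z0 z; rewrite modulus_distC; lra.
  exists (fun z => z ^+ r * q z^-1); split.
  + apply: filterS near_ext => z z1; have [z_0 w1] := inv_outside z1.
    exact: (dda_derivable_inv SA).
  + rewrite mulf_neq0 ?expf_neq0 // mulf_neq0 // expf_neq0 //.
    by rewrite mulf_neq0 ?oppr_eq0 // s0.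
  + apply: filterS near_ext => z z1; have [z_0 w1] := inv_outside z1.
    rewrite KL_det_lop ?(ltW z1) // FE // (prod_split_count s i0) -/n.
    have -> : z^-1 - i0 = (z - z0) * (- i0 * z^-1).
      by rewrite /i0; field; rewrite z_0 z00.
    by rewrite exprMn /q /h; ring.
- move=> z; rewrite memP /exterior /= norm_gt1; split=> [si|[z1 /eqP]].
    have z1 : 1 < modulus z.
      by rewrite -[z]invrK modulusV invf_gt1 ?s1 // modulus_gt0 s0.
    by split=> //; apply/eqP; rewrite zeroP.
  by rewrite zeroP.
Qed.

End ZeroCount.

(** * Sequences, stencils and solutions of the scheme *)

Section ShiftAction.
Variable R : realType.
Local Notation C := R[i].
Implicit Types (P Q : {poly C}) (v : nat -> C).

(** The action of polynomials on sequences for which X is the shift. *)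
Definition pact P v i : C := \sum_(s < size P) P`_s * v (i + s)%N.

Lemma pactE n P v i : (size P <= n)%N -> pact P v i = \sum_(s < n) P`_s * v (i + s)%N.
Proof.
move=> Pn; rewrite /pact (big_ord_widen_cond n predT (fun s => P`_s * v (i + s)%N)) //.
rewrite big_mkcond /=; apply: eq_bigr => s _; case: ltnP => // Ps.
by rewrite nth_default // mul0r.
Qed.

Lemma pactD P Q v i : pact (P + Q) v i = pact P v i + pact Q v i.
Proof.
have PQ := size_polyD P Q; rewrite (pactE _ _ PQ).
rewrite (@pactE _ P _ _ (leq_maxl _ (size Q))) (@pactE _ Q _ _ (leq_maxr (size P) _)).
by rewrite -big_split; apply: eq_bigr => s _; rewrite coefD mulrDl.
Qed.

Lemma pactZ c P v i : pact (c *: P) v i = c * pact P v i.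
Proof.
rewrite (pactE _ _ (size_scale_leq c P)) /pact mulr_sumr.
by apply: eq_bigr => s _; rewrite coefZ mulrA.
Qed.

Lemma pactB P Q v i : pact (P - Q) v i = pact P v i - pact Q v i.
Proof. by rewrite pactD -scaleN1r pactZ mulN1r. Qed.

Lemma pact_sum I (s : seq I) (F : I -> {poly C}) v i :
  pact (\sum_(l <- s) F l) v i = \sum_(l <- s) pact (F l) v i.
Proof.
elim: s => [|l s IH]; first by rewrite !big_nil /pact size_poly0 big_ord0.
by rewrite !big_cons pactD IH.
Qed.

Lemma pactXnM n P v i : pact ('X^n * P) v i = pact P v (i + n)%N.
Proof.
have sz : (size ('X^n * P)%R <= n + size P)%N.
  by rewrite (leq_trans (size_polyMleq _ _)) // size_polyXn.
rewrite (pactE _ _ sz) big_split_ord /= big1 => [|s _].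
  by rewrite add0r; apply: eq_bigr => s _; rewrite coefXnM ltnNge leq_addr addKn addnA.
by rewrite coefXnM ltn_ord mul0r.
Qed.

Lemma pactXn n v i : pact 'X^n v i = v (i + n)%N.
Proof.
rewrite -['X^n]mulr1 pactXnM /pact size_poly1 big_ord1.
by rewrite coefC eqxx mul1r addn0.
Qed.

Lemma pactM P Q v i : pact (P * Q) v i = pact P (pact Q v) i.
Proof.
have -> : P * Q = \sum_(s < size P) P`_s *: ('X^s * Q).
  rewrite -{1}[P]coefK poly_def mulr_suml; apply: eq_bigr => s _.
  by rewrite scalerAl.
by rewrite pact_sum; apply: eq_bigr => s _; rewrite pactZ pactXnM.
Qed.

Lemma pact_le P v (E : R) i : (forall j, modulus (v j) <= E) ->
  modulus (pact P v i) <= pnorm P * E.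
Proof.
move=> vE; apply: (le_trans (modulus_sum _ _ _)); rewrite /pnorm mulr_suml.
by apply: ler_sum => s _; rewrite modulusM ler_wpM2l ?modulus_ge0.
Qed.

Definition fin_supp v := exists J, forall j, (J <= j)%N -> v j = 0.

Lemma fin_supp_pact P v : fin_supp v -> fin_supp (pact P v).
Proof.
move=> [J vJ]; exists J => j Jj; rewrite /pact big1 // => s _.
by rewrite vJ ?mulr0 // (leq_trans Jj) // leq_addr.
Qed.

(** For one root x the equation v (i + 1) - x * v i = e i is solved from the
    right, starting where v vanishes, and 1 / x is a contraction; the roots
    are treated one after the other. *)
Lemma pact_invert (s : seq C) (c : C) : c != 0 ->
  (forall x, x \in s -> 1 < modulus x) -> exists2 K : R, 0 < K &
  forall v (E : R), fin_supp v -> 0 <= E ->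
    (forall i, modulus (pact (c *: rpoly s) v i) <= E) ->
    forall i, modulus (v i) <= K * E.
Proof.
move=> c0 s1; have c_gt0 : 0 < modulus c by rewrite modulus_gt0.
suff [K K0 KP] : exists2 K : R, 0 < K & forall v (E : R), fin_supp v -> 0 <= E ->
    (forall i, modulus (pact (rpoly s) v i) <= E) -> forall i, modulus (v i) <= K * E.
  exists (K / modulus c); first by rewrite divr_gt0.
  move=> v E vf E0 vE i; rewrite -mulrA; apply: KP => // [|j].
    by rewrite mulr_ge0 // invr_ge0 ltW.
  by rewrite ler_pdivlMl // -modulusM -pactZ; apply: vE.
elim: s s1 => [|x s IH] s1.
  exists 1 => // v E _ _ vE i; have := vE i.
  by rewrite /rpoly big_nil -(expr0 'X) pactXn addn0 mul1r.
have [y|K K0 KP] := IH; first by move=> ys; apply: s1; rewrite inE ys orbT.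
have x1 : 1 < modulus x by apply: s1; rewrite mem_head.
exists (K / (modulus x - 1)); first by rewrite divr_gt0 // subr_gt0.
move=> v E vf E0 vE; pose u := pact (rpoly s) v.
have uE i : modulus (u i) <= E / (modulus x - 1).
  have [J uJ] : fin_supp u by apply: fin_supp_pact.
  have E10 : 0 <= E / (modulus x - 1) by rewrite divr_ge0 // subr_ge0 ltW.
  have [n] := ubnP (J - i)%N; elim: n i => // n IHn i iJ.
  have [Ji|iJ'] := leqP J i; first by rewrite uJ // modulus0.
  have u1 : modulus (u i.+1) <= E / (modulus x - 1) by apply: IHn; lia.
  have := vE i; rewrite rpoly_cons pactM -/u pactB.
  have -> : pact 'X u i = u i.+1 by rewrite -['X]expr1 pactXn addn1.
  have -> : pact x%:P u i = x * u i.
    by rewrite -[x%:P]mulr1 mul_polyC pactZ -(expr0 'X) pactXn addn0.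
  move=> h; have xu : modulus x * modulus (u i) <= E + E / (modulus x - 1).
    rewrite -modulusM; have := modulus_dist3 (x * u i) (u i.+1) 0.
    by rewrite !subr0 modulus_distC; lra.
  have EE : E + E / (modulus x - 1) = modulus x * (E / (modulus x - 1)).
    by field; rewrite subr_eq0 gt_eqF.
  by move: xu; rewrite EE ler_pM2l // (lt_trans ltr01).
move=> i; rewrite mulrAC -mulrA; apply: KP => //.
by rewrite divr_ge0 // subr_ge0 ltW.
Qed.

End ShiftAction.

Section Boundary.
Variables (R : realType) (k p m : nat) (a : int -> R[i]) (b : int -> nat -> R[i]).
Local Notation C := R[i].
Local Notation r := k.+1.
Local Notation A := (symbol r p a).
Local Notation B := (boundary_mx r m a b).

Lemma interior_stencil (V : int -> C) (i : nat) :
  \sum_(s < (r + p).+1) a (offset r s) * V ((i + r)%N%:Z + offset r s) =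
  pact A (fun j => V j%:Z) i.
Proof.
rewrite (pactE _ _ (size_poly _ _)); apply: eq_bigr => s _.
rewrite coef_poly ltn_ord; congr (_ * V _); rewrite /offset; lia.
Qed.

Lemma offset_neg (l : nat) : (l < r)%N -> offset r l = Negz (k - l).
Proof. by move=> lr; rewrite /offset; lia. Qed.

(** The grid values at one time, given the interior ones v and the data h. *)
Definition extend (v : nat -> C) (h : int -> C) (j : int) : C :=
  if j is Posz q then v q else \sum_(q < m) b j q * v q + h j.

Fixpoint interior_state (f : nat -> C) (g : int -> nat -> C) (n : nat) : nat -> C :=
  if n is n'.+1 then fun j => \sum_(s < (r + p).+1) a (offset r s) *
    extend (interior_state f g n') (g ^~ n') (j%:Z + offset r s)
  else f.

Lemma solution_ex f g : exists U, is_solution r p m a b f g U.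
Proof.
exists (fun j n => extend (interior_state f g n) (g ^~ n) j); split=> //.
by move=> l n lr; rewrite offset_neg.
Qed.

(** All that matters of the data at time n are its values at the ghost
    points. *)
Lemma solution_uniq f g U V : is_solution r p m a b f g U ->
  is_solution r p m a b f g V ->
  forall n, (forall j : nat, U j%:Z n = V j%:Z n) /\
    (forall l : nat, (l < r)%N -> U (offset r l) n = V (offset r l) n).
Proof.
move=> [Ustep Ughost U0] [Vstep Vghost V0].
have ghosts n : (forall j : nat, U j%:Z n = V j%:Z n) ->
    forall l : nat, (l < r)%N -> U (offset r l) n = V (offset r l) n.
  move=> UV l lr; rewrite Ughost // Vghost //; congr (_ + _).
  by apply: eq_bigr => q _; rewrite UV.
elim=> [|n [IH IHg]].
  have UV0 (j : nat) : U j%:Z 0%N = V j%:Z 0%N by rewrite U0 V0.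
  by split=> //; apply: ghosts.
have UV (j : nat) : U j%:Z n.+1 = V j%:Z n.+1.
  rewrite Ustep Vstep; apply: eq_bigr => s _; congr (_ * _).
  have [rs|sr] := leqP r (j + s)%N.
    have -> : j%:Z + offset r s = (j + s - r)%N%:Z by rewrite /offset; lia.
    exact: IH.
  have -> : j%:Z + offset r s = offset r (j + s)%N by rewrite /offset; lia.
  exact: IHg.
by split=> //; apply: ghosts.
Qed.

(** The stencil carries information over at most r points to the right in
    each time step. *)
Lemma finite_speed g U : is_solution r p m a b (fun=> 0) g U ->
  forall n j : nat, (r * n <= j)%N -> U j%:Z n = 0.
Proof.
move=> [Ustep _ U0]; elim=> [|n IH] j rj; first exact: U0.
rewrite Ustep big1 // => s _.
have -> : j%:Z + offset r s = (j + s - r)%N%:Z by rewrite /offset; lia.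
by rewrite IH ?mulr0 //; lia.
Qed.

(** The effect of the ghost values on the first r interior equations. It is
    triangular with diagonal a (- r). *)
Definition ghost_mx : 'M[C]_r := \matrix_(i < r, l < r) a (offset r l - i%:Z).

Hypothesis a_support : forall q : int, (q < - r%:Z) || (p%:Z < q) -> a q = 0.

Lemma ghost_unit : a (- r%:Z) != 0 -> ghost_mx \in unitmx.
Proof.
move=> a_left; rewrite -unitmx_tr unitmxE unitfE det_trig.
  apply/prodf_neq0 => i _; rewrite !mxE /offset.
  by have -> : (i%:Z - r%:Z - i%:Z)%R = - r%:Z by ring.
apply/is_trig_mxP => i j ij; rewrite !mxE a_support //; apply/orP; left.
rewrite /offset; lia.
Qed.

Hypothesis m_ge : (p + r <= m)%N.

(** The stencil of each of the first r equations is extended to a sum over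
    the whole range of grid points -r, ..., m - 1, where the additional
    coefficients vanish; m >= p + r ensures that the range contains the
    stencil. *)
Lemma stencil_split (V : int -> C) (i : 'I_r) :
  \sum_(s < (r + p).+1) a (offset r s) * V (i%:Z + offset r s) =
  \sum_(j < m) a (j%:Z - i%:Z) * V j%:Z +
  \sum_(l < r) a (offset r l - i%:Z) * V (offset r l).
Proof.
pose f (t : nat) := a (t%:Z - r%:Z - i%:Z) * V (t%:Z - r%:Z).
have i_lt := ltn_ord i.
transitivity (\sum_(0 <= t < r + m) f t).
  rewrite (big_cat_nat (n := i)) //=; last by lia.
  rewrite [X in _ = X + _]big_nat_cond [X in _ = X + _]big1 ?add0r; last first.
    move=> t; rewrite andbT => /andP[_ ti].
    by rewrite /f a_support ?mul0r //; apply/orP; left; lia.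
  rewrite (big_cat_nat (n := (i + (r + p).+1)%N)) //=; [|by lia|by lia].
  rewrite [X in _ = _ + X]big_nat_cond [X in _ = _ + X]big1 ?addr0; last first.
    move=> t; rewrite andbT => /andP[it _].
    by rewrite /f a_support ?mul0r //; apply/orP; right; lia.
  rewrite -[X in index_iota X _]add0n big_addn addKn big_mkord.
  apply: eq_bigr => s _; rewrite /f /offset; congr (a _ * V _); lia.
rewrite (big_cat_nat (n := r)) //=; last by rewrite leq_addr.
rewrite addrC; congr (_ + _); last by rewrite big_mkord.
rewrite -[X in index_iota X _]add0n big_addn addKn big_mkord; apply: eq_bigr => j _.
by rewrite /f; congr (a _ * V _); lia.
Qed.

(** Eliminating the ghost values produces the boundary matrix. *)
Lemma boundary_stencil (V : int -> C) (h : int -> C) (i : 'I_r) :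
  (forall l : nat, (l < r)%N ->
    V (offset r l) = \sum_(j < m) b (offset r l) j * V j%:Z + h (offset r l)) ->
  \sum_(s < (r + p).+1) a (offset r s) * V (i%:Z + offset r s) =
  \sum_(j < m) B i j * V j%:Z + \sum_(l < r) ghost_mx i l * h (offset r l).
Proof.
move=> Vghost; rewrite stencil_split.
under [X in _ + X = _]eq_bigr => l _ do rewrite Vghost // mulrDr mulr_sumr.
rewrite big_split /= exchange_big /= addrA -big_split /=; congr (_ + _).
  apply: eq_bigr => j _; rewrite mxE mulrDl mulr_suml; congr (_ + _).
  by apply: eq_bigr => l _; rewrite mulrA.
by apply: eq_bigr => l _; rewrite mxE.
Qed.

End Boundary.

(** * A zero outside the closed disc excludes strong stability *)

Section Series.
Variable R : realType.

Lemma series_fin (u : nat -> R) N : (forall n, (N <= n)%N -> u n = 0) ->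
  (\sum_(0 <= n <oo) (u n)%:E = (\sum_(n < N) u n)%:E)%E.
Proof.
move=> u0; apply: lim_near_cst => //; near=> n.
have Nn : (N <= n)%N by near: n; exact: nbhs_infty_ge.
rewrite sumEFin (big_cat_nat (n := N)) //= big_mkord; congr (_%:E).
rewrite [X in _ + X]big_nat_cond [X in _ + X]big1 ?addr0 // => i.
by rewrite andbT => /andP[Ni _]; rewrite u0.
Unshelve. all: by end_near. Qed.

Lemma term_le_series (u : nat -> \bar R) j : (forall n, 0 <= u n)%E ->
  (u j <= \sum_(0 <= n <oo) u n)%E.
Proof.
move=> u0; apply: le_trans (nneseries_lim_ge j.+1 _) => //.
by rewrite big_nat_recr //= leeDr // sume_ge0.
Qed.

Lemma series_le (u : nat -> R) (M : \bar R) : (forall n, 0 <= u n) ->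
  (forall N, (\sum_(n < N) u n)%:E <= M)%E -> (\sum_(0 <= n <oo) (u n)%:E <= M)%E.
Proof.
move=> u0 uM; apply: lime_le.
  by apply: is_cvg_nneseries => n _ _; rewrite lee_fin.
by apply: nearW => N; rewrite sumEFin big_mkord.
Qed.

End Series.

Section Instability.
Variables (R : realType) (k p m : nat) (a : int -> R[i]) (b : int -> nat -> R[i]).
Variables (velocity lambda : R).
Local Notation C := R[i].
Local Notation r := k.+1.
Hypothesis adm : admissible r p a.
Hypothesis m_ge : (p + r <= m)%N.
Hypothesis a_support : forall q : int, (q < - r%:Z) || (p%:Z < q) -> a q = 0.
Hypothesis velocity_gt0 : 0 < velocity.
Hypothesis lambda_gt0 : 0 < lambda.
Local Notation A := (symbol r p a).
Local Notation B := (boundary_mx r m a b).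
Local Notation G := (ghost_mx k a).

(** For small space steps the weights of the stability estimate are x^(2n)
    with x < 1 as close to 1 as wanted; data supported at the initial time
    have a finite norm, so each term of the interior sum is bounded. *)
Lemma stable_pointwise x g U : strongly_stable r p m a b velocity lambda ->
  0 < x < 1 -> (forall j n, (0 < n)%N -> g j n = 0) ->
  is_solution r p m a b (fun=> 0) g U ->
  exists2 K : R, 0 <= K & forall j n : nat, modulus (U j%:Z n) * x ^+ n <= K.
Proof.
move=> [Cst [alpha0 [Cst0 stab]]] /andP[x0 x1] g0 solU.
pose alpha := Num.max alpha0 0 + 1.
have alpha_gt : alpha0 < alpha by rewrite /alpha ltr_pwDr // le_max lexx.
have alpha_gt0 : 0 < alpha by rewrite /alpha ltr_wpDl // le_max lexx orbT.
pose dt := - ln x / alpha.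
have lnx : ln x < 0 by rewrite ln_lt0 // x0.
have dt0 : 0 < dt by rewrite divr_gt0 // oppr_gt0.
pose dx := dt * velocity / lambda.
have dx0 : 0 < dx by rewrite divr_gt0 // mulr_gt0.
have := stab alpha alpha_gt g dx dx0 U solU; cbv zeta.
have -> : lambda * dx / velocity = dt by rewrite /dx; field; rewrite !gt_eqF.
pose w (n : nat) := x ^+ (2 * n).
have wE n : expR (- (2 * alpha * n%:R * dt)) = w n.
  rewrite /w -[x in RHS]lnK ?posrE // -expRM_natl; congr expR.
  by rewrite natrM /dt; field; rewrite gt_eqF.
under eq_bigr => l _ do under eq_eseriesr => n _ do rewrite wE.
under [X in (_ * X)%E]eq_eseriesr => n _ do under eq_eseriesr => j _ do rewrite wE.
under [X in (_ <= _ * X)%E]eq_bigr => l _ do under eq_eseriesr => n _ do rewrite wE.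
have w0 n : 0 <= w n by rewrite exprn_ge0 // ltW.
set co := (alpha - alpha0) / (alpha * dt + 1).
have co0 : 0 < co by rewrite divr_gt0 ?subr_gt0 // addr_gt0 // mulr_gt0.
pose rhs := \sum_(l < r) \sum_(n < 1) dt * w n * modulus (g (offset r l) n) ^+ 2.
have -> : (\sum_(l < r) \sum_(0 <= n <oo)
    (dt * w n * modulus (g (offset r l) n) ^+ 2)%:E)%E = rhs%:E.
  rewrite -sumEFin; apply: eq_bigr => l _; apply: series_fin => n n1.
  by rewrite g0 // modulus0 expr0n mulr0.
rewrite -EFinM; set lhs1 := (X in (X + _)%E); set lhs2 := (X in (_ * X)%E) => le_rhs.
have dtw n : 0 <= dt * w n by rewrite mulr_ge0 // ltW.
have dtxw n : 0 <= dt * dx * w n by rewrite mulr_ge0 // mulr_ge0 // ltW.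
have lhs1_ge0 : (0 <= lhs1)%E.
  apply: sume_ge0 => l _; apply: nneseries_ge0 => n _ _.
  by rewrite lee_fin mulr_ge0 // sqr_ge0.
have {}le_rhs : (co%:E * lhs2 <= (Cst * rhs)%:E)%E.
  by apply: le_trans le_rhs; rewrite leeDr.
pose K2 := Cst * rhs / (co * (dt * dx)).
have cdx0 : 0 < co * (dt * dx) by apply: mulr_gt0 => //; apply: mulr_gt0.
have sq_le (j n : nat) : (modulus (U j%:Z n) * x ^+ n) ^+ 2 <= K2.
  rewrite /K2 ler_pdivlMr // -lee_fin; apply: le_trans le_rhs.
  have -> : (modulus (U j%:Z n) * x ^+ n) ^+ 2 * (co * (dt * dx)) =
      co * (dt * dx * w n * modulus (U j%:Z n) ^+ 2).
    by rewrite /w mulnC exprM; ring.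
  rewrite EFinM lee_pmul2l ?lte_fin //.
  have inner_ge0 i : (0 <= \sum_(0 <= j' <oo)
      (dt * dx * w i * modulus (U j'%:Z i) ^+ 2)%:E)%E.
    by apply: nneseries_ge0 => l _ _; rewrite lee_fin mulr_ge0 // sqr_ge0.
  apply: (@le_trans _ _ (\sum_(0 <= j' <oo)
      (dt * dx * w n * modulus (U j'%:Z n) ^+ 2)%:E)%E); last first.
    exact: (term_le_series n inner_ge0).
  apply: (@term_le_series _ (fun j' => (dt * dx * w n * modulus (U j'%:Z n) ^+ 2)%:E)).
  by move=> l; rewrite lee_fin mulr_ge0 // sqr_ge0.
exists (Num.sqrt K2) => [|j n]; first exact: sqrtr_ge0.
have Ux0 : 0 <= modulus (U j%:Z n) * x ^+ n.
  by rewrite mulr_ge0 ?modulus_ge0 // exprn_ge0 // ltW.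
by rewrite -[leLHS](ger0_norm Ux0) -sqrtr_sqr ler_wsqrtr.
Qed.

(** At a zero w of the determinant there is a left null vector ell of lop_mx
    w, and l0 is chosen so that ell G e0 is not 0, where e0 is the datum 1
    at the ghost point l0 and at time 0. The partial sums W N of w^n U^n
    solve the Laplace-transformed scheme up to the residual w^N U^N. If the
    scheme were strongly stable, U^N would be at most of the size of x^-N
    for some x > modulus w, by stable_pointwise, and the residual would tend
    to 0.

    The interior equations say that T (Q W) is the residual, with Q and T
    the stable and the unstable factor, so Q W tends to 0 by pact_invert.
    Hence W is, up to a small error, generated by its first r values through
    the powers of the companion matrix of Q. The first r equations then read
    lop_mx w * W = w * G e0 + a small error, and the product with ell gives
    ell G e0 = 0 in the limit. *)
Lemma not_stable (w : C) : modulus w < 1 -> lop_det k p m a b w = 0 ->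
  ~ strongly_stable r p m a b velocity lambda.
Proof.
move=> w1 F0 stab; have w0 : w != 0.
  by apply: contra_eq_neq F0 => ->; rewrite lop_det0 oner_eq0.
have /det0P[ell ell0 ellM] : \det (lop_mx k p m a b w) == 0 by apply/eqP.
have a_left : a (- r%:Z) != 0 by case: adm.
have [l0 ellG] : exists l0, (ell *m G) 0 l0 != 0.
  apply: contrapT => ellG; move/negP: ell0; apply; apply/eqP.
  have uG : G \in unitmx := ghost_unit a_support a_left.
  suff ellG0 : ell *m G = 0 by rewrite -(mulmxK uG ell) ellG0 mul0mx.
  apply/rowP => l; rewrite [RHS]mxE; apply/eqP/negPn/negP => h.
  by apply: ellG; exists l.
pose g (j : int) (n : nat) : C := ((j == offset r l0) && (n == 0%N))%:R.
have [U solU] := @solution_ex R k p m a b (fun=> 0) g.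
have [Ustep Ughost U0] := solU.
have mw0 : 0 < modulus w by rewrite modulus_gt0.
(* Any x strictly between modulus w and 1 serves. *)
pose x := (modulus w + 1) / 2.
have x_in : 0 < x < 1 by rewrite /x; apply/andP; split; lra.
have g0 j n : (0 < n)%N -> g j n = 0 by rewrite /g; case: n => // n _; rewrite andbF.
have [K K0 UK] := stable_pointwise stab x_in g0 solU.
pose q := modulus w / x.
have /andP[x0 x1] := x_in.
have q0 : 0 < q by rewrite divr_gt0.
have q1 : q < 1 by rewrite ltr_pdivrMr // mul1r /x; lra.
have res_le N (j : nat) : modulus (w ^+ N * U j%:Z N) <= K * q ^+ N.
  rewrite modulusM modulusX /q expr_div_n mulrA ler_pdivlMr ?exprn_gt0 //.
  rewrite -mulrA (mulrC K); apply: ler_wpM2l; last exact: UK.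
  by rewrite exprn_ge0 // ltW.
pose W (N : nat) (j : nat) : C := \sum_(n < N) w ^+ n * U j%:Z n.
have WS N (j : nat) : W N.+1 j = w * \sum_(n < N) w ^+ n * U j%:Z n.+1.
  rewrite /W big_ord_recl U0 mulr0 add0r mulr_sumr; apply: eq_bigr => n _.
  by rewrite exprS mulrA.
have Wr N (j : nat) : W N.+1 j = W N j + w ^+ N * U j%:Z N by rewrite /W big_ord_recr.
have W_supp N : fin_supp (W N).
  exists (r * N)%N => j rj; rewrite /W big1 // => n _.
  rewrite (finite_speed solU) ?mulr0 // (leq_trans _ rj) // leq_mul2l ltnW ?orbT //.
pose Q := sfactor r p a w; pose T := ufactor r p a w.
have QT : Q * T = 'X^r - w *: A by apply: sfactor_mul.
(* The interior equations, weighted by w^n and summed, telescope. *)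
have residual N i : pact T (pact Q (W N)) i = - (w ^+ N * U (i + r)%N%:Z N).
  rewrite -pactM mulrC QT pactB pactZ pactXn.
  have -> : w * pact A (W N) i = W N.+1 (i + r)%N.
    rewrite WS; congr (_ * _).
    under [RHS]eq_bigr => n _ do rewrite Ustep (@interior_stencil R k p a (U ^~ n) i) /pact mulr_sumr.
    rewrite exchange_big /=; apply: eq_bigr => s _; rewrite /W mulr_sumr.
    by apply: eq_bigr => n _; rewrite mulrCA.
  by rewrite Wr opprD addNKr.
have [KT KT0 KTP] : exists2 KT : R, 0 < KT & forall v (E : R), fin_supp v -> 0 <= E ->
    (forall i, modulus (pact T v i) <= E) -> forall i, modulus (v i) <= KT * E.
  have [c [s [TE c0 s1]]] := ufactor_roots adm w0 w1.
  by rewrite /T TE; apply: pact_invert.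
have V_le N i : modulus (pact Q (W N) i) <= KT * (K * q ^+ N).
  apply: KTP; first exact/fin_supp_pact.
    by rewrite mulr_ge0 // exprn_ge0 // ltW.
  by move=> j; rewrite residual modulusN; apply: res_le.
pose N0 := compmx k Q; pose M := powmx m N0.
have Qm : Q \is monic by rewrite monicE lead_coefE (size_sfactor adm w1) (sfactor_lead adm w1).
pose D (j : nat) := 'X^j %/ Q.
(* The remainder of X^j modulo Q is row j of M. *)
have W_split N (j : 'I_m) : W N j = pact (D j) (pact Q (W N)) 0 +
    \sum_(c < r) M j c * W N c.
  have -> : W N j = pact 'X^j (W N) 0 by rewrite pactXn.
  rewrite {1}(divp_eq 'X^j Q) pactD pactM; congr (_ + _).
  have szQ : size Q = k.+2 := size_sfactor adm w1.
  have lt_r : (size ('X^j %% Q)%R <= r)%N.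
    by rewrite -ltnS -szQ ltn_modp monic_neq0.
  rewrite (pactE _ _ lt_r); apply: eq_bigr => c _; congr (_ * _).
  rewrite mxE -(@horner_compmx0 _ k Q _ c lt_r) -/N0.
  have -> : N0 ^+ j = horner_mx N0 'X^j by rewrite rmorphXn /= horner_mx_X.
  rewrite {2}(divp_eq 'X^j Q) rmorphD rmorphM /= horner_compmx_self //.
    by rewrite mulr0 add0r.
  exact: (sfactor_lead adm w1).
pose u N : 'cV[C]_r := \col_c W N c.
pose er N : 'cV[C]_m := \col_j pact (D j) (pact Q (W N)) 0.
pose U1 N : 'cV[C]_r := \col_i U (nat_of_ord i)%:Z N.
pose e0 : 'cV[C]_r := \col_l (l == l0)%:R.
(* The first r equations, weighted by w^n and summed; only the term n = 0
   contains the datum. *)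
have boundary N : u N.+1 + w ^+ N.+1 *: U1 N.+1 =
    w *: (B *m (M *m u N.+1 + er N.+1)) + w *: (G *m e0).
  apply/colP => i; rewrite !mxE -Wr WS -mulrDr; congr (_ * _).
  have stepE n : U (nat_of_ord i)%:Z n.+1 =
      \sum_(j < m) B i j * U j%:Z n + \sum_(l < r) G i l * g (offset r l) n.
    rewrite Ustep; apply: (@boundary_stencil R k p m a b a_support m_ge
      (U ^~ n) (g ^~ n) i) => l lr; exact: Ughost.
  under eq_bigr => n _ do rewrite stepE mulrDr.
  rewrite big_split /=; congr (_ + _).
    under eq_bigr => n _ do rewrite mulr_sumr.
    rewrite exchange_big /=; apply: eq_bigr => j _.
    transitivity (B i j * W N.+1 j).
      by rewrite /W mulr_sumr; apply: eq_bigr => n _; rewrite mulrCA.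
    congr (_ * _); rewrite W_split addrC [RHS]mxE; congr (_ + _); rewrite mxE //.
    by apply: eq_bigr => c _; rewrite [u _ _ _]mxE.
  rewrite big_ord_recl expr0 mul1r [X in _ + X = _]big1 ?addr0 => [|n _]; last first.
    by rewrite big1 ?mulr0 // => l _; rewrite g0 ?mulr0.
  apply: eq_bigr => l _; rewrite [e0 _ _]mxE /g eqxx andbT.
  by rewrite /offset (inj_eq (addIr _)) eqz_nat.
have key N : w *: (ell *m (G *m e0)) =
    w ^+ N.+1 *: (ell *m U1 N.+1) - w *: (ell *m (B *m er N.+1)).
  have lopE : lop_mx k p m a b w *m u N.+1 =
      w *: (G *m e0) + w *: (B *m er N.+1) - w ^+ N.+1 *: U1 N.+1.
    rewrite /lop_mx -/Q -/N0 -/M mulmxBl mul1mx -scalemxAl -mulmxA.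
    have uE : u N.+1 = w *: (B *m (M *m u N.+1 + er N.+1)) + w *: (G *m e0) -
        w ^+ N.+1 *: U1 N.+1 by rewrite -boundary addrK.
    rewrite {1}uE mulmxDr scalerDr [LHS]addrC !addrA addNr add0r.
    by rewrite [w *: (B *m _) + _]addrC.
  have := congr1 (mulmx ell) lopE; rewrite mulmxA ellM mul0mx.
  rewrite mulmxBr mulmxDr -!scalemxAr => h.
  by apply/eqP; rewrite -subr_eq0 opprB addrA -h.
have Ge0 : (ell *m (G *m e0)) 0 0 = (ell *m G) 0 l0.
  rewrite mulmxA mxE (bigD1 l0) //= [e0 l0 _]mxE eqxx mulr1 big1 ?addr0 // => l ll0.
  by rewrite [e0 _ _]mxE (negbTE ll0) mulr0.
have keyS N : w * (ell *m (G *m e0)) 0 0 =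
    w ^+ N.+1 * (ell *m U1 N.+1) 0 0 - w * (ell *m B *m er N.+1) 0 0.
  have scE (c : C) (X : 'M[C]_1) : (c *: X) 0 0 = c * X 0 0 by rewrite mxE.
  have subE (X Y : 'M[C]_1) : (X - Y) 0 0 = X 0 0 - Y 0 0 by rewrite !mxE.
  by rewrite -scE (key N) subE !scE mulmxA.
pose lam1 : R := \sum_(i < r) modulus (ell 0 i).
pose lam2 : R := \sum_(j < m) modulus ((ell *m B) 0 j).
pose DD : R := \sum_(j < m) pnorm (D j).
have DD_ge (j : 'I_m) : pnorm (D j) <= DD.
  by rewrite /DD (bigD1 j) //= lerDl sumr_ge0 // => i _; apply: pnorm_ge0.
pose K3 := lam1 * K + modulus w * (lam2 * (DD * (KT * K))).
have small N : modulus w * modulus ((ell *m G) 0 l0) <= K3 * q ^+ N.+1.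
  rewrite -Ge0 -modulusM (keyS N); apply: (le_trans (modulusB _ _)); rewrite /K3 mulrDl.
  have qN0 : 0 <= q ^+ N.+1 by rewrite exprn_ge0 // ltW.
  apply: lerD.
    rewrite modulusM mxE /lam1 -mulrA mulr_suml.
    apply: (@le_trans _ _ (\sum_(i < r) modulus (ell 0 i) * modulus (w ^+ N.+1 * U1 N.+1 i 0))).
      rewrite -modulusM mulr_sumr; apply: (le_trans (modulus_sum _ _ _)).
      by apply: ler_sum => i _; rewrite mulrCA (modulusM (ell 0 i)).
    apply: ler_sum => i _; rewrite ler_wpM2l ?modulus_ge0 //.
    by rewrite [U1 _ _ _]mxE; apply: res_le.
  rewrite modulusM -!mulrA ler_wpM2l ?modulus_ge0 //.
  rewrite mxE /lam2 mulr_suml; apply: (le_trans (modulus_sum _ _ _)).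
  apply: ler_sum => j _; rewrite modulusM ler_wpM2l ?modulus_ge0 //.
  rewrite [er _ _ _]mxE; apply: (le_trans (pact_le _ _ (V_le _))).
  by apply: ler_wpM2r => //; apply: mulr_ge0; [exact: ltW|exact: mulr_ge0].
have d0 : 0 < modulus w * modulus ((ell *m G) 0 l0) by rewrite mulr_gt0 // modulus_gt0.
have K30 : 0 < K3.
  by have := lt_le_trans d0 (small 0%N); rewrite pmulr_lgt0 // exprn_gt0.
have q1' : 1 < q^-1 by rewrite invf_gt1.
have [N hN] := exp_unbounded (K3 / (modulus w * modulus ((ell *m G) 0 l0))) q1'.
have := small N; apply/negP; rewrite -ltNge.
apply: (@le_lt_trans _ _ (K3 * q ^+ N)).
  rewrite ler_pM2l // exprS ler_piMl ?exprn_ge0 ?ltW //.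
by move: hN; rewrite ltr_pdivrMr // exprVn mulrC ltr_pdivlMr ?exprn_gt0.
Qed.

End Instability.

(** * Absence of zeros implies strong stability *)

Section Energy.
Variable R : realType.
Local Notation C := R[i].

(** By Parseval's identity on the circle, applied to the product of P and
    the polynomial whose coefficients are the sequence u in reverse order. *)
Lemma pact_contract (P : {poly C}) (u : nat -> C) J :
  (forall x, modulus x = 1 -> modulus P.[x] <= 1) ->
  (forall j, (J <= j)%N -> u j = 0) ->
  \sum_(i < J) modulus (pact P u i) ^+ 2 <= \sum_(i < J) modulus (u i) ^+ 2.
Proof.
move=> P1 uJ; pose v := \poly_(t < J) u (J.-1 - t)%N.
have coefE (i : 'I_J) : pact P u i = (P * v)`_(rev_ord i).
  have iJ := ltn_ord i; have n_lt : (rev_ord i < J)%N by exact: ltn_ord.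
  rewrite coefM (pactE (n := (size P + J)%N)); last by rewrite leq_addr.
  rewrite (big_ord_widen_cond (size P + J) predT (fun s => P`_s * v`_(rev_ord i - s))).
    rewrite [RHS]big_mkcond /=; apply: eq_bigr => s _; rewrite ltnS.
    have [si|is_] := leqP s (J - i.+1)%N.
      have lt_J : (J - i.+1 - s < J)%N by lia.
      by rewrite coef_poly lt_J; congr (_ * u _); lia.
    by rewrite uJ ?mulr0 //; lia.
  exact: leq_trans n_lt (leq_addl _ _).
pose L := (size P + J).+1.
have vJ : (size v <= J)%N by exact: size_poly.
have vL : (size v <= L)%N by apply: leq_trans vJ _; rewrite /L leqW // leq_addl.
have PvL : (size (P * v)%R <= L)%N.
  apply: (leq_trans (size_polyMleq _ _)); apply: leq_trans (leq_pred _) _.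
  by rewrite /L leqW // leq_add2l.
have LR0 : 0 < L%:R :> R by rewrite ltr0n.
have pars := parseval_poly (1 : R).
apply: (@le_trans _ _ (\sum_(n < L) modulus (P * v)`_n ^+ 2 * 1 ^+ (2 * n))).
  have JL : (J <= L)%N by rewrite /L; lia.
  rewrite [leLHS](reindex_inj rev_ord_inj).
  under [leLHS]eq_bigr => i _ do rewrite coefE rev_ordK.
  rewrite (big_ord_widen_cond L predT (fun n => modulus (P * v)`_n ^+ 2)) //.
  rewrite big_mkcond /=; apply: ler_sum => n _; rewrite expr1n mulr1.
  by case: ifP => // _; rewrite sqr_ge0.
rewrite -(ler_pM2l LR0) -pars //; apply: (@le_trans _ _
    (\sum_(l < L) modulus v.[1%:C%C * omega R L ^+ l] ^+ 2)).
  apply: ler_sum => l _; rewrite hornerM modulusM exprMn.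
  set y := (X in P.[X]); have y1 : modulus y = 1.
    by rewrite modulusM modulus_omega modulus_real normr1 mulr1.
  rewrite ler_piMl ?sqr_ge0 //; apply: exprn_ile1; [exact: modulus_ge0|exact: P1].
rewrite pars // ler_pM2l // [X in X <= _](bigID (fun n : 'I_L => (n < J)%N)) /=.
rewrite [X in _ + X]big1 ?addr0 => [|n nJ]; last first.
  by rewrite coef_poly (negbTE nJ) modulus0 expr0n mul0r.
have JL : (J <= L)%N by rewrite /L; lia.
rewrite -(big_ord_widen L (fun n => modulus v`_n ^+ 2 * 1 ^+ (2 * n)) JL).
rewrite (reindex_inj rev_ord_inj) /=; apply: ler_sum => n _.
rewrite coef_poly expr1n mulr1 rev_ord_proof /=.
by have -> : (J.-1 - (J - n.+1) = n)%N by have := ltn_ord n; lia.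
Qed.

(** Summation by parts with the weights y^n: multiplying E (n + 1) - E n <=
    tau (n + 1) by y^(n + 1) and summing. *)
Lemma weighted_energy (E tau : nat -> R) (y : R) N : 0 <= y -> E 0%N = 0 ->
  (forall n, 0 <= E n) -> (forall n, 0 <= tau n) ->
  (forall n, E n.+1 <= E n + tau n.+1) ->
  (1 - y) * \sum_(n < N) y ^+ n * E n <= \sum_(n < N) y ^+ n * tau n.
Proof.
move=> y0 E0 E_ge0 tau_ge0 step; case: N => [|N].
  by rewrite !big_ord0 mulr0.
rewrite mulrBl mul1r lerBlDr.
have h : \sum_(n < N.+1) y ^+ n * E n <=
    y * \sum_(n < N) y ^+ n * E n + \sum_(n < N) y ^+ n.+1 * tau n.+1.
  rewrite big_ord_recl E0 mulr0 add0r mulr_sumr -big_split /=.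
  apply: ler_sum => n _; rewrite mulrA -exprS -mulrDr.
  by rewrite ler_wpM2l ?exprn_ge0.
apply: (le_trans h); rewrite addrC; apply: lerD.
  by rewrite [leRHS]big_ord_recl lerDr expr0 mul1r.
by rewrite ler_wpM2l // big_ord_recr lerDl mulr_ge0 ?exprn_ge0.
Qed.

Lemma sqr_sum_le n (u : 'I_n -> R) : (\sum_i u i) ^+ 2 <= n%:R * \sum_i u i ^+ 2.
Proof.
elim: n u => [|n IH] u; first by rewrite !big_ord0 expr0n mul0r.
rewrite !big_ord_recr /=; set S := \sum_(i < n) _; set T := \sum_(i < n) _ ^+ 2.
have := IH (fun i => u (widen_ord (leqnSn n) i)); rewrite -/S -/T => h.
have [n0|n_gt0] := posnP n.
  have S0 : S = 0 by rewrite /S big1 // => -[i iP]; exfalso; move: iP; rewrite n0.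
  have T0 : T = 0 by rewrite /T big1 // => -[i iP]; exfalso; move: iP; rewrite n0.
  by rewrite S0 T0 !add0r ler_peMl ?sqr_ge0 // ler1n.
have nR : 0 < n%:R :> R by rewrite ltr0n.
set x := u ord_max; rewrite -natr1.
suff : 2 * S * x <= n%:R * x ^+ 2 + T by rewrite sqrrD; lra.
have T_ge : S ^+ 2 / n%:R <= T by rewrite ler_pdivrMr // mulrC.
apply: le_trans (lerD (lexx _) T_ge).
have : 0 <= (n%:R * x - S) ^+ 2 / n%:R by rewrite divr_ge0 // sqr_ge0.
have -> : (n%:R * x - S) ^+ 2 / n%:R = n%:R * x ^+ 2 + S ^+ 2 / n%:R - 2 * S * x.
  by field; rewrite gt_eqF.
lra.
Qed.

End Energy.

Section Stability.
Variables (R : realType) (k p m : nat) (a : int -> R[i]) (b : int -> nat -> R[i]).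
Variables (velocity lambda : R).
Local Notation C := R[i].
Local Notation r := k.+1.
Hypothesis adm : admissible r p a.
Hypothesis m_ge : (p + r <= m)%N.
Hypothesis a_support : forall q : int, (q < - r%:Z) || (p%:Z < q) -> a q = 0.
Hypothesis velocity_gt0 : 0 < velocity.
Hypothesis lambda_gt0 : 0 < lambda.
Hypothesis lop_neq0 : forall w, modulus w <= 1 -> lop_det k p m a b w != 0.
Local Notation A := (symbol r p a).
Local Notation B := (boundary_mx r m a b).
Local Notation G := (ghost_mx k a).
Local Notation lop w := (lop_mx k p m a b w).
Local Notation comp w := (compmx k (sfactor r p a w)).
Local Notation S := (ratfun (@odisc R) (sgen k p a)).

Let SA : dd_algebra S := sgen_dda adm.

(** The first r interior values of the generating function, in the variable
    w = 1 / z, of the solution whose only datum is 1 at the ghost point l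
    and at the initial time. *)
Definition green_state (l : 'I_r) (w : C) : 'cV[C]_r :=
  w *: (invmx (lop w) *m col l G).

(** The same generating function at every grid point. It is the stable
    solution of the resolvent equation, hence generated by the powers of the
    companion matrix. *)
Definition green (l : 'I_r) (w : C) : int -> C :=
  extend m b (fun q => (comp w ^+ q *m green_state l w) 0 0)
    (fun j => (j == offset r l)%:R).

Lemma lop_unit w : modulus w <= 1 -> lop w \in unitmx.
Proof. by move=> w1; rewrite unitmxE unitfE; exact: lop_neq0. Qed.

Lemma green_ratfun l j : ratfun (@cdisc R 1 : set C) (sgen k p a) (fun w => green l w j).
Proof.
pose E : set C := @cdisc R 1.
have st (q : nat) : ratfun E (sgen k p a)
    (fun w => (comp w ^+ q *m green_state l w) 0 0).
  apply: ratmxM.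
    by apply/ratmxX/ratmx_compmx => i; apply: ratfun_sfactor.
  apply: ratmxZ; first by apply: ratfun_gen; left.
  apply: ratmxM; last exact: ratmx_cst.
  by apply: ratmx_inv; [exact: lop_unit|exact: lop_ratmx].
case: j => q /=; first exact: st.
apply: ratfunD; last exact: ratfun_cst.
by apply: ratfun_sum => q'; apply: ratfunM => //; exact: ratfun_cst.
Qed.

Lemma green_dda l j : S (fun w => green l w j).
Proof. by apply: ratfun_sub (green_ratfun l j) => w; rewrite /odisc /cdisc /= => /ltW. Qed.

Lemma green_bounded l j : exists2 M : R, 0 < M & forall w, modulus w < 1 ->
  modulus (green l w j) <= M.
Proof.
have cG : cont_on (@cdisc R 1) (fun w => green l w j).
  apply: (@ratfun_cont R R[i]^o (cdisc 1) (sgen k p a)); first exact: (sgen_cont adm).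
  exact: green_ratfun.
by have [M M0 MP] := cont_on_bounded cG; exists M => // w w1; apply: MP; exact: ltW.
Qed.

(** The powers of the companion matrix solve the interior equations, and
    lop_mx is the matrix of the first r ones. *)
Lemma green_step l w (j : nat) : modulus w < 1 ->
  green l w j%:Z = w * \sum_(s < (r + p).+1) a (offset r s) * green l w (j%:Z + offset r s).
Proof.
move=> w1; pose N := comp w; pose u := green_state l w.
have greenE (q : nat) : green l w q%:Z = (N ^+ q *m u) 0 0 by [].
have [jr|rj] := ltnP j r; last first.
  have -> : j%:Z = (j - r + r)%N%:Z by rewrite subnK.
  rewrite (@interior_stencil R k p a (green l w) (j - r)).
  have Q_dvd : sfactor r p a w %| 'X^r - w *: A.
    by rewrite -(sfactor_mul adm w1) dvdp_mulr.
  have := powmx_recurrence u (j - r) (size_sfactor adm w1) (sfactor_lead adm w1) Q_dvd.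
  rewrite -/N -/(pact ('X^r - w *: A) (fun q => (N ^+ q *m u) 0 0) (j - r)).
  by rewrite pactB pactZ pactXn => /eqP; rewrite subr_eq0 => /eqP.
have := @boundary_stencil R k p m a b a_support m_ge (green l w)
  (fun j => (j == offset r l)%:R) (Ordinal jr) _.
rewrite [nat_of_ord (Ordinal jr)]/= => ->; last first.
  by move=> l' l'r; rewrite {1}/green (offset_neg l'r) /extend.
have uE : u = w *: (B *m powmx m N *m u) + w *: col l G.
  have : lop w *m u = w *: col l G.
    by rewrite /u /green_state -scalemxAr mulKVmx // lop_unit // ltW.
  rewrite /lop_mx mulmxBl mul1mx -scalemxAl => /eqP.
  by rewrite subr_eq addrC => /eqP.
rewrite greenE mxE (bigD1 (Ordinal jr)) //= compmx_expr0 // eqxx mul1r.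
rewrite big1 ?addr0 => [|i ij]; last first.
  by rewrite compmx_expr0 // (_ : (j == i) = false) ?mul0r // eq_sym; apply/negbTE.
rewrite {1}uE -mulmxA mxE [X in X + _]mxE [X in _ + X]mxE -mulrDr; congr (_ * _).
congr (_ + _).
  rewrite mxE; apply: eq_bigr => q _; congr (_ * _).
  by rewrite mxE [RHS]mxE; apply: eq_bigr => c _; congr (_ * _); rewrite mxE.
rewrite mxE (bigD1 l) //= eqxx mulr1 big1 ?addr0 // => l' l'l.
rewrite /offset (inj_eq (addIr _)) eqz_nat.
have -> : (l' == l :> nat) = false by apply: negbTE.
by rewrite mulr0.
Qed.

Lemma green_taylor : exists c : 'I_r -> int -> nat -> C, forall l j,
  taylor S (fun w => green l w j) (c l j).
Proof.
have [c cP] := choice (fun lj : 'I_r * int => taylor_ex SA (green_dda lj.1 lj.2)).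
by exists (fun l j => c (l, j)) => l j; apply: (cP (l, j)).
Qed.

(** Duhamel's formula: by uniqueness of the solution, it suffices that the
    convolution of the Taylor coefficients of the Green functions with the
    data solves the scheme, and uniqueness of Taylor coefficients turns
    green_step into this fact. *)
Lemma green_convolution : exists c : 'I_r -> int -> nat -> C,
  (forall l j, taylor S (fun w => green l w j) (c l j)) /\
  forall g U, is_solution r p m a b (fun=> 0) g U -> forall t n : nat, (t < r + r)%N ->
    U (offset r t) n = \sum_(l < r) \sum_(n' < n.+1) c l (offset r t) (n - n')%N * g (offset r l) n'.
Proof.
have [c cP] := green_taylor; exists c; split=> // g U solU.
have c_step l (j n : nat) : c l j%:Z n =
    if n is n'.+1 then \sum_(s < (r + p).+1) a (offset r s) * c l (j%:Z + offset r s) n' else 0.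
  have step := taylorX SA (taylor_sum SA (index_enum 'I_(r + p).+1)
    (fun s : 'I_(r + p).+1 => taylorZ SA (a (offset r s)) (cP l (j%:Z + offset r s)))).
  rewrite (taylor_uniq SA (cP l j%:Z) (taylor_ext _ step)) // => w w1.
  by rewrite green_step.
have c_ghost l (l' n : nat) : (l' < r)%N -> c l (offset r l') n =
    \sum_(q < m) b (offset r l') q * c l q%:Z n +
    (if n is 0%N then (offset r l' == offset r l)%:R else 0).
  move=> l'r; have sum := taylorD SA (taylor_sum SA (index_enum 'I_m)
    (fun q : 'I_m => taylorZ SA (b (offset r l') q) (cP l q%:Z)))
    (taylor_cst SA (offset r l' == offset r l)%:R).
  rewrite (taylor_uniq SA (cP l (offset r l')) (taylor_ext _ sum)) // => w w1.
  by rewrite [RHS]/green offset_neg.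
pose V (j : int) n := \sum_(l < r) \sum_(n' < n.+1) c l j (n - n')%N * g (offset r l) n'.
have solV : is_solution r p m a b (fun=> 0) g V.
  split.
  - move=> j n; rewrite /V; under [RHS]eq_bigr => s _ do rewrite mulr_sumr.
    rewrite [RHS]exchange_big /=; apply: eq_bigr => l _.
    rewrite big_ord_recr /= subnn c_step mul0r addr0.
    under [RHS]eq_bigr => s _ do rewrite mulr_sumr.
    rewrite [RHS]exchange_big /=; apply: eq_bigr => n' _.
    rewrite subSn; last by rewrite -ltnS.
    rewrite c_step mulr_suml; apply: eq_bigr => s _.
    by rewrite mulrA.
  - move=> l' n l'r; rewrite /V.
    under eq_bigr => l _ do under eq_bigr => n' _ do rewrite c_ghost // mulrDl.
    under eq_bigr => l _ do rewrite big_split /=.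
    rewrite big_split /=; congr (_ + _).
      under [RHS]eq_bigr => q _ do rewrite mulr_sumr.
      rewrite [RHS]exchange_big /=; apply: eq_bigr => l _.
      under [RHS]eq_bigr => q _ do rewrite mulr_sumr.
      rewrite [RHS]exchange_big /=; apply: eq_bigr => n' _.
      by rewrite mulr_suml; apply: eq_bigr => q _; rewrite mulrA.
    rewrite (bigD1 (Ordinal l'r)) //= [X in _ + X]big1 ?addr0.
      rewrite big_ord_recr /= subnn eqxx mul1r big1 ?add0r // => n' _.
      case nn': (n - n')%N => [|q]; last by rewrite mul0r.
      by move/eqP: nn'; rewrite subn_eq0 leqNgt ltn_ord.
    move=> l ll'; rewrite big1 // => n' _; case: (n - n')%N => [|? ]; rewrite ?mul0r //.
    rewrite /offset (inj_eq (addIr _)) eqz_nat.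
    have -> : (l' == l :> nat) = false; last by rewrite mul0r.
    by apply/negbTE; move: ll'; apply: contraNneq => h; apply/eqP/val_inj.
  - move=> j; rewrite /V big1 // => l _; rewrite big_ord1 subn0 c_step mul0r //.
move=> t n tr; have [UV UVg] := solution_uniq solU solV n.
have [rt|tr'] := leqP r t; last exact: UVg.
have -> : offset r t = (t - r)%N%:Z by rewrite /offset; lia.
exact: UV.
Qed.

(** The Green functions are bounded on the disc, being continuous on the
    closed disc where lop_det has no zero; taylor_multiplier then bounds
    each convolution in Duhamel's formula. The indices t < 2r cover the
    ghost points and the first r interior points. *)
Lemma trace_bound : exists2 K : R, 0 < K & forall g U x N,
  is_solution r p m a b (fun=> 0) g U -> 0 < x < 1 -> forall t : nat, (t < r + r)%N ->
  \sum_(n < N) modulus (U (offset r t) n) ^+ 2 * x ^+ (2 * n) <=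
  K * \sum_(n < N) \sum_(l < r) modulus (g (offset r l) n) ^+ 2 * x ^+ (2 * n).
Proof.
have [c [cP cU]] := green_convolution.
have [M0 M0P] : exists M0 : 'I_r * nat -> R, forall lt, 0 < M0 lt /\
    forall w, modulus w < 1 -> modulus (green lt.1 w (offset r lt.2)) <= M0 lt.
  have ex (lt : 'I_r * nat) : exists M : R, 0 < M /\
      forall w, modulus w < 1 -> modulus (green lt.1 w (offset r lt.2)) <= M.
    by have [M ? ?] := green_bounded lt.1 (offset r lt.2); exists M.
  by have [M0 M0P] := choice ex; exists M0.
pose M := 1 + \sum_(t < r + r) \sum_(l < r) M0 (l, nat_of_ord t).
have sum_ge0 : 0 <= \sum_(t < r + r) \sum_(l < r) M0 (l, nat_of_ord t).
  by apply: sumr_ge0 => t _; apply: sumr_ge0 => l _; apply: ltW; exact: (M0P _).1.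
have M1 : 1 <= M by rewrite lerDl.
have M_ge (t : 'I_(r + r)) l : M0 (l, nat_of_ord t) <= M.
  rewrite /M (bigD1 t) //= (bigD1 l) //=.
  have h1 : 0 <= \sum_(i < r | i != l) M0 (i, nat_of_ord t).
    by apply: sumr_ge0 => i _; apply: ltW; exact: (M0P _).1.
  have h2 : 0 <= \sum_(i < r + r | i != t) \sum_(l < r) M0 (l, nat_of_ord i).
    by apply: sumr_ge0 => i _; apply: sumr_ge0 => l' _; apply: ltW; exact: (M0P _).1.
  lra.
have M_gt0 : 0 < M by apply: lt_le_trans M1.
exists (r%:R * M ^+ 2); first by rewrite mulr_gt0 ?ltr0n // exprn_gt0.
move=> g U x N solU x01 t tr; have x0 : 0 <= x by case/andP: x01 => /ltW.
pose conv l n := \sum_(n' < n.+1) c l (offset r t) (n - n')%N * g (offset r l) n'.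
apply: (@le_trans _ _ (\sum_(n < N) \sum_(l < r) r%:R * (modulus (conv l n) ^+ 2 * x ^+ (2 * n)))).
  apply: ler_sum => n _; rewrite (cU g U solU t n tr) -mulr_sumr -mulr_suml mulrA.
  rewrite ler_wpM2r ?exprn_ge0 //.
  apply: le_trans (sqr_sum_le (fun l => modulus (conv l n))).
  rewrite ler_sqr ?nnegrE ?modulus_ge0 ?sumr_ge0 //.
    exact: modulus_sum.
  by move=> l _; apply: modulus_ge0.
rewrite exchange_big /= [X in _ * X]exchange_big /= mulr_sumr.
apply: ler_sum => l _; rewrite -mulr_sumr -mulrA ler_wpM2l //.
rewrite /conv; apply: (taylor_multiplier SA (g (offset r l)) N
  (green_dda l (offset r t)) (cP l (offset r t)) (ltW M_gt0)) => //.
by move=> w w1; apply: le_trans ((M0P (l, t)).2 w w1) (M_ge (Ordinal tr) l).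
Qed.

(** Away from the first r points one time step is a contraction, by Cauchy
    stability, so the energy of the solution grows at most by its trace. *)
Lemma energy_step g U n : is_solution r p m a b (fun=> 0) g U ->
  \sum_(j < r * n.+1) modulus (U j%:Z n.+1) ^+ 2 <=
  \sum_(j < r * n) modulus (U j%:Z n) ^+ 2 + \sum_(j < r) modulus (U j%:Z n.+1) ^+ 2.
Proof.
move=> solU; have [Ustep _ _] := solU; rewrite mulnS big_split_ord /= addrC lerD2r.
have := pact_contract (symbol_circle adm) (finite_speed solU (n := n)).
apply: le_trans; apply: ler_sum => j _.
by rewrite addnC Ustep (@interior_stencil R k p a (U ^~ n) j).
Qed.

(** With alpha0 = 0 and x = exp (- alpha dt): trace_bound controls the ghost
    values, and weighted_energy with the first r interior values as tau
    controls the interior sum, since alpha dt / (alpha dt + 1) <= 1 - x^2. *)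
Lemma stable : strongly_stable r p m a b velocity lambda.
Proof.
have [K K0 KP] := trace_bound.
pose C1 := r%:R * K; have C10 : 0 < C1 by rewrite mulr_gt0 // ltr0n.
have vl0 : 0 < velocity / lambda by rewrite divr_gt0.
(* The second summand is for the interior sum, with dx = velocity / lambda * dt. *)
exists (C1 + C1 * (velocity / lambda)), 0; split; first by rewrite addr_gt0 // mulr_gt0.
move=> alpha alpha0 g dx dx0 U solU; cbv zeta.
set dt := lambda * dx / velocity.
have dt0 : 0 < dt by rewrite divr_gt0 // mulr_gt0.
have dxE : dx = velocity / lambda * dt by rewrite /dt; field; rewrite !gt_eqF.
have adt0 : 0 < alpha * dt by rewrite mulr_gt0.
pose x := expR (- (alpha * dt)).
have x_in : 0 < x < 1 by rewrite expR_gt0 /x expR_lt1 oppr_lt0.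
have /andP[x0 x1] := x_in.
pose w (n : nat) := x ^+ (2 * n).
have w0 n : 0 <= w n by rewrite exprn_ge0 // ltW.
have wE n : expR (- (2 * alpha * n%:R * dt)) = w n.
  by rewrite /w /x -expRM_natl; congr expR; rewrite natrM; ring.
under eq_bigr => l _ do under eq_eseriesr => n _ do rewrite wE.
under [X in (_ * X)%E]eq_eseriesr => n _ do under eq_eseriesr => j _ do rewrite wE.
under [X in (_ <= _ * X)%E]eq_bigr => l _ do under eq_eseriesr => n _ do rewrite wE.
rewrite subr0; set co := alpha / (alpha * dt + 1).
have dtw n : 0 <= dt * w n by rewrite mulr_ge0 // ltW.
have dtxw n : 0 <= dt * dx * w n by rewrite mulr_ge0 // mulr_ge0 // ltW.
have sq z (y : R) : 0 <= y -> 0 <= y * modulus z ^+ 2.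
  by move=> y0; rewrite mulr_ge0 // sqr_ge0.
pose Gam n := \sum_(l < r) dt * w n * modulus (g (offset r l) n) ^+ 2.
pose rhs : \bar R := (\sum_(0 <= n <oo) (Gam n)%:E)%E.
have swap (f : 'I_r -> nat -> R) : (forall l n, 0 <= f l n) ->
    (\sum_(l < r) \sum_(0 <= n <oo) (f l n)%:E = \sum_(0 <= n <oo) (\sum_(l < r) f l n)%:E)%E.
  move=> f0; rewrite -nneseries_sum => [|l n _]; last by rewrite lee_fin.
  by apply: eq_eseriesr => n _; rewrite sumEFin.
have Gam0 n : 0 <= Gam n by apply: sumr_ge0 => l _; apply: sq.
have rhs0 : (0 <= rhs)%E by apply: nneseries_ge0 => n _ _; rewrite lee_fin.
have partial N : ((\sum_(n < N) Gam n)%:E <= rhs)%E.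
  apply: le_trans (nneseries_lim_ge N _); last by move=> n _ _; rewrite lee_fin.
  by rewrite sumEFin big_mkord.
have partial_scale (c : R) N : 0 <= c -> ((c * \sum_(n < N) Gam n)%:E <= c%:E * rhs)%E.
  by move=> c0; rewrite EFinM; apply: lee_wpmul2l; rewrite ?lee_fin.
rewrite [X in (X + _)%E]swap => [|l n]; last exact: sq.
rewrite [X in (_ <= _ * X)%E]swap => [|l n]; last exact: sq.
have vlC : 0 <= C1 * (velocity / lambda) by apply: mulr_ge0; apply: ltW.
rewrite -/rhs EFinD ge0_muleDl ?lee_fin ?(ltW C10) //.
have trace t N : (t < r + r)%N ->
    \sum_(n < N) dt * w n * modulus (U (offset r t) n) ^+ 2 <= K * \sum_(n < N) Gam n.
  move=> tr; have := KP g U x N solU x_in t tr; rewrite -(ler_pM2l dt0).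
  rewrite mulr_sumr [X in _ <= X -> _]mulrCA mulr_sumr => h.
  apply: le_trans (le_trans h _).
    by apply: ler_sum => n _; rewrite mulrAC -mulrA.
  rewrite ler_pM2l //; apply: ler_sum => n _; rewrite mulr_sumr; apply: ler_sum => l _.
  by rewrite [leRHS]mulrAC -mulrA.
have traces (o : nat) N : (o <= r)%N ->
    \sum_(n < N) \sum_(l < r) dt * w n * modulus (U (offset r (o + l)%N) n) ^+ 2 <=
    C1 * \sum_(n < N) Gam n.
  move=> or; rewrite exchange_big /= /C1 -mulrA.
  apply: (@le_trans _ _ (\sum_(l < r) K * \sum_(n < N) Gam n)).
    by apply: ler_sum => l _; apply: trace; rewrite -addnS leq_add // ltn_ord.
  by rewrite sumr_const card_ord mulr_natl.
apply: leeD.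
  apply: series_le => [n|N]; first by apply: sumr_ge0 => l _; apply: sq.
  apply: le_trans (partial_scale C1 N (ltW C10)); rewrite lee_fin.
  exact: (traces 0%N).
pose En n := \sum_(j < r * n) modulus (U j%:Z n) ^+ 2.
have innerE n : (\sum_(0 <= j <oo) (dt * dx * w n * modulus (U j%:Z n) ^+ 2)%:E =
    (dt * dx * w n * En n)%:E)%E.
  rewrite (series_fin (N := (r * n)%N)) => [|j rj]; first by rewrite mulr_sumr.
  by rewrite (finite_speed solU rj) modulus0 expr0n mulr0.
under eq_eseriesr => n _ do rewrite innerE.
have En0 n : 0 <= En n by apply: sumr_ge0 => j _; rewrite sqr_ge0.
have co0 : 0 <= co by rewrite divr_ge0 ?ltW // addr_gt0.
rewrite -nneseriesZl => [|n _]; last by rewrite lee_fin mulr_ge0.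
under eq_eseriesr => n _ do rewrite -EFinM.
apply: series_le => [n|N]; first by rewrite mulr_ge0 // mulr_ge0.
apply: le_trans (partial_scale _ N vlC); rewrite lee_fin.
pose tau n := \sum_(l < r) modulus (U (offset r (r + l)%N) n) ^+ 2.
have tau0 n : 0 <= tau n by apply: sumr_ge0 => l _; rewrite sqr_ge0.
have Estep n : En n.+1 <= En n + tau n.+1.
  have := energy_step n solU; rewrite -/(En _) -/(En _).
  suff -> : tau n.+1 = \sum_(j < r) modulus (U j%:Z n.+1) ^+ 2 by [].
  apply: eq_bigr => j _; congr (modulus (U _ _) ^+ 2).
  by rewrite /offset PoszD addrAC subrr add0r.
have En_0 : En 0%N = 0 by rewrite /En muln0 big_ord0.
have := weighted_energy N (sqr_ge0 x) En_0 En0 tau0 Estep => energy.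
have co_le : co * dt <= 1 - x ^+ 2.
  have -> : x ^+ 2 = (expR (2 * (alpha * dt)))^-1.
    by rewrite /x -expRM_natl -expRN mulrN.
  have ex := expR_ge1Dx (2 * (alpha * dt)).
  have e0 : 0 < expR (2 * (alpha * dt)) by apply: expR_gt0.
  have h : (expR (2 * (alpha * dt)))^-1 <= (1 + alpha * dt)^-1.
    by rewrite lef_pV2 ?posrE //; lra.
  have -> : co * dt = 1 - (1 + alpha * dt)^-1.
    by rewrite /co [alpha * dt + 1]addrC; field; lra.
  lra.
have tr := traces r N (leqnn _).
have trE : \sum_(n < N) \sum_(l < r) dt * w n * modulus (U (offset r (r + l)%N) n) ^+ 2 =
    dt * \sum_(n < N) (x ^+ 2) ^+ n * tau n.
  rewrite mulr_sumr; apply: eq_bigr => n _; rewrite /tau -mulr_sumr -mulrA.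
  by rewrite /w exprM.
rewrite trE in tr.
have sumE : \sum_(n < N) co * (dt * dx * w n * En n) =
    velocity / lambda * (dt * (co * dt * \sum_(n < N) (x ^+ 2) ^+ n * En n)).
  rewrite !mulr_sumr; apply: eq_bigr => n _; rewrite {1}dxE /w exprM; ring.
rewrite sumE [C1 * _]mulrC -[leRHS]mulrA ler_pM2l //; apply: le_trans tr.
rewrite ler_pM2l //; apply: le_trans energy; rewrite ler_wpM2r //.
by apply: sumr_ge0 => n _; rewrite mulr_ge0 // exprn_ge0 // sqr_ge0.
Qed.

End Stability.

(** * The theorem *)

Theorem mainTheorem3 (R : realType) (r p m : nat)
    (a : int -> R[i]) (b : int -> nat -> R[i]) (velocity lambda : R)
    (r_ge1 : (1 <= r)%N) (p_ge1 : (1 <= p)%N) (m_ge : (p + r <= m)%N)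
    (a_support : forall q : int, (q < - r%:Z) || (p%:Z < q) -> a q = 0)
    (a_left : a (- r%:Z) != 0) (a_right : a p%:Z != 0)
    (velocity_gt0 : 0 < velocity) (lambda_gt0 : 0 < lambda)
    (a_stable : cauchy_stable r p a) :
  let Delta := KL_det r p m a b in
  let curve := fun theta : R => Delta (expi theta) in
  let Delta_S := curve @` `[0, 2 * pi] in
  let Ind := winding_number curve 0 in
  (Delta_S 0 -> exists z0 : R[i], unit_circle z0 /\ Delta z0 = 0) /\
  (~ Delta_S 0 ->
    [/\ forall z : R[i], unit_circle z -> Delta z != 0,
        has_zero_count Delta (exterior (R := R)) (r%:Z - Ind),
        Ind = r%:Z -> strongly_stable r p m a b velocity lambda
      & Ind <> r%:Z -> ~ strongly_stable r p m a b velocity lambda]).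
Proof.
case: r r_ge1 m_ge a_support a_left a_stable => // k r_ge1 m_ge a_support a_left a_stable.
move=> Delta curve Delta_S Ind; have adm : admissible k.+1 p a by split.
split=> [[theta _ curve0]|no_zero].
  by exists (expi theta); split=> //; apply/norm_eq1/modulus_expi.
have circle_neq0 z : modulus z = 1 -> Delta z != 0.
  move=> z1; have [theta theta_in zE] := expi_onto z1.
  apply: contra_notN no_zero => /eqP z0; exists theta; first by rewrite /= in_itv.
  by rewrite /curve -zE.
have count : has_zero_count Delta (exterior (R := R)) (k.+1%:Z - Ind).
  exact: KL_det_zero_count adm circle_neq0.
split=> //; first by move=> z /norm_eq1; apply: circle_neq0.
  move=> IndE; apply: (stable adm m_ge a_support velocity_gt0 lambda_gt0) => w w1.
  (* The point w = 0 stands for z = oo, where lop_det is 1. *)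
  have [->|w0] := pselect (w = 0); first by rewrite lop_det0 oner_neq0.
  have w_gt0 : 0 < modulus w by rewrite modulus_gt0; apply/eqP.
  have wV1 : 1 <= modulus w^-1 by rewrite modulusV invf_ge1.
  have detE := KL_det_eq0 m b adm wV1; rewrite -/Delta invrK in detE.
  rewrite -detE; have [wV1'|wV1'] := pselect (modulus w^-1 = 1); first exact: circle_neq0.
  have [s [sP _ size_s]] := count; move: size_s; rewrite IndE subrr => -[/size0nil s0].
  apply/eqP => Delta0; have /sP : exterior w^-1 /\ Delta w^-1 = 0.
    split=> //; rewrite /exterior /= norm_gt1 lt_neqAle wV1 andbT eq_sym.
    exact/eqP.
  by rewrite s0.
move=> IndE; have [[|z s] [sP _ size_s]] := count.
  by case: IndE; apply/eqP; rewrite eq_sym -subr_eq0 -size_s.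
have [z1 Delta0] : exterior z /\ Delta z = 0 by apply/sP; rewrite mem_head.
move: z1; rewrite /exterior /= norm_gt1 => z1.
apply: (not_stable adm m_ge a_support velocity_gt0 lambda_gt0 (w := z^-1)).
  by rewrite modulusV invf_lt1 // (lt_trans _ z1).
have detE := KL_det_eq0 m b adm (ltW z1).
by apply/eqP; rewrite -detE; apply/eqP.
Qed.
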